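(* Let $s_0>0$, $v^0\in\dot H^{s_0}$, $T>0$, and fix $\sigma$ with $0<\sigma<s_0$. For $m\in\mathbb{N}$ let $v^{(m)}$ be the (global) solution of the Galerkin system described in the context with $v^{(m)}(0)=v^0$. Then there is a subsequence of $(v^{(m)})$ that converges strongly in $L_p([0,T];\dot H^\sigma)$ for every fixed $1<p<\infty$, and weakly-$*$ in $L_\infty([0,T];\dot H^{s_0})$, to a function $v^\infty$; $v^\infty$ is a solution on $[0,T]$ of the system $\partial_t v_k=\tfrac12 ik\sum_{k_1+k_2=k}e^{3ikk_1k_2t}v_{k_1}v_{k_2}$, $k\in\mathbb{Z}_0$, with $v^\infty(0)=v^0$ (in the sense described in the context); $\|v^\infty\|_{L_\infty([0,T];\dot H^{s_0})}\le M_{s_0}$ for a constant $M_{s_0}$ depending only on $\|v^0\|_{\dot H^0}$, $T$, $\|v^0\|_{\dot H^{s_0}}$ and $s_0$; and $\|v^\infty(t)\|_{\dot H^0}=\|v^0\|_{\dot H^0}$ for almost every $t\in[0,T]$.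
   Context: Write $\mathbb{Z}_0=\mathbb{Z}\setminus\{0\}$. For $s\in\mathbb{R}$, $\dot H^s$ denotes the Hilbert space of sequences $v=(v_k)_{k\in\mathbb{Z}_0}$ of complex numbers with $v_{-k}=\overline{v_k}$ and $\|v\|_{\dot H^s}^2=\sum_{k\in\mathbb{Z}_0}|k|^{2s}|v_k|^2<\infty$. A function $v$ is a solution on $[0,T]$ with $v(0)=v^0$ of the system above if $v\in L_\infty([0,T];\dot H^0)$ and for every $k\in\mathbb{Z}_0$ and $t\in[0,T]$, $v_k(t)-v^0_k=\tfrac12 ik\int_0^t\sum_{k_1+k_2=k}e^{3ikk_1k_2\tau}v_{k_1}(\tau)v_{k_2}(\tau)\,d\tau$ (sums over $k_1,k_2\in\mathbb{Z}_0$). For $m\in\mathbb{N}$, $\Pi_m$ is the projection $(\Pi_m\varphi)_k=\varphi_k$ if $|k|\le m$, $=0$ if $|k|>m$. The Galerkin system is $$\partial_t v^{(m)}_k=\tfrac12 ik\Big(\Pi_m\sum_{k_1+k_2=\cdot}e^{3i(\cdot)k_1k_2t}(\Pi_mv^{(m)})_{k_1}(\Pi_mv^{(m)})_{k_2}\Big)_k,\qquad k\in\mathbb{Z}_0,\qquad v^{(m)}(0)=v^0,$$ i.e. for $|k|\le m$ the right side is $\tfrac12 ik\sum_{k_1+k_2=k,\,|k_1|,|k_2|\le m}e^{3ikk_1k_2t}v^{(m)}_{k_1}v^{(m)}_{k_2}$ and for $|k|>m$ it is $0$. Its solutions exist for all $t\ge0$. *)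

(* Defs.v *)
From HB Require Import structures.
From mathcomp Require Import all_boot all_order all_algebra.
From mathcomp Require Import all_classical all_reals all_analysis.
Set Implicit Arguments. Unset Strict Implicit. Unset Printing Implicit Defensive.
Import Order.TTheory GRing.Theory Num.Theory.
Import numFieldNormedType.Exports.
Local Open Scope classical_set_scope.
Local Open Scope ring_scope.

Section Defs.
Variable R : realType.

Definition cplx := (R * R)%type.
Definition csub (z w : cplx) : cplx := (z.1 - w.1, z.2 - w.2).
Definition cmul (z w : cplx) : cplx :=
  (z.1 * w.1 - z.2 * w.2, z.1 * w.2 + z.2 * w.1).
Definition cconj (z : cplx) : cplx := (z.1, - z.2).
Definition cabs2 (z : cplx) : R := z.1 ^+ 2 + z.2 ^+ 2.
Definition cexpi (th : R) : cplx := (cos th, sin th).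

(* sequences indexed by Z; the value at index 0 is irrelevant (Z_0 = Z \ {0}) *)
Definition seqZ := int -> cplx.
Definition seqZ_sub (v w : seqZ) : seqZ := fun k => csub (v k) (w k).

Definition real_seq (v : seqZ) := forall k : int, k != 0 -> v (- k) = cconj (v k).

Definition Hnorm2 (s : R) (v : seqZ) : \bar R :=
  (\sum_(0 <= n <oo)
     (((n.+1)%:R `^ (2 * s)) * (cabs2 (v (n.+1)%:Z) + cabs2 (v (- (n.+1)%:Z))))%:E)%E.
Definition Hnorm (s : R) (v : seqZ) : \bar R := (Hnorm2 s v `^ 2^-1)%E.

Definition inH (s : R) (v : seqZ) := real_seq v /\ (Hnorm2 s v < +oo)%E.

Definition Hpair (v g : seqZ) : R :=
  limn (fun N : nat => \sum_(0 <= n < N)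
          ((cmul (v (n.+1)%:Z) (cconj (g (n.+1)%:Z))).1
           + (cmul (v (- (n.+1)%:Z)) (cconj (g (- (n.+1)%:Z)))).1)).

Definition Nterm (v : seqZ) (k : int) (t : R) (k1 : int) : cplx :=
  cmul (cexpi (3 * k%:~R * k1%:~R * (k - k1)%:~R * t)) (cmul (v k1) (v (k - k1))).

(* real / imaginary parts of sum_{k1 + k2 = k, k1,k2 in Z_0} e^{3ikk1k2t} v_{k1} v_{k2},
   as the limit of the symmetric partial sums over |k1| <= N *)
Definition NRe (v : seqZ) (k : int) (t : R) : R :=
  limn (fun N : nat => \sum_(i < (2 * N).+1 |
          ((i%:Z - N%:Z) != 0) && (k - (i%:Z - N%:Z) != 0))
          (Nterm v k t (i%:Z - N%:Z)).1).
Definition NIm (v : seqZ) (k : int) (t : R) : R :=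
  limn (fun N : nat => \sum_(i < (2 * N).+1 |
          ((i%:Z - N%:Z) != 0) && (k - (i%:Z - N%:Z) != 0))
          (Nterm v k t (i%:Z - N%:Z)).2).

Definition meas_on (T : R) (v : R -> seqZ) :=
  forall k : int, measurable_fun `[0, T] (fun t => (v t k).1)
                /\ measurable_fun `[0, T] (fun t => (v t k).2).

Definition is_solution (T : R) (v : R -> seqZ) (v0 : seqZ) :=
  [/\ meas_on T v,
      (forall t, `[0, T]%classic t -> real_seq (v t)),
      (exists M : R, {ae (@lebesgue_measure R), forall t,
                         `[0, T]%classic t -> (Hnorm 0 (v t) <= M%:E)%E}) &
      (forall k : int, k != 0 -> forall t, `[0, T]%classic t ->
         csub (v t k) (v0 k) =
         cmul (0, k%:~R / 2)
              (\int[(@lebesgue_measure R)]_(tau in `[0, t]) NRe (v tau) k tau,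
               \int[(@lebesgue_measure R)]_(tau in `[0, t]) NIm (v tau) k tau))].

Definition galerkin_rhs (m : nat) (w : seqZ) (k : int) (t : R) : cplx :=
  if (absz k <= m)%N then
    cmul (0, k%:~R / 2)
      (\sum_(i < (2 * m).+1 | [&& (i%:Z - m%:Z) != 0, k - (i%:Z - m%:Z) != 0
                                 & (absz (k - (i%:Z - m%:Z))%R <= m)%N])
          (Nterm w k t (i%:Z - m%:Z)).1,
       \sum_(i < (2 * m).+1 | [&& (i%:Z - m%:Z) != 0, k - (i%:Z - m%:Z) != 0
                                 & (absz (k - (i%:Z - m%:Z))%R <= m)%N])
          (Nterm w k t (i%:Z - m%:Z)).2)
  else (0, 0).

Definition galerkin_solution (m : nat) (w : R -> seqZ) (v0 : seqZ) :=
  forall k : int, k != 0 ->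
    [/\ w 0 k = v0 k,
        {within `[0, +oo[, continuous (fun t => (w t k).1)},
        {within `[0, +oo[, continuous (fun t => (w t k).2)} &
        forall t : R, 0 < t ->
          is_derive t (1 : R) (fun t : R => (w t k).1) (galerkin_rhs m (w t) k t).1
          /\ is_derive t (1 : R) (fun t : R => (w t k).2) (galerkin_rhs m (w t) k t).2].

Definition inL1H (s T : R) (g : R -> seqZ) :=
  [/\ meas_on T g,
      (forall t, `[0, T]%classic t -> real_seq (g t)) &
      (\int[(@lebesgue_measure R)]_(t in `[0%R, T]%classic) Hnorm s (g t) < +oo)%E].

End Defs.

(* Main.v *)
(** The bound in H^s0 uniform in m rests on a modified energy. Put u_k = exp(- i k^3 t) v_k, so
    that u_k' = - i k^3 u_k + (i k / 2) sum_(a + b = k) u_a u_b, and let mu be a weight that is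
    comparable to |k|^(2 s0) and constant for |k| <= N0. On real solutions the derivative of
    E2 = sum_k mu_k |u_k|^2 is - (i / 3) sum_(a + b + c = 0) M u_a u_b u_c, where
    M = a mu_a + b mu_b + c mu_c; for mu = 1 it vanishes, whence conservation of the H^0 norm.
    In general it is cancelled by adding E3 = - (1 / 9) sum M / (a b c) u_a u_b u_c, and
    (E2 + E3)' = - (i / 6) sum M / (a b) u_a u_b (sum_(d + e = c) u_d u_e). Since |M| is at most
    min(|a|, |b|, |c|) times the weight of the largest frequency, Hilbert's inequality for the
    kernel 1 / max(|a|, |b|) bounds this by C |u|_0^2 E2, and bounds |E3| by E2 / 2 once N0 is
    large compared with |u|_0; Gronwall's lemma concludes. Only the truncation |a|, |b|, |c| <= m,
    which is symmetric, enters, so the constants do not depend on m.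

    Each mode is Lipschitz in time uniformly in m, so a subsequence converges uniformly on [0, T]
    mode by mode. The H^s0 bound makes the tails of all the series uniformly small, which upgrades
    this to uniform convergence in H^sigma, passes the quadratic term to the limit, and preserves
    the H^0 norm. *)
Require Import Defs.
From HB Require Import structures.
From mathcomp Require Import all_boot all_order all_algebra.
From mathcomp Require Import all_classical all_reals all_analysis.
From mathcomp Require Import measurable_realfun.
From mathcomp Require Import complex ring lra zify.
Set Implicit Arguments. Unset Strict Implicit. Unset Printing Implicit Defensive.
Import Order.TTheory GRing.Theory Num.Theory.
Import numFieldNormedType.Exports.
Import ComplexField.Normc.
Local Open Scope classical_set_scope.
Local Open Scope ring_scope.
Local Open Scope complex_scope.

(** The obstacle is that [s0] may be arbitrarily small. The derivative of E2 contains the smallest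
    frequency of each triple as a factor, and only an H^0 bound is available for the mode carrying
    it: one derivative is missing. Dividing by the phase recovers it. The division is legitimate
    because the zero mode is absent, so that a b c has no zeros; its price is a fourth factor u. The
    correction E3 is cubic while E2 is quadratic, so for large data it need not be dominated by E2.
    Flattening the weight removes exactly the low triples responsible, and [N0] enters the final
    bound only through N0 ^ (2 s0), hence through the H^0 norm of the datum. A Galerkin solution is
    not assumed to be real, whereas the energies equal sums of squares only on real solutions.
    Reality is therefore derived first, from uniqueness for the truncated system. Finally, the datum
    is not truncated: modes outside the window stay frozen at their initial values and are accounted
    for separately. *)

(** * Sums over symmetric frequency windows *)

(* Locked, so that simplification never unfolds the enumeration. *)
Definition box (m : nat) : seq int := locked [seq i%:Z - m%:Z | i <- iota 0 (2 * m).+1].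

Lemma mem_box m k : (k \in box m) = (absz k <= m)%N.
Proof.
rewrite /box -lock; apply/mapP/idP => [[j]|km]; first by rewrite mem_iota => ? ->; lia.
by exists (absz (k + m%:Z)); [rewrite mem_iota; lia | lia].
Qed.

Lemma succ_notin_box m j : (m <= j)%N -> (j.+1%:Z \notin box m) /\ (- j.+1%:Z \notin box m).
Proof. by rewrite !mem_box; lia. Qed.

Lemma box_uniq m : uniq (box m).
Proof. by rewrite /box -lock map_inj_uniq ?iota_uniq// => i j /addIr []. Qed.

Lemma perm_box_opp m : perm_eq (map -%R (box m)) (box m).
Proof.
apply: uniq_perm; rewrite ?box_uniq ?(map_inj_uniq oppr_inj) ?box_uniq// => k.
by rewrite -{1}[k]opprK (mem_map oppr_inj) !mem_box abszN.
Qed.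

Section BoxSum.
Variable V : nmodType.

Lemma sum_box_opp m (F : int -> V) :
  \sum_(k <- box m) F (- k) = \sum_(k <- box m) F k.
Proof. by rewrite -[RHS](perm_big _ (perm_box_opp m)) [RHS]big_map. Qed.

Lemma sum_box_ord m (P : pred int) (F : int -> V) :
  \sum_(i < (2 * m).+1 | P (i%:Z - m%:Z)) F (i%:Z - m%:Z)
    = \sum_(k <- box m | P k) F k.
Proof.
by rewrite /box -lock big_map -(big_mkord (fun i => P (i%:Z - m%:Z)) (fun i => F (i%:Z - m%:Z))) /index_iota subn0.
Qed.

Lemma sum_box_fold m (F : int -> V) :
  \sum_(k <- box m) F k
    = F 0 + \sum_(0 <= n < m) (F (n.+1)%:Z + F (- (n.+1)%:Z)).
Proof.
rewrite -(sum_box_ord _ xpredT) /=.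
elim: m => [|m IH]; first by rewrite big_ord_recl big_ord0 big_geq//.
rewrite big_nat_recr//= addrA -IH mulnS big_ord_recl big_ord_recr /=.
rewrite (_ : 0%:Z - m.+1%:Z = - m.+1%:Z); last by lia.
rewrite (_ : (lift ord0 ord_max)%:Z - m.+1%:Z = m.+1%:Z); last first.
  by rewrite /= /bump /=; lia.
rewrite (eq_bigr (fun i : 'I_(2 * m).+1 => F (i%:Z - m%:Z))); last first.
  by move=> i _; congr F; rewrite /bump /=; lia.
by rewrite addrC -addrA.
Qed.
End BoxSum.

(** * Cauchy-Schwarz and Hardy's inequality *)

Section RealSums.
Variable R : rcfType.

Lemma eq_ler (x y : R) : x = y -> x <= y.
Proof. by move=> ->. Qed.

Lemma sum_box_single m (j : int) (G : int -> R) (B : R) :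
  0 <= B -> {in box m, forall k, 0 <= G k <= B} ->
  \sum_(k <- box m | k == j) G k <= B.
Proof.
move=> B0 GB; have [jm|jm] := boolP (j \in box m).
  rewrite -big_filter (_ : [seq k <- box m | k == j] = [:: j]); last first.
    by rewrite -(filter_pred1_uniq (box_uniq m) jm); apply: eq_filter => k; rewrite /= eq_sym.
  by rewrite big_seq1; case/andP: (GB j jm).
rewrite big_seq_cond big1//.
by move=> i /andP[ib /eqP ij]; move: jm; rewrite -ij ib.
Qed.

Lemma sum_sqr_ge0 (I : Type) (r : seq I) (x : I -> R) : 0 <= \sum_(i <- r) x i ^+ 2.
Proof. by apply: sumr_ge0 => i _; exact: sqr_ge0. Qed.

Lemma cauchy_schwarz_sum (I : Type) (r : seq I) (x y : I -> R) :
  \sum_(i <- r) x i * y i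
    <= Num.sqrt (\sum_(i <- r) x i ^+ 2) * Num.sqrt (\sum_(i <- r) y i ^+ 2).
Proof.
rewrite -sqrtrM ?sum_sqr_ge0//.
apply: le_trans (ler_norm _) _; rewrite -sqrtr_sqr ler_wsqrtr//.
(* Lagrange's identity: this double sum is twice the defect in the squared Cauchy-Schwarz
   inequality. *)
have : 0 <= \sum_(i <- r) \sum_(j <- r) (x i * y j - x j * y i) ^+ 2.
  by apply: sumr_ge0 => i _; exact: sum_sqr_ge0.
have -> : \sum_(i <- r) \sum_(j <- r) (x i * y j - x j * y i) ^+ 2
   = 2 * ((\sum_(i <- r) x i ^+ 2) * (\sum_(i <- r) y i ^+ 2)
           - (\sum_(i <- r) x i * y i) ^+ 2).
  set A := \sum_(i <- r) x i ^+ 2; set B := \sum_(i <- r) y i ^+ 2.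
  set C := \sum_(i <- r) x i * y i.
  transitivity (A * B + B * A - (C * C + C * C)); last by ring.
  rewrite !big_distrlr/= -!big_split/= -sumrB.
  apply: eq_bigr => i _; rewrite -!big_split/= -sumrB.
  by apply: eq_bigr => j _; ring.
by lra.
Qed.

Section Hardy.
Variable x : nat -> R.
Let avg n : R := (\sum_(0 <= k < n) x k.+1) / n%:R.

Lemma hardy m : \sum_(0 <= n < m) avg n.+1 ^+ 2 <= 4 * \sum_(0 <= n < m) x n.+1 ^+ 2.
Proof.
(* [avg n ^ 2 - 2 avg n x n <= (n - 1) avg (n - 1) ^ 2 - n avg n ^ 2] telescopes. *)
suff H : \sum_(0 <= n < m) avg n.+1 ^+ 2
     <= \sum_(0 <= n < m) 2 * (avg n.+1 * x n.+1) - m%:R * avg m ^+ 2.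
  have h2 : \sum_(0 <= n < m) 2 * (avg n.+1 * x n.+1)
     <= \sum_(0 <= n < m) avg n.+1 ^+ 2 / 2 + \sum_(0 <= n < m) 2 * x n.+1 ^+ 2.
    rewrite -big_split/=; apply: ler_sum => n _.
    have := sqr_ge0 (avg n.+1 - 2 * x n.+1); nra.
  have h3 : 0 <= m%:R * avg m ^+ 2 by rewrite mulr_ge0 ?sqr_ge0.
  move: H h2; rewrite -mulr_suml -!mulr_sumr; lra.
elim: m => [|m IH]; first by rewrite !big_geq// mul0r subrr.
rewrite !big_nat_recr//=.
have e : x m.+1 = m.+1%:R * avg m.+1 - m%:R * avg m.
  rewrite /avg mulrC divfK ?pnatr_eq0// big_nat_recr//=.
  case: m {IH} => [|m]; first by rewrite big_geq// mul0r; ring.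
  by rewrite (mulrC m.+1%:R) divfK ?pnatr_eq0//; ring.
rewrite e; set S1 := \sum_(_ <= _ < _) _ in IH *; set S2 := \sum_(_ <= _ < _) _ in IH *.
have hm : 0 <= m%:R :> R by [].
have := mulr_ge0 hm (sqr_ge0 (avg m.+1 - avg m)).
rewrite -[m.+1%:R]natr1; move: (m%:R) (avg m) (avg m.+1) IH hm => M a b IH hm.
by nra.
Qed.
End Hardy.
End RealSums.

(** * Hilbert's inequality and sums over zero-sum triples *)

Section Hilbert.
Variable R : rcfType.

Definition l2 m (x : int -> R) : R := Num.sqrt (\sum_(k <- box m) x k ^+ 2).

Lemma l2_ge0 m x : 0 <= l2 m x. Proof. exact: sqrtr_ge0. Qed.

Lemma l2_sqr m x : l2 m x ^+ 2 = \sum_(k <- box m) x k ^+ 2.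
Proof. by rewrite sqr_sqrtr// sum_sqr_ge0. Qed.

Lemma le_l2 m x k : k \in box m -> x k <= l2 m x.
Proof.
move=> km; apply: le_trans (ler_norm _) _; rewrite -sqrtr_sqr ler_wsqrtr//.
by rewrite (bigD1_seq k) ?box_uniq//= lerDl; apply: sumr_ge0 => i _; exact: sqr_ge0.
Qed.

(** Where the first index is the larger one, the kernel depends on it alone and the inner sum
    becomes an average; Cauchy-Schwarz and Hardy's inequality then bound this half with the constant
    2. The diagonal is counted in both halves, which is harmless for nonnegative terms. *)
Lemma hilbert_nat m (X Y : nat -> R) : (forall n, 0 <= X n) -> (forall n, 0 <= Y n) ->
  \sum_(0 <= n < m) \sum_(0 <= l < m) X n.+1 * Y l.+1 / (maxn n.+1 l.+1)%:R
   <= 4 * (Num.sqrt (\sum_(0 <= n < m) X n.+1 ^+ 2)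
           * Num.sqrt (\sum_(0 <= n < m) Y n.+1 ^+ 2)).
Proof.
pose avg (Z : nat -> R) n := (\sum_(0 <= k < n) Z k.+1) / n%:R.
have half (Z W : nat -> R) : (forall n, 0 <= Z n) -> (forall n, 0 <= W n) ->
    \sum_(0 <= n < m) \sum_(0 <= l < m | (l <= n)%N) Z n.+1 * W l.+1 / (maxn n.+1 l.+1)%:R
     <= 2 * (Num.sqrt (\sum_(0 <= n < m) Z n.+1 ^+ 2)
           * Num.sqrt (\sum_(0 <= n < m) W n.+1 ^+ 2)).
  move=> Z0 W0; apply: (@le_trans _ _ (\sum_(0 <= n < m) Z n.+1 * avg W n.+1)).
    rewrite big_nat_cond [leRHS]big_nat_cond; apply: ler_sum => n /andP[/andP[_ nm] _].
    rewrite /avg mulrA mulr_sumr mulr_suml.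
    rewrite (big_nat_widen 0 n.+1 m)//.
    apply: ler_sum => l ln.
    by rewrite (maxn_idPl _).
  apply: le_trans (cauchy_schwarz_sum _ _ _) _.
  rewrite mulrCA; apply: ler_wpM2l; first exact: sqrtr_ge0.
  rewrite -[2 in leRHS]gtr0_norm// -sqrtr_sqr -sqrtrM ?sqr_ge0//.
  by apply: ler_wsqrtr; apply: le_trans (hardy W m) _; rewrite -natrX.
move=> X0 Y0; have XY := half X Y X0 Y0; have YX := half Y X Y0 X0.
apply: (@le_trans _ _ (\sum_(0 <= n < m) (\sum_(0 <= l < m | (l <= n)%N) X n.+1 * Y l.+1 / (maxn n.+1 l.+1)%:R
   + \sum_(0 <= l < m | (n <= l)%N) X n.+1 * Y l.+1 / (maxn n.+1 l.+1)%:R))).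
  apply: ler_sum => n _; rewrite [X in _ <= X + _]big_mkcond [X in _ <= _ + X]big_mkcond /=.
  rewrite -big_split/=; apply: ler_sum => l _.
  have t0 : 0 <= X n.+1 * Y l.+1 / (maxn n.+1 l.+1)%:R by rewrite !mulr_ge0// invr_ge0.
  by case: (leqP l n) => ln; [case: (leqP n l); rewrite ?lerDl ?addr0 | rewrite ltnW// add0r].
rewrite big_split/=.
have e : \sum_(0 <= n < m) \sum_(0 <= l < m | (n <= l)%N) X n.+1 * Y l.+1 / (maxn n.+1 l.+1)%:R
  = \sum_(0 <= n < m) \sum_(0 <= l < m | (l <= n)%N) Y n.+1 * X l.+1 / (maxn n.+1 l.+1)%:R.
  rewrite (exchange_big_dep xpredT)//=; apply: eq_bigr => l _; apply: eq_bigr => n _.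
  by rewrite maxnC [X _ * _]mulrC.
rewrite e; move: XY YX; rewrite [X in _ <= 2 * X -> _]mulrC; lra.
Qed.

(** Adding the values at n and - n reduces this to positive frequencies. The inequality (p + q)^2 <=
    2 (p^2 + q^2) costs a factor sqrt 2 for each sequence, whence 8 = 4 * 2. *)
Lemma hilbert m (x y : int -> R) : (forall k, 0 <= x k) -> (forall k, 0 <= y k) ->
  x 0 = 0 -> y 0 = 0 ->
  \sum_(a <- box m) \sum_(b <- box m) x a * y b / (maxn (absz a) (absz b))%:R
    <= 8 * (l2 m x * l2 m y).
Proof.
move=> x0 y0 xz yz.
pose fold (z : int -> R) (n : nat) := z n%:Z + z (- n%:Z).
have foldE z : z 0 = 0 -> Num.sqrt (\sum_(0 <= n < m) fold z n.+1 ^+ 2) <= Num.sqrt 2 * l2 m z.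
  move=> z0; rewrite -sqrtrM// ler_wsqrtr// sum_box_fold z0 expr0n add0r mulr_sumr.
  apply: ler_sum => n _; rewrite /fold.
  by have := sqr_ge0 (z n.+1%:Z - z (- n.+1%:Z)); nra.
have -> : \sum_(a <- box m) \sum_(b <- box m) x a * y b / (maxn `|a| `|b|)%:R
   = \sum_(0 <= n < m) \sum_(0 <= l < m) fold x n.+1 * fold y l.+1 / (maxn n.+1 l.+1)%:R.
  rewrite sum_box_fold big1 ?add0r; last by move=> b _; rewrite xz !mul0r.
  apply: eq_bigr => n _; rewrite !sum_box_fold yz !mulr0 !mul0r !add0r -big_split/=.
  by apply: eq_bigr => l _; rewrite ?abszN /fold; ring.
apply: le_trans (@hilbert_nat m (fold x) (fold y) _ _) _; [by move=> n; rewrite addr_ge0|by move=> n; rewrite addr_ge0|].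
have s2 : Num.sqrt 2 * Num.sqrt 2 = 2 :> R by rewrite -expr2 sqr_sqrtr.
rewrite (_ : 8 * _ = 4 * ((Num.sqrt 2 * l2 m x) * (Num.sqrt 2 * l2 m y))); last first.
  by rewrite mulrACA s2; ring.
by rewrite ler_wpM2l// ler_pM ?sqrtr_ge0 ?foldE.
Qed.

Section Tri.
Variable V : nmodType.
(** The constraint is left symmetric instead of being solved for one variable: the slots can then be
    permuted freely, on which the energy identities rest. *)
Definition tri m (F : int -> int -> int -> V) : V :=
  \sum_(a <- box m) \sum_(b <- box m) \sum_(c <- box m | a + b + c == 0) F a b c.

Lemma tri_swap12 m F : tri m F = tri m (fun a b c => F b a c).
Proof.
rewrite /tri exchange_big; apply: eq_bigr => a _; apply: eq_bigr => b _.
by apply: eq_bigl => c; rewrite (addrC a b).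
Qed.

Lemma tri_swap23 m F : tri m F = tri m (fun a b c => F a c b).
Proof.
rewrite /tri; apply: eq_bigr => a _; rewrite (exchange_big_dep xpredT)//=.
by apply: eq_bigr => b _; apply: eq_bigl => c; rewrite addrAC.
Qed.

Lemma eq_tri m F G : (forall a b c, a + b + c = 0 -> F a b c = G a b c) -> tri m F = tri m G.
Proof.
move=> FG; apply: eq_bigr => a _; apply: eq_bigr => b _; apply: eq_bigr => c /eqP.
exact: FG.
Qed.

Lemma triD m F G : tri m (fun a b c => F a b c + G a b c) = tri m F + tri m G.
Proof.
rewrite /tri -big_split; apply: eq_bigr => a _; rewrite -big_split.
by apply: eq_bigr => b _; rewrite -big_split.
Qed.
End Tri.

Lemma triZ (S : pzRingType) m (k : S) F : tri m (fun a b c => k * F a b c) = k * tri m F.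
Proof.
rewrite /tri mulr_sumr; apply: eq_bigr => a _; rewrite mulr_sumr.
by apply: eq_bigr => b _; rewrite mulr_sumr.
Qed.

Lemma le_tri m (F G : int -> int -> int -> R) :
  (forall a b c, c \in box m -> a + b + c = 0 -> F a b c <= G a b c) -> tri m F <= tri m G.
Proof.
move=> FG; apply: ler_sum => a _; apply: ler_sum => b _.
rewrite big_seq_cond [leRHS]big_seq_cond; apply: ler_sum => c /andP[cm /eqP].
exact: FG.
Qed.

(** Once [a] and [b] are chosen at most one [c] remains, so a bounded third factor costs only its
    bound. *)
Lemma tri_hilbert m (x y z : int -> R) B : (forall k, 0 <= x k) -> (forall k, 0 <= y k) ->
  x 0 = 0 -> y 0 = 0 -> 0 <= B -> {in box m, forall k, 0 <= z k <= B} ->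
  tri m (fun a b c => x a * y b / (maxn (absz a) (absz b))%:R * z c)
    <= 8 * B * (l2 m x * l2 m y).
Proof.
move=> x0 y0 xz yz B0 zB; rewrite mulrAC.
apply: le_trans (ler_wpM2r B0 (hilbert m x0 y0 xz yz)).
rewrite /tri mulr_suml; apply: ler_sum => a _; rewrite mulr_suml; apply: ler_sum => b _.
rewrite -mulr_sumr ler_wpM2l ?mulr_ge0 ?invr_ge0//.
rewrite (eq_bigl (fun c => c == - (a + b))); first exact: sum_box_single.
by move=> c; rewrite addr_eq0 -eqr_oppLR eq_sym.
Qed.

Definition conv m (x y : int -> R) c := \sum_(d <- box m) \sum_(e <- box m | d + e == c) x d * y e.

Lemma conv_ge0 m x y c : (forall k, 0 <= x k) -> (forall k, 0 <= y k) -> 0 <= conv m x y c.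
Proof. by move=> x0 y0; do 2!apply: sumr_ge0 => ? _; rewrite mulr_ge0. Qed.

(** Young's inequality from l2 and l2 into the bounded sequences. *)
Lemma conv_le m x y c : conv m x y c <= l2 m x * l2 m y.
Proof.
rewrite /conv; under eq_bigr do rewrite -mulr_sumr.
apply: le_trans (cauchy_schwarz_sum _ _ _) _.
rewrite ler_wpM2l ?sqrtr_ge0// ler_wsqrtr//.
(* At most one [e] meets the constraint, so the square passes inside the sum. *)
have single d (z : int -> R) : (\sum_(e <- box m | d + e == c) z e) ^+ 2
    = \sum_(e <- box m | d + e == c) z e ^+ 2.
  have [jm|jm] := boolP (c - d \in box m); last first.
    rewrite big_seq_cond [RHS]big_seq_cond !big_pred0 ?expr0n// => e;
    by apply/negbTE/negP => /andP[em /eqP de]; move: jm; rewrite -de addrAC subrr add0r em.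
  have e : [seq e <- box m | d + e == c] = [:: c - d].
    rewrite -(filter_pred1_uniq (box_uniq m) jm); apply: eq_filter => e /=.
    by apply/eqP/eqP; lia.
  by rewrite -big_filter e -[RHS]big_filter e !big_seq1.
under eq_bigr do rewrite single.
rewrite (exchange_big_dep xpredT)//=; apply: ler_sum => e _.
rewrite (eq_bigl (fun d => d == c - e)); last by move=> d; apply/eqP/eqP; lia.
by apply: sum_box_single => *; rewrite ?sqr_ge0 ?lexx.
Qed.
End Hilbert.

(** * The commutator symbol *)

Lemma sorted_triple (P : int -> int -> int -> Prop) :
  (forall a b c, P a b c -> P b a c) -> (forall a b c, P a b c -> P a c b) ->
  (forall a b c, (absz c <= absz b <= absz a)%N -> P a b c) ->
  forall a b c, P a b c.
Proof.
move=> P12 P23 Ps a b c.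
case: (leqP (absz a) (absz b)) => ab; case: (leqP (absz b) (absz c)) => bc;
  case: (leqP (absz a) (absz c)) => ac.
- by apply/P12/P23/P12/Ps; lia.
- by exfalso; lia.
- by apply/P12/P23/Ps; lia.
- by apply/P12/Ps; lia.
- by apply/P23/P12/Ps; lia.
- by apply/P23/Ps; lia.
- by exfalso; lia.
- by apply/Ps; lia.
Qed.

Section Weight.
Variable R : rcfType.

(** A mean value estimate in polynomial form. Replacing the first factor [q] by [p] gives a stronger
    inequality that goes through by induction. *)
Lemma powB_le n (p q : R) : 0 <= q -> q <= p -> q * (p ^+ n - q ^+ n) <= n%:R * (p - q) * p ^+ n.
Proof.
move=> q0 qp; apply: (@le_trans _ _ (p * (p ^+ n - q ^+ n))).
  by rewrite ler_wpM2r// subr_ge0 lerXn2r// nnegrE (le_trans q0).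
elim: n => [|n IH]; first by rewrite !expr0 subrr mulr0 !mul0r.
have qn : q ^+ n <= p ^+ n by rewrite lerXn2r// nnegrE (le_trans q0).
rewrite !exprS -[n.+1%:R]natr1.
have p0 := le_trans q0 qp.
have := ler_wpM2l p0 IH.
have := mulr_ge0 (mulr_ge0 p0 _ : 0 <= p * (p - q)) (_ : 0 <= p ^+ n - q ^+ n).
rewrite !subr_ge0 => /(_ qp qn).
move: (p ^+ n) (q ^+ n) (n%:R : R) => P Q N; nra.
Qed.

(* [nu ^ 2] grows at most like the [n]-th power, and is constant on the modes up to [N0]: the
   commutator symbol below then vanishes on triples of low modes, which gains a factor
   [1 / N0] in the cubic correction of the energy. *)
Record weight (n : nat) (N0 : nat) (nu : nat -> R) : Prop := Weight {
  weight_gt0 : forall k, 0 < nu k;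
  weight_mono : {homo nu : j k / (j <= k)%N >-> j <= k};
  weight_pow : forall j k, (j <= k)%N -> nu k ^+ 2 * j%:R ^+ n <= nu j ^+ 2 * k%:R ^+ n;
  weight_cst : forall k, (k <= N0)%N -> nu k = nu 0%N }.

(** The symbol M of the overview for mu = [nu] ^ 2; [nu] itself is the weight of a single factor in
    an l2 norm. *)
Definition symb (nu : nat -> R) (a b c : int) : R :=
  a%:~R * nu (absz a) ^+ 2 + b%:~R * nu (absz b) ^+ 2 + c%:~R * nu (absz c) ^+ 2.

Variables (n N0 : nat) (nu : nat -> R).
Hypothesis nuW : weight n N0 nu.

Let nu0 k : 0 < nu k. Proof. exact: (weight_gt0 nuW). Qed.

Lemma weight_double j k : (k <= 2 * j)%N -> nu k <= 2 ^+ n * nu j.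
Proof.
move=> kj.
have n1 : 1 <= 2 ^+ n :> R by rewrite exprn_ege1// ler1n.
have [jk|/ltnW kj'] := leqP j k; last first.
  by apply: le_trans (weight_mono nuW kj') _; rewrite ler_peMl// ltW.
have [j0|j0] := posnP j.
  move: kj; rewrite j0 muln0 leqn0 => /eqP ->; rewrite ler_peMl// ltW//.
have nk : nu k \is Num.nneg by rewrite nnegrE ltW.
have nj : 2 ^+ n * nu j \is Num.nneg by rewrite nnegrE mulr_ge0 ?exprn_ge0// ltW.
rewrite -(@ler_pXn2r _ 2)//.
apply: (@le_trans _ _ (2 ^+ n * nu j ^+ 2)); last first.
  by rewrite exprMn ler_wpM2r ?sqr_ge0// ler_eXnr.
have jn0 : 0 < j%:R ^+ n :> R by rewrite exprn_gt0// ltr0n.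
rewrite -(ler_pM2r jn0); apply: le_trans (weight_pow nuW jk) _.
rewrite [leRHS]mulrAC -exprMn [leRHS]mulrC ler_wpM2l ?sqr_ge0// -natrM.
by rewrite lerXn2r ?nnegrE// ler_nat.
Qed.

Lemma weight_add (d e : int) : nu (absz (d + e)) <= 2 ^+ n * (nu (absz d) + nu (absz e)).
Proof.
have n0 : 0 <= 2 ^+ n :> R by rewrite exprn_ge0.
case: (leqP (absz d) (absz e)) => de.
  have /weight_double : (absz (d + e)%R <= 2 * absz e)%N by lia.
  by move=> /le_trans; apply; rewrite ler_wpM2l// lerDr ltW.
have /weight_double : (absz (d + e)%R <= 2 * absz d)%N by lia.
by move=> /le_trans; apply; rewrite ler_wpM2l// lerDl ltW.
Qed.

(** The left side splits as q (nu(q+r)^2 - nu(q)^2) + r (nu(q+r)^2 - nu(r)^2), both terms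
    nonnegative. The polynomial growth of the weight bounds the first by n r nu(q+r)^2, the second
    is at most r nu(q+r)^2: the factor gained is [r] and not the large frequency q + r. *)
Lemma weight_commutator q r :
  `|(q + r)%:R * nu (q + r) ^+ 2 - q%:R * nu q ^+ 2 - r%:R * nu r ^+ 2|
    <= n.+1%:R * r%:R * nu (q + r) ^+ 2.
Proof.
have sq j k : (j <= k)%N -> nu j ^+ 2 <= nu k ^+ 2.
  move=> jk; apply: lerXn2r; [by rewrite nnegrE ltW|by rewrite nnegrE ltW|].
  exact: (weight_mono nuW).
have hq := sq q (q + r)%N (leq_addr _ _); have hr := sq r (q + r)%N (leq_addl _ _).
have key : q%:R * (nu (q + r) ^+ 2 - nu q ^+ 2) <= n%:R * r%:R * nu (q + r) ^+ 2.
  have [q0|q0] := posnP q.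
    by rewrite q0 mulr0n mul0r !mulr_ge0// ltW.
  have pn0 : 0 < (q + r)%:R ^+ n :> R by rewrite exprn_gt0// ltr0n addn_gt0 q0.
  rewrite -(ler_pM2r pn0).
  have := weight_pow nuW (leq_addr r q).
  have := @powB_le n (q + r)%:R q%:R (ler0n _ _); rewrite ler_nat leq_addr => /(_ isT).
  rewrite (_ : (q + r)%:R - q%:R = r%:R); last by rewrite natrD addrAC subrr add0r.
  move=> /(ler_wpM2r (sqr_ge0 (nu (q + r)))) h1.
  move=> /(ler_wpM2l (ler0n R q)) h2.
  move: h1 h2.
  move: (nu (q + r) ^+ 2) (nu q ^+ 2) ((q + r)%:R ^+ n) (q%:R ^+ n) => A B P Q; nra.
have q0 := ler0n R q; have r0 := ler0n R r.
have n0 : 0 <= nu r ^+ 2 by rewrite sqr_ge0.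
rewrite natrD -[n.+1%:R]natr1 ler_norml.
move: (nu (q + r) ^+ 2) (nu q ^+ 2) (nu r ^+ 2) hq hr n0 key => A B C hq hr n0 key.
have := mulr_ge0 q0 (_ : 0 <= A - B); rewrite subr_ge0 => /(_ hq) h1.
have := mulr_ge0 r0 (_ : 0 <= A - C); rewrite subr_ge0 => /(_ hr) h2.
have A0 : 0 <= A by lra.
have := mulr_ge0 (mulr_ge0 (ler0n R n) r0) A0 => h3.
have := mulr_ge0 r0 A0 => h4.
have := mulr_ge0 r0 n0 => h5.
apply/andP; split; nra.
Qed.

Lemma weight_ge0 k : 0 <= nu k. Proof. exact: ltW. Qed.

Lemma symbC12 a b c : symb nu a b c = symb nu b a c.
Proof. by rewrite /symb (addrC (a%:~R * _)). Qed.

Lemma symbC23 a b c : symb nu a b c = symb nu a c b.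
Proof. by rewrite /symb addrAC. Qed.

(** The factor n + 1 comes from the commutator estimate, 2 ^ n from moving one weight from the
    largest frequency to the middle one. *)
Definition symbC : R := n.+1%:R * 2 ^+ n.

Lemma symbC_ge0 : 0 <= symbC. Proof. by rewrite mulr_ge0// exprn_ge0. Qed.

(** The largest frequency has the sign opposite to the other two and |a| = |b| + |c|, so up to sign
    the symbol is the commutator with q = |b|, r = |c|. Since |a| <= 2 |b|, doubling turns one
    factor nu(|a|) into nu(|b|). *)
Lemma symb_sorted a b c : a + b + c = 0 -> (absz c <= absz b <= absz a)%N ->
  `|symb nu a b c| <= symbC * (absz c)%:R * (nu (absz a) * nu (absz b)).
Proof.
move=> abc cba.
have aE : absz a = (absz b + absz c)%N by lia.
have -> : `|symb nu a b c| = `|(absz a)%:R * nu (absz a) ^+ 2 - (absz b)%:R * nu (absz b) ^+ 2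
                - (absz c)%:R * nu (absz c) ^+ 2|.
  have [a0|a0] := lerP 0 a.
    have ea : a = (absz a)%:Z by lia.
    have eb : b = - (absz b)%:Z by lia.
    have ec : c = - (absz c)%:Z by lia.
    by rewrite /symb {1}ea {1}eb {1}ec !mulrNz !mulNr.
  have ea : a = - (absz a)%:Z by lia.
  have eb : b = (absz b)%:Z by lia.
  have ec : c = (absz c)%:Z by lia.
  by rewrite /symb {1}ea {1}eb {1}ec !mulrNz !mulNr -normrN !opprD !opprK.
rewrite {1 2}aE; apply: le_trans (weight_commutator _ _) _; rewrite -aE /symbC.
rewrite -!mulrA ler_wpM2l// [leRHS]mulrCA ler_wpM2l// expr2 [leRHS]mulrCA ler_wpM2l ?(ltW (nu0 _))//.
by apply: weight_double; lia.
Qed.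

(** Summing over the three pairs makes the right side symmetric; one of the pairs consists of the
    two largest frequencies, which reduces the claim to the sorted case. *)
Lemma symb_le_min a b c : a + b + c = 0 ->
  `|symb nu a b c| <= symbC * (minn (absz a) (minn (absz b) (absz c)))%:R *
    (nu (absz a) * nu (absz b) + nu (absz b) * nu (absz c) + nu (absz a) * nu (absz c)).
Proof.
move: a b c; apply: sorted_triple => [a b c H|a b c H|a b c cba] abc.
- rewrite symbC12 minnCA; apply: le_trans (H _) _; first by lia.
  by apply: eq_ler; ring.
- rewrite symbC23 (minnC (absz c)); apply: le_trans (H _) _; first by lia.
  by apply: eq_ler; ring.
rewrite (_ : minn _ _ = absz c); last by lia.
apply: le_trans (symb_sorted abc cba) _.
rewrite ler_wpM2l ?mulr_ge0 ?symbC_ge0// -addrA lerDl.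
by rewrite addr_ge0// mulr_ge0// ltW.
Qed.

(** As |a b| is the product of min(|a|, |b|) and max(|a|, |b|), the minimum gained from the symbol
    cancels and Hilbert's kernel is left. *)
Lemma symb_quotient2 a b c : a + b + c = 0 -> a != 0 -> b != 0 ->
  `|symb nu a b c| / ((absz a)%:R * (absz b)%:R) <=
   symbC * (nu (absz a) * nu (absz b) + nu (absz b) * nu (absz c) + nu (absz a) * nu (absz c))
     / (maxn (absz a) (absz b))%:R.
Proof.
move=> abc a0 b0.
have ab : (absz a * absz b = minn (absz a) (absz b) * maxn (absz a) (absz b))%N.
  by rewrite minnE maxnE; case: (leqP (absz a) (absz b)) => h; nia.
have m0 : 0 < (minn (absz a) (absz b))%:R :> R by rewrite ltr0n; lia.
have M0 : 0 < (maxn (absz a) (absz b))%:R :> R by rewrite ltr0n; lia.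
rewrite -natrM ab natrM ler_pdivrMr ?mulr_gt0//.
apply: le_trans (symb_le_min abc) _; set P := _ + _ + _.
rewrite (_ : symbC * P / _ * _ = symbC * (minn (absz a) (absz b))%:R * P); last first.
  by field; rewrite gt_eqF.
apply: ler_wpM2r; first by rewrite !addr_ge0// mulr_ge0// ltW.
by rewrite ler_wpM2l ?symbC_ge0// ler_nat; lia.
Qed.

(** In the sorted case, if |a| <= N0 then [nu] is constant on the triple and the symbol is a
    multiple of a + b + c = 0. Otherwise N0 <= |a| <= 2 |b|, so that N0 / (|a| |b|) <= 2 / |a|,
    while |c| cancels against the symbol. *)
Lemma symb_quotient3 a b c : a + b + c = 0 -> a != 0 -> b != 0 -> c != 0 ->
  N0%:R * (`|symb nu a b c| / ((absz a)%:R * (absz b)%:R * (absz c)%:R)) <=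
   2 * symbC * (nu (absz a) * nu (absz b) / (maxn (absz a) (absz b))%:R
       + nu (absz b) * nu (absz c) / (maxn (absz b) (absz c))%:R
       + nu (absz a) * nu (absz c) / (maxn (absz a) (absz c))%:R).
Proof.
have gt0 (k : int) : k != 0 -> 0 < (absz k)%:R :> R by rewrite ltr0n; lia.
move: a b c; apply: sorted_triple => [a b c H|a b c H|a b c cba] abc a0 b0 c0.
- rewrite symbC12 (mulrC (absz b)%:R (absz a)%:R); apply: le_trans (H _ _ _ _) _ => //; first by lia.
  by apply: eq_ler; rewrite maxnC; ring.
- rewrite symbC23 (mulrAC (absz a)%:R (absz c)%:R); apply: le_trans (H _ _ _ _) _ => //; first by lia.
  by apply: eq_ler; rewrite (maxnC (absz c)); ring.
have [aN|Na] := leqP (absz a) N0.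
  have -> : symb nu a b c = 0.
    rewrite /symb !(weight_cst nuW); try lia.
    by rewrite -!mulrDl -!intrD abc mul0r.
  rewrite normr0 mul0r mulr0 !mulr_ge0 ?symbC_ge0// !addr_ge0// mulr_ge0 ?invr_ge0// mulr_ge0// ltW//.
rewrite -addrA mulrDr -[leLHS]addr0 lerD//; last first.
  by rewrite !mulr_ge0 ?symbC_ge0// !addr_ge0// mulr_ge0 ?invr_ge0// mulr_ge0// ltW.
rewrite (maxn_idPl _); last by case/andP: cba.
have A0 := gt0 _ a0; have B0 := gt0 _ b0; have C0 := gt0 _ c0.
have s := symb_sorted abc cba.
have NA : N0%:R <= (absz a)%:R :> R by rewrite ler_nat ltnW.
have AB : (absz a)%:R <= 2 * (absz b)%:R :> R by rewrite -natrM ler_nat; lia.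
rewrite mulrA ler_pdivrMr ?mulr_gt0//.
apply: le_trans (ler_pM (ler0n _ _) (normr_ge0 _) NA s) _.
set x := _ * nu (absz b); have x0 : 0 <= x by rewrite mulr_ge0 ?ltW.
move: symbC symbC_ge0 => K K0.
have -> : 2 * K * (x / `|a|%N%:R) * (`|a|%N%:R * `|b|%N%:R * `|c|%N%:R)
   = (K * x * `|c|%N%:R) * (2 * `|b|%N%:R) by field; rewrite gt_eqF.
have -> : `|a|%N%:R * (K * `|c|%N%:R * x) = (K * x * `|c|%N%:R) * `|a|%N%:R by ring.
by rewrite ler_wpM2l// mulr_ge0// mulr_ge0.
Qed.

Variables (m : nat) (A : int -> R).
Hypotheses (A0 : forall k, 0 <= A k) (Az : A 0 = 0).
Let B k := nu (absz k) * A k.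
Let B0 k : 0 <= B k. Proof. by rewrite mulr_ge0// weight_ge0. Qed.
Let Bz : B 0 = 0. Proof. by rewrite /B Az mulr0. Qed.

(** In each of the three terms the weighted factors sit under Hilbert's kernel and the unweighted
    one is bounded by its l2 norm. The constant is 48 = 2 * 3 * 8. *)
Lemma trilinear_correction_bound :
  N0%:R * tri m (fun a b c => `|symb nu a b c| / ((absz a)%:R * (absz b)%:R * (absz c)%:R)
       * (A a * A b * A c)) <= 48 * symbC * l2 m A * l2 m B ^+ 2.
Proof.
pose F a b c := B a * B b / (maxn (absz a) (absz b))%:R * A c.
have tF : tri m F <= 8 * l2 m A * (l2 m B * l2 m B).
  by apply: tri_hilbert => // [|k km]; rewrite ?l2_ge0// A0/=; exact: le_l2.
apply: (@le_trans _ _ (2 * symbC * (tri m F + tri m (fun a b c => F b c a) + tri m (fun a b c => F a c b)))).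
  rewrite -triZ -!triD -triZ; apply: le_tri => a b c _ abc.
  have rhs0 : 0 <= 2 * symbC * (F a b c + F b c a + F a c b).
    by rewrite mulr_ge0 ?mulr_ge0 ?symbC_ge0// !addr_ge0// mulr_ge0// mulr_ge0 ?invr_ge0// mulr_ge0.
  have [az|az] := eqVneq a 0; first by rewrite {3}az Az !mul0r mulr0 mulr0.
  have [bz|bz] := eqVneq b 0; first by rewrite {3}bz Az !(mulr0,mul0r).
  have [cz|cz] := eqVneq c 0; first by rewrite {3}cz Az !(mulr0,mul0r).
  rewrite mulrA.
  apply: le_trans (ler_wpM2r _ (symb_quotient3 abc az bz cz)) _.
    by rewrite !mulr_ge0.
  by apply: eq_ler; rewrite /F /B; ring.
rewrite -[tri m (fun a b c => F b c a)](tri_swap12 m (fun a b c => F a c b)).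
rewrite -(tri_swap23 m F).
have := symbC_ge0; move: tF; nra.
Qed.

(** If the weights fall on [a] and [b], the convolution is bounded by the squared l2 norm of [A]. If
    one falls on [c] = d + e (up to renaming), it is distributed over the two factors of the
    convolution by [weight_add]. The constants add up to 8 + 2 * 8 * (2 * 2 ^ n). *)
Lemma quadrilinear_bound :
  tri m (fun a b c => `|symb nu a b c| / ((absz a)%:R * (absz b)%:R)
       * (A a * A b * conv m A A c)) <= symbC * (8 + 32 * 2 ^+ n) * l2 m A ^+ 2 * l2 m B ^+ 2.
Proof.
pose K a b := (maxn (absz a) (absz b))%:R : R.
pose nuS c := nu (absz c) * conv m A A c.
have S0 c : 0 <= conv m A A c by exact: conv_ge0.
have nuS0 c : 0 <= nuS c by rewrite mulr_ge0 ?weight_ge0.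
have n0 : 0 <= 2 ^+ n :> R by rewrite exprn_ge0.
have nuSle c : nuS c <= 2 * 2 ^+ n * (l2 m A * l2 m B).
  apply: (@le_trans _ _ (2 ^+ n * (conv m B A c + conv m A B c))).
    rewrite /nuS /conv -big_split mulr_sumr mulr_sumr/=; apply: ler_sum => d _.
    rewrite -big_split mulr_sumr mulr_sumr/=; apply: ler_sum => e /eqP <-.
    rewrite (_ : 2 ^+ n * _ = 2 ^+ n * (nu (absz d) + nu (absz e)) * (A d * A e)); last first.
      by rewrite /B; ring.
    by rewrite ler_wpM2r ?mulr_ge0//; exact: weight_add.
  rewrite -mulrA mulrCA; apply: ler_wpM2l => //.
  by have := conv_le m A B c; have := conv_le m B A c; rewrite (mulrC (l2 m B)); lra.
have t1 : tri m (fun a b c => B a * B b / K a b * conv m A A c)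
    <= 8 * l2 m A ^+ 2 * (l2 m B * l2 m B).
  apply: tri_hilbert => // [|c _]; rewrite ?sqr_ge0// S0/= expr2; exact: conv_le.
have lAB : 0 <= 2 * 2 ^+ n * (l2 m A * l2 m B) by rewrite !mulr_ge0 ?l2_ge0.
have t2 : tri m (fun a b c => A a * B b / K a b * nuS c)
    <= 8 * (2 * 2 ^+ n * (l2 m A * l2 m B)) * (l2 m A * l2 m B).
  by apply: tri_hilbert => // c _; rewrite nuS0 nuSle.
have t3 : tri m (fun a b c => B a * A b / K a b * nuS c)
    <= 8 * (2 * 2 ^+ n * (l2 m A * l2 m B)) * (l2 m B * l2 m A).
  by apply: tri_hilbert => // c _; rewrite nuS0 nuSle.
apply: (@le_trans _ _ (symbC * (tri m (fun a b c => B a * B b / K a b * conv m A A c)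
   + tri m (fun a b c => A a * B b / K a b * nuS c)
   + tri m (fun a b c => B a * A b / K a b * nuS c)))).
  rewrite -!triD -triZ; apply: le_tri => a b c _ abc.
  have rhs0 : 0 <= symbC * (B a * B b / K a b * conv m A A c + A a * B b / K a b * nuS c
     + B a * A b / K a b * nuS c).
    by rewrite mulr_ge0 ?symbC_ge0// !addr_ge0// mulr_ge0// mulr_ge0 ?invr_ge0// mulr_ge0.
  have [az|az] := eqVneq a 0; first by rewrite {3}az Az !(mulr0,mul0r).
  have [bz|bz] := eqVneq b 0; first by rewrite {3}bz Az !(mulr0,mul0r).
  apply: le_trans (ler_wpM2r _ (symb_quotient2 abc az bz)) _.
    by rewrite !mulr_ge0.
  by apply: eq_ler; rewrite /nuS /B /K; ring.
rewrite -mulrA -[leRHS]mulrA ler_wpM2l ?symbC_ge0//.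
by move: t1 t2 t3; move: (l2 m A) (l2 m B) (2 ^+ n) => p q r; nra.
Qed.
End Weight.

(** * The Galerkin flow *)

Section C1.
Variable R : realType.
Implicit Types f g : R -> R.

(* Galerkin solutions are only assumed continuous from the right at [0]. *)
Definition C1half f f' := {within `[0, +oo[, continuous f} /\
  forall t : R, 0 < t -> is_derive t (1 : R) f (f' t).

Lemma C1half_eq f g f' g' : f =1 g -> (forall t : R, 0 < t -> f' t = g' t) -> C1half f f' -> C1half g g'.
Proof.
move=> /funext <- e [c d]; split=> // t t0; rewrite -e//; exact: d.
Qed.

Lemma C1half_cst (k : R) : C1half (fun=> k) (fun=> 0).
Proof. by split=> [x|t _]; [exact: cvg_cst|exact: is_derive_cst]. Qed.

Lemma C1halfD f g f' g' : C1half f f' -> C1half g g' ->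
  C1half (fun t => f t + g t) (fun t => f' t + g' t).
Proof.
move=> [cf df] [cg dg]; split=> [x|t t0]; first by apply: cvgD; [exact: cf|exact: cg].
by apply: is_deriveD; [exact: df|exact: dg].
Qed.

Lemma C1halfM f g f' g' : C1half f f' -> C1half g g' ->
  C1half (fun t => f t * g t) (fun t => f' t * g t + f t * g' t).
Proof.
move=> [cf df] [cg dg]; split=> [x|t t0]; first by apply: cvgM; [exact: cf|exact: cg].
have := is_deriveM (df t t0) (dg t t0); rewrite /GRing.scale /= => h.
by rewrite addrC (mulrC (f' t)).
Qed.

Lemma C1halfN f f' : C1half f f' -> C1half (fun t => - f t) (fun t => - f' t).
Proof.
move=> h; apply: C1half_eq (C1halfM (C1half_cst (-1)) h) => [t|t _] /=; rewrite ?mul0r ?add0r mulN1r//.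
Qed.

Lemma C1half_entire f f' : (forall t : R, is_derive t (1 : R) f (f' t)) -> C1half f f'.
Proof.
move=> d; split=> [|t _]; last exact: d.
apply: continuous_subspaceT => x; apply: differentiable_continuous.
by apply/derivable1_diffP; have [] := d x.
Qed.

Lemma is_derive_comp_scale (F F' : R -> R) (c t : R) :
  (forall x : R, is_derive x (1 : R) F (F' x)) ->
  is_derive t (1 : R) (fun u => F (c * u)) (c * F' (c * t)).
Proof.
move=> dF; have d1 : is_derive t (1 : R) ( *%R c) c.
  by have := is_deriveZ c (is_derive_id t (1 : R)); rewrite /GRing.scale /= mulr1.
by have := is_derive1_comp (dF (c * t)) d1; rewrite mulrC.
Qed.

Lemma C1half_sin (c : R) : C1half (fun t => sin (c * t)) (fun t => c * cos (c * t)).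
Proof.
by apply: C1half_entire => t; exact: is_derive_comp_scale.
Qed.

Lemma C1half_cos (c : R) : C1half (fun t => cos (c * t)) (fun t => - (c * sin (c * t))).
Proof.
apply: C1half_entire => t; rewrite -mulrN.
exact: (@is_derive_comp_scale _ (fun x => - sin x)).
Qed.

Lemma gronwall f f' (K T : R) : C1half f f' -> (forall t : R, 0 < t < T -> f' t <= K * f t) ->
  forall t : R, 0 <= t <= T -> f t <= f 0 * expR (K * t).
Proof.
move=> [cf df] le t /andP[t0 tT].
pose g (s : R) := f s * expR (- K * s).
have de (x : R) : is_derive x (1 : R) (fun s : R => expR (- K * s)) (- K * expR (- K * x)).
  exact: is_derive_comp_scale.
have dg (x : R) : 0 < x -> is_derive x (1 : R) g ((f' x - K * f x) * expR (- K * x)).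
  move=> x0; have h := df x x0; have h2 := de x; apply: is_derive_eq.
  by rewrite /GRing.scale /=; ring.
have gcont : {within `[0, T], continuous g}.
  have sub : `[0, T] `<=` `[0, +oo[.
    by move=> x /=; rewrite !in_itv/= andbT => /andP[].
  apply: (continuous_subspaceW sub) => x; apply: cvgM; first exact: cf.
  apply: continuous_subspaceT x => x; apply: continuous_comp; last exact: continuous_expR.
  by apply: cvgM; [exact: cvg_cst|exact: cvg_id].
have gd (x : R) : x \in `]0, T[ -> derivable g x 1.
  by rewrite in_itv/= => /andP[x0 _]; have [] := dg x x0.
have gd0 (x : R) : x \in `]0, T[ -> derive1 g x <= 0.
  rewrite in_itv/= => xT; rewrite derive1E; have [_ ->] := dg x (andP xT).1.
  by rewrite pmulr_lle0 ?expR_gt0// subr_le0; exact: le.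
have := ler0_derive1_nincr gd gd0 gcont (lexx 0) t0 tT.
rewrite /g mulr0 expR0 mulr1 mulNr expRN => h.
by rewrite -ler_pdivrMr ?expR_gt0.
Qed.

Lemma C1half_const f : C1half f (fun=> 0) -> forall t : R, 0 <= t -> f t = f 0.
Proof.
move=> h t t0; apply/eqP; rewrite eq_le.
have tt : 0 <= t <= t by rewrite t0 lexx.
have h1 := @gronwall f (fun=> 0) 0 t h; have h2 := C1halfN h.
have {}h2 := @gronwall _ _ 0 t h2.
have := h1 _ t tt; rewrite mul0r expR0 mulr1 => ->; last by move=> *; rewrite mul0r.
by have := h2 _ t tt; rewrite mul0r expR0 mulr1 lerN2; apply => *; rewrite mul0r oppr0.
Qed.

End C1.

Section ComplexC1.
Variable R : realType.
Implicit Types (f g : R -> R[i]) (x y z : R[i]).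

Lemma Re_add x y : complex.Re (x + y) = complex.Re x + complex.Re y.
Proof. by case: x; case: y. Qed.
Lemma Im_add x y : complex.Im (x + y) = complex.Im x + complex.Im y.
Proof. by case: x; case: y. Qed.
Lemma Re_mul x y : complex.Re (x * y) = complex.Re x * complex.Re y - complex.Im x * complex.Im y.
Proof. by case: x; case: y. Qed.
Lemma Im_mul x y : complex.Im (x * y) = complex.Re x * complex.Im y + complex.Im x * complex.Re y.
Proof. by case: x; case: y. Qed.
Lemma Re_sub x y : complex.Re (x - y) = complex.Re x - complex.Re y.
Proof. by case: x; case: y. Qed.
Lemma Im_sub x y : complex.Im (x - y) = complex.Im x - complex.Im y.
Proof. by case: x; case: y. Qed.
Lemma Re_conj z : complex.Re z^* = complex.Re z. Proof. by case: z. Qed.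
Lemma Im_conj z : complex.Im z^* = - complex.Im z. Proof. by case: z. Qed.
Lemma complex_ext z w : complex.Re z = complex.Re w -> complex.Im z = complex.Im w -> z = w.
Proof. by case: z; case: w => a b c d /= -> ->. Qed.

Lemma Re_sum (I : Type) (r : seq I) (P : pred I) (F : I -> R[i]) :
  complex.Re (\sum_(i <- r | P i) F i) = \sum_(i <- r | P i) complex.Re (F i).
Proof. by apply: (big_morph (@complex.Re R)) => //; exact: Re_add. Qed.
Lemma Im_sum (I : Type) (r : seq I) (P : pred I) (F : I -> R[i]) :
  complex.Im (\sum_(i <- r | P i) F i) = \sum_(i <- r | P i) complex.Im (F i).
Proof. by apply: (big_morph (@complex.Im R)) => //; exact: Im_add. Qed.

Lemma normc_ge0 z : 0 <= normc z. Proof. by case: z => a b; exact: sqrtr_ge0. Qed.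

Lemma normc_sqr z : normc z ^+ 2 = complex.Re z ^+ 2 + complex.Im z ^+ 2.
Proof. by case: z => a b; rewrite /= sqr_sqrtr// addr_ge0 ?sqr_ge0. Qed.

Lemma mulc_conj z : z * z^* = (normc z ^+ 2)%:C.
Proof.
by rewrite normc_sqr; case: z => a b; apply: complex_ext => /=; ring.
Qed.

Lemma normc_conj z : normc z^* = normc z.
Proof. by case: z => a b /=; rewrite sqrrN. Qed.

Lemma normc_real (a : R) : normc a%:C = `|a|.
Proof. by rewrite /= expr0n/= addr0 sqrtr_sqr. Qed.

Lemma normc_i : normc ('i : R[i]) = 1.
Proof. by rewrite /= expr0n expr1n/= add0r sqrtr1. Qed.

Lemma normcN z : normc (- z) = normc z.
Proof. by case: z => a b; rewrite /= !sqrrN. Qed.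

Lemma normc_int k : normc (k%:~R : R[i]) = (absz k)%:R.
Proof. by rewrite -(rmorph_int (real_complex R)) normc_real -intr_norm. Qed.

Lemma Re_le_normc z : `|complex.Re z| <= normc z.
Proof.
by case: z => a b; rewrite /= -sqrtr_sqr ler_wsqrtr// lerDl sqr_ge0.
Qed.

Lemma Im_le_normc z : `|complex.Im z| <= normc z.
Proof.
by case: z => a b; rewrite /= -sqrtr_sqr ler_wsqrtr// lerDr sqr_ge0.
Qed.

Lemma normcD x y : normc (x + y) <= normc x + normc y.
Proof.
have := ler_normD x y; rewrite -lecR rmorphD /=.
by case: x; case: y.
Qed.

Lemma normc_sum (I : Type) (r : seq I) (P : pred I) (F : I -> R[i]) :
  normc (\sum_(i <- r | P i) F i) <= \sum_(i <- r | P i) normc (F i).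
Proof.
elim/big_rec2: _ => [|i y x _ h]; first by rewrite normc0.
by apply: le_trans (normcD _ _) _; rewrite lerD2l.
Qed.

Lemma normc_tri m (F : int -> int -> int -> R[i]) :
  normc (tri m F) <= tri m (fun a b c => normc (F a b c)).
Proof.
apply: le_trans (normc_sum _ _ _) _; apply: ler_sum => a _.
apply: le_trans (normc_sum _ _ _) _; apply: ler_sum => b _; exact: normc_sum.
Qed.

Definition cC1half f f' := C1half (fun t => complex.Re (f t)) (fun t => complex.Re (f' t))
  /\ C1half (fun t => complex.Im (f t)) (fun t => complex.Im (f' t)).

Lemma cC1half_eq f g f' g' : f =1 g -> (forall t : R, 0 < t -> f' t = g' t) ->
  cC1half f f' -> cC1half g g'.
Proof.
by move=> /funext <- e [h1 h2]; split; [move: h1|move: h2]; apply: C1half_eq => // t t0 /=; rewrite e.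
Qed.

Lemma cC1half_cst z : cC1half (fun=> z) (fun=> 0).
Proof. by split; exact: C1half_cst. Qed.

Lemma cC1halfD f g f' g' : cC1half f f' -> cC1half g g' ->
  cC1half (fun t => f t + g t) (fun t => f' t + g' t).
Proof.
move=> [h1 h2] [h3 h4]; split.
  by apply: C1half_eq (C1halfD h1 h3) => [t|t _]; rewrite /= Re_add.
by apply: C1half_eq (C1halfD h2 h4) => [t|t _]; rewrite /= Im_add.
Qed.

Lemma cC1halfM f g f' g' : cC1half f f' -> cC1half g g' ->
  cC1half (fun t => f t * g t) (fun t => f' t * g t + f t * g' t).
Proof.
move=> [h1 h2] [h3 h4]; split.
  have := C1halfD (C1halfM h1 h3) (C1halfN (C1halfM h2 h4)).
  by apply: C1half_eq => [t|t _]; rewrite /= ?Re_add !Re_mul//; ring.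
have := C1halfD (C1halfM h1 h4) (C1halfM h2 h3).
by apply: C1half_eq => [t|t _]; rewrite /= ?Im_add !Im_mul//; ring.
Qed.

Lemma cC1halfZ z f f' : cC1half f f' -> cC1half (fun t => z * f t) (fun t => z * f' t).
Proof.
move=> h; apply: cC1half_eq (cC1halfM (cC1half_cst z) h) => // t _ /=.
by rewrite mul0r add0r.
Qed.

Lemma cC1half_conj f f' : cC1half f f' -> cC1half (fun t => (f t)^*) (fun t => (f' t)^*).
Proof.
move=> [h1 h2]; split; first by apply: C1half_eq h1 => [t|t _]; rewrite /= Re_conj.
by apply: C1half_eq (C1halfN h2) => [t|t _]; rewrite /= Im_conj.
Qed.

Lemma cC1half_sum (I : eqType) (r : seq I) (P : pred I) (F F' : I -> R -> R[i]) :
  (forall i, i \in r -> P i -> cC1half (F i) (F' i)) ->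
  cC1half (fun t => \sum_(i <- r | P i) F i t) (fun t => \sum_(i <- r | P i) F' i t).
Proof.
elim: r => [|i r IH] h.
  by apply: cC1half_eq (cC1half_cst 0) => [t|t _]; rewrite big_nil.
have {}IH := IH (fun j jr => h j (mem_behead (s := i :: r) jr)).
case Pi : (P i); last first.
  by apply: cC1half_eq IH => [t|t _]; rewrite big_cons Pi.
by apply: cC1half_eq (cC1halfD (h i (mem_head _ _) Pi) IH) => [t|t _]; rewrite big_cons Pi.
Qed.

Lemma cC1half_tri m (F F' : int -> int -> int -> R -> R[i]) :
  (forall a b c, a \in box m -> b \in box m -> c \in box m -> cC1half (F a b c) (F' a b c)) ->
  cC1half (fun t => tri m (fun a b c => F a b c t)) (fun t => tri m (fun a b c => F' a b c t)).
Proof.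
move=> h; apply: cC1half_sum => a am _; apply: cC1half_sum => b bm _.
by apply: cC1half_sum => c cm _; exact: h.
Qed.

Definition cis (s : R) : R[i] := cos s +i* sin s.

Lemma cisD (s t : R) : cis (s + t) = cis s * cis t.
Proof. by apply: complex_ext; rewrite /= ?cosD ?sinD; ring. Qed.

Lemma cis0 : cis 0 = 1. Proof. by rewrite /cis cos0 sin0. Qed.

Lemma cisN (s : R) : cis (- s) = (cis s)^*.
Proof. by rewrite /cis cosN sinN. Qed.

Lemma normc_cis (s : R) : normc (cis s) = 1.
Proof. by rewrite /= cos2Dsin2 sqrtr1. Qed.

Lemma cC1half_cis (c : R) : cC1half (fun t => cis (c * t)) (fun t => 'i * c%:C * cis (c * t)).
Proof.
split; first by apply: C1half_eq (C1half_cos c) => // t _ /=; ring.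
by apply: C1half_eq (C1half_sin c) => // t _ /=; ring.
Qed.

End ComplexC1.

(** With [c] outermost the inner sum is the quadratic term at the frequency - c; this links the
    derivative of an energy to sums over triples. *)
Lemma tri_last (S : comPzRingType) m (X : int -> int -> S) (Y : int -> S) :
  tri m (fun a b c => X a b * Y c)
  = \sum_(c <- box m) Y c * \sum_(a <- box m) \sum_(b <- box m | a + b == - c) X a b.
Proof.
rewrite tri_swap23 tri_swap12 /tri; apply: eq_bigr => c _.
rewrite mulr_sumr; apply: eq_bigr => a _; rewrite mulr_sumr.
rewrite (eq_bigl (fun b => a + b == - c)); last by move=> b; apply/eqP/eqP; lia.
by apply: eq_bigr => b _; rewrite mulrC.
Qed.

(** * Algebraic energy identities *)

Section Energy.
Variables (R : realType) (m : nat).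
Implicit Types (u : int -> R[i]) (nu : nat -> R).

Definition nlin u c := \sum_(a <- box m) \sum_(b <- box m | a + b == c) u a * u b.

(** On the window, this is the Fourier form of the truncated KdV equation u_t = u_xxx + u u_x. *)
Definition gal_field u k := 'i * (- (k%:~R ^+ 3) * u k + k%:~R / 2 * nlin u k).

(* At triples with a zero entry the quotient is the junk value [0]; the zero mode of [u]
   vanishes, so these triples do not contribute. *)
Definition symbQ nu a b c : R[i] := (symb nu a b c)%:C / (a%:~R * b%:~R * c%:~R).

Lemma symbE nu a b c : (symb nu a b c)%:C = a%:~R * (nu (absz a) ^+ 2)%:C
   + b%:~R * (nu (absz b) ^+ 2)%:C + c%:~R * (nu (absz c) ^+ 2)%:C :> R[i].
Proof. by rewrite /symb !rmorphD !rmorphM !rmorph_int. Qed.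

Lemma symbQC12 nu a b c : symbQ nu a b c = symbQ nu b a c.
Proof. by rewrite /symbQ symbC12 (mulrC a%:~R). Qed.

Lemma symbQC23 nu a b c : symbQ nu a b c = symbQ nu a c b.
Proof. by rewrite /symbQ symbC23 (mulrAC a%:~R). Qed.

(** The choice of the distinguished third slot is immaterial after summation. Read backwards, this
    symmetrises a summand. *)
Lemma tri_sym (G : int -> int -> int -> R[i]) :
  (forall a b c, G a b c = G b a c) ->
  tri m (fun a b c => G a b c + G c b a + G a c b) = 3 * tri m G.
Proof.
move=> G12; rewrite !triD.
have e1 : tri m (fun a b c => G a c b) = tri m G by rewrite -tri_swap23.
have e2 : tri m (fun a b c => G c b a) = tri m G.
  by rewrite tri_swap12 -e1; apply: eq_tri => a b c _; rewrite G12.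
by rewrite e1 e2; ring.
Qed.

(** The dispersive parts at k and - k cancel because k^3 is odd. Reflecting k merges the two
    nonlinear parts into one sum of c mu_c u_c times the quadratic term at - c, and symmetrisation
    produces the symbol together with the factor 1 / 3. *)
Lemma quadratic_energy_field nu u :
  \sum_(k <- box m) (nu (absz k) ^+ 2)%:C * (gal_field u k * u (- k) + u k * gal_field u (- k))
  = - ('i / 3) * tri m (fun a b c => (symb nu a b c)%:C * (u a * u b * u c)).
Proof.
pose P k : R[i] := (nu (absz k) ^+ 2)%:C.
have -> : tri m (fun a b c => (symb nu a b c)%:C * (u a * u b * u c))
   = 3 * \sum_(c <- box m) c%:~R * P c * u c * nlin u (- c).
  rewrite -(tri_last _ (fun a b => u a * u b) (fun c => c%:~R * P c * u c)).
  rewrite -tri_sym; last by move=> a b c; rewrite (mulrC (u a)).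
  by apply: eq_tri => a b c _; rewrite symbE /P; ring.
transitivity (\sum_(k <- box m) (P k * 'i * (k%:~R / 2) * nlin u k * u (- k))
  + \sum_(k <- box m) (- P k * 'i * (k%:~R / 2) * nlin u (- k) * u k)).
  by rewrite -big_split/=; apply: eq_bigr => k _; rewrite /gal_field /P mulrNz; ring.
rewrite -sum_box_opp -big_split mulrA mulr_sumr; apply: eq_bigr => k _.
by rewrite /= /P abszN mulrNz opprK; field.
Qed.

(** By symmetry it is enough to differentiate the third factor and multiply by 3. The dispersive
    part brings c^3, whose symmetrisation is a^3 + b^3 + c^3 = 3 a b c and undoes the division in
    [symbQ]. Triples with a zero entry, where that division is meaningless, vanish by [u 0 = 0]. *)
Lemma cubic_energy_field nu u : u 0 = 0 ->
  tri m (fun a b c => symbQ nu a b c * ((gal_field u a * u b + u a * gal_field u b) * u c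
            + u a * u b * gal_field u c))
  = - (3 * 'i) * tri m (fun a b c => (symb nu a b c)%:C * (u a * u b * u c))
    + 3 * 'i / 2 * tri m (fun a b c => symbQ nu a b c * c%:~R * (u a * u b * nlin u c)).
Proof.
move=> u0.
pose G a b c := symbQ nu a b c * (u a * u b * gal_field u c).
transitivity (3 * tri m G).
  rewrite -tri_sym => [|a b c]; last by rewrite /G symbQC12 (mulrC (u a)).
  apply: eq_tri => a b c _; rewrite /G (symbQC23 nu a c) (symbQC12 nu c b a) (symbQC23 nu b c).
  by rewrite (symbQC12 nu b); ring.
have -> : tri m G = - 'i * tri m (fun a b c => symbQ nu a b c * c%:~R ^+ 3 * (u a * u b * u c))
   + 'i / 2 * tri m (fun a b c => symbQ nu a b c * c%:~R * (u a * u b * nlin u c)).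
  rewrite -!triZ -triD; apply: eq_tri => a b c _; rewrite /G /gal_field; ring.
rewrite mulrDr.
have -> : tri m (fun a b c => (symb nu a b c)%:C * (u a * u b * u c))
   = tri m (fun a b c => symbQ nu a b c * c%:~R ^+ 3 * (u a * u b * u c)).
  apply: (@mulfI _ 3); first by rewrite pnatr_eq0.
  rewrite -[RHS]tri_sym => [|a b c]; last by rewrite symbQC12 (mulrC (u a)).
  rewrite -triZ; apply: eq_tri => a b c abc.
  rewrite (symbQC23 nu a c) (symbQC12 nu c b a) (symbQC23 nu b c) (symbQC12 nu b).
  rewrite /symbQ.
  have [->|a0] := eqVneq a 0; first by rewrite u0; ring.
  have [->|b0] := eqVneq b 0; first by rewrite u0; ring.
  have [->|c0] := eqVneq c 0; first by rewrite u0; ring.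
  have cE : c%:~R = - (a%:~R + b%:~R) :> R[i].
    by rewrite -intrD -mulrNz; congr (_%:~R); lia.
  have ab0 : a%:~R + b%:~R != 0 :> R[i] by rewrite -oppr_eq0 -cE intr_eq0.
  by rewrite cE; field; rewrite ab0 !intr_eq0 a0 b0.
by ring.
Qed.

End Energy.

(** * Uniqueness and reality of the truncated flow *)

Section Flow.
Variables (R : realType) (m : nat).
Implicit Types (U V : R -> int -> R[i]) (nu : nat -> R).

Definition gal_flow U := (forall t, U t 0 = 0) /\
  forall k, k \in box m -> cC1half (fun t => U t k) (fun t => gal_field m (U t) k).

Lemma box_opp k : k \in box m -> - k \in box m.
Proof. by rewrite !mem_box abszN. Qed.

Lemma sum_seq_const (I : Type) (r : seq I) (x : R) : \sum_(i <- r) x = (size r)%:R * x.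
Proof. by elim: r => [|i r IH]; rewrite ?big_nil ?mul0r// big_cons IH /= -natr1; ring. Qed.

Lemma sum_sqr_le (I : Type) (r : seq I) (x : I -> R) :
  (\sum_(i <- r) x i) ^+ 2 <= (size r)%:R * \sum_(i <- r) x i ^+ 2.
Proof.
elim: r => [|i r IH]; first by rewrite !big_nil expr0n mul0r.
rewrite !big_cons /= -natr1.
have : 0 <= \sum_(j <- r) (x i - x j) ^+ 2 by exact: sum_sqr_ge0.
have -> : \sum_(j <- r) (x i - x j) ^+ 2
   = (size r)%:R * x i ^+ 2 - 2 * x i * (\sum_(j <- r) x j) + \sum_(j <- r) x j ^+ 2.
  rewrite mulr_sumr -sum_seq_const -sumrB -big_split/=.
  by apply: eq_bigr => j _; ring.
nra.
Qed.

(** Conservation of the H^0 norm cannot be invoked yet: it is proved through reality, which is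
    deduced from uniqueness, which in turn uses this bound. Compactness of [0, T] is used
    instead. *)
Lemma gal_flow_bounded U (T : R) : gal_flow U -> 0 <= T ->
  exists2 B : R, 0 <= B & forall t, 0 <= t <= T -> forall k, k \in box m -> normc (U t k) <= B.
Proof.
move=> [_ UC] T0.
pose E t : R[i] := \sum_(k <- box m) U t k * (U t k)^*.
have [f' [[cE _] _]] : exists f', cC1half E f'.
  eexists; apply: cC1half_sum => k km _; apply: cC1halfM; last apply: cC1half_conj; exact: UC.
have sub : `[0, T] `<=` `[0, +oo[.
  by move=> x /=; rewrite !in_itv/= andbT => /andP[].
have [c _ max] := EVT_max T0 (continuous_subspaceW sub cE).
have EE t : complex.Re (E t) = \sum_(k <- box m) normc (U t k) ^+ 2.
  by rewrite Re_sum; apply: eq_bigr => k _; rewrite mulc_conj.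
(* The inequality x <= 1 + x^2 avoids taking a square root of the maximum. *)
exists (1 + complex.Re (E c)).
  by rewrite EE addr_ge0// sum_sqr_ge0.
move=> t tT k km; apply: le_trans (_ : 1 + normc (U t k) ^+ 2 <= _).
  have := sqr_ge0 (normc (U t k) - 1); have := normc_ge0 (U t k); nra.
rewrite lerD2l; apply: le_trans (max t _); last by rewrite in_itv.
rewrite EE (bigD1_seq k) ?box_uniq//= lerDl.
by apply: sumr_ge0 => j _; exact: sqr_ge0.
Qed.

Lemma gal_field_lipschitz (u v : int -> R[i]) (B : R) k : 0 <= B -> k \in box m ->
  {in box m, forall j, normc (u j) <= B} -> {in box m, forall j, normc (v j) <= B} ->
  normc (gal_field m u k - gal_field m v k)
    <= (m%:R ^+ 3 + 2 * m%:R * (size (box m))%:R * B) * \sum_(j <- box m) normc (u j - v j).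
Proof.
move=> B0 km uB vB.
set S := \sum_(j <- box m) normc (u j - v j).
have S0 : 0 <= S by apply: sumr_ge0 => j _; exact: normc_ge0.
have kR : normc (k%:~R : R[i]) <= m%:R.
  by rewrite normc_int ler_nat -mem_box.
have nl : normc (nlin m u k - nlin m v k) <= 2 * (size (box m))%:R * B * S.
  rewrite /nlin -sumrB.
  apply: le_trans (normc_sum _ _ _) _.
  apply: (@le_trans _ _ (\sum_(a <- box m) \sum_(b <- box m) (B * normc (u b - v b) + B * normc (u a - v a)))).
    rewrite big_seq [leRHS]big_seq; apply: ler_sum => a am.
    rewrite -sumrB; apply: le_trans (normc_sum _ _ _) _.
    rewrite big_mkcond big_seq [leRHS]big_seq; apply: ler_sum => b bm.
    have r0 : 0 <= B * normc (u b - v b) + B * normc (u a - v a).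
      by rewrite addr_ge0// mulr_ge0// normc_ge0.
    case: ifP => // _.
    rewrite (_ : _ - _ = u a * (u b - v b) + v b * (u a - v a)); last by ring.
    apply: le_trans (normcD _ _) _; rewrite !normcM.
    by rewrite lerD// ler_wpM2r ?normc_ge0 ?uB ?vB.
  under eq_bigr do rewrite big_split/= -mulr_sumr sum_seq_const.
  by rewrite big_split/= sum_seq_const -mulr_sumr -mulr_sumr -/S; apply: eq_ler; ring.
rewrite (_ : _ - _ = 'i * (- (k%:~R ^+ 3) * (u k - v k) + k%:~R / 2 * (nlin m u k - nlin m v k))); last first.
  by rewrite /gal_field; ring.
rewrite normcM normc_i mul1r mulrDl; apply: le_trans (normcD _ _) _; apply: lerD.
  rewrite normcM normcN !exprS !expr0 !mulr1 !normcM.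
  have uS : normc (u k - v k) <= S.
    by rewrite /S (bigD1_seq k) ?box_uniq//= lerDl; apply: sumr_ge0 => j _; exact: normc_ge0.
  by do 3!(apply: ler_pM; rewrite ?mulr_ge0 ?normc_ge0//).
rewrite normcM normcM normcV.
rewrite (_ : normc 2 = 2); last by rewrite (normc_int _ 2).
apply: (@le_trans _ _ (normc (k%:~R : R[i]) * normc (nlin m u k - nlin m v k))).
  rewrite ler_wpM2r ?normc_ge0// ler_pdivrMr// ler_peMr ?normc_ge0// ler1n//.
apply: le_trans (ler_pM (normc_ge0 _) (normc_ge0 _) kR nl) _.
by apply: eq_ler; ring.
Qed.

(** Gronwall's lemma for the squared distance of the two flows. The Lipschitz constant depends on
    [m] and on the two flows, which is harmless here. *)
Lemma gal_flow_unique U V : gal_flow U -> gal_flow V ->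
  {in box m, forall k, U 0 k = V 0 k} -> forall t : R, 0 <= t -> {in box m, forall k, U t k = V t k}.
Proof.
move=> UF VF e0 t t0.
have [B1 B10 UB] := gal_flow_bounded UF t0; have [B2 B20 VB] := gal_flow_bounded VF t0.
pose B := B1 + B2.
pose Q t : R[i] := \sum_(k <- box m) (U t k - V t k) * (U t k - V t k)^*.
pose d t k := U t k - V t k.
pose d' t k := gal_field m (U t) k - gal_field m (V t) k.
pose Q' t := \sum_(k <- box m) (d' t k * (d t k)^* + d t k * (d' t k)^*).
have dC k : k \in box m -> cC1half (fun t => d t k) (fun t => d' t k).
  move=> km; have := cC1halfD (UF.2 k km) (cC1halfZ (-1) (VF.2 k km)).
  by apply: cC1half_eq => [s|s _]; rewrite /d /d' mulN1r.
have QC : cC1half Q Q'.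
  by apply: cC1half_sum => k km _; apply: cC1halfM; last apply: cC1half_conj; exact: dC.
have QE s : complex.Re (Q s) = \sum_(k <- box m) normc (d s k) ^+ 2.
  by rewrite Re_sum; apply: eq_bigr => k _; rewrite mulc_conj.
pose L := m%:R ^+ 3 + 2 * m%:R * (size (box m))%:R * B : R.
have L0 : 0 <= L by rewrite addr_ge0 ?exprn_ge0// !mulr_ge0// addr_ge0.
have Qle s : 0 < s < t -> complex.Re (Q' s) <= (2 * L * (size (box m))%:R) * complex.Re (Q s).
  move=> /andP[s0 st]; have st' : 0 <= s <= t by rewrite !ltW.
  apply: le_trans (ler_norm _) _; apply: le_trans (Re_le_normc _) _.
  apply: le_trans (normc_sum _ _ _) _; rewrite QE.
  apply: (@le_trans _ _ (\sum_(k <- box m) 2 * (normc (d s k) * (L * \sum_(j <- box m) normc (d s j))))).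
    rewrite big_seq [leRHS]big_seq; apply: ler_sum => k km.
    apply: le_trans (normcD _ _) _; rewrite !normcM !normc_conj.
    rewrite (_ : _ + _ = 2 * (normc (d s k) * normc (d' s k))); last by ring.
    rewrite ler_wpM2l// ler_wpM2l ?normc_ge0//.
    apply: gal_field_lipschitz => //; rewrite ?addr_ge0// => j jm.
      by rewrite (le_trans (UB _ st' _ jm))// lerDl.
    by rewrite (le_trans (VB _ st' _ jm))// lerDr.
  rewrite -mulr_sumr -mulr_suml; set S := \sum_(j <- box m) normc (d s j).
  rewrite [leLHS](_ : _ = 2 * L * S ^+ 2); last by ring.
  by rewrite -[leRHS]mulrA ler_wpM2l ?mulr_ge0// sum_sqr_le.
have := gronwall QC.1 Qle (_ : 0 <= t <= t); rewrite t0 lexx => /(_ isT).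
have -> : complex.Re (Q 0) = 0.
  by rewrite QE big_seq big1// => k km; rewrite /d e0// subrr normc0 expr0n.
rewrite mul0r QE => Q0 k km; apply/eqP; rewrite -subr_eq0; apply/eqP/eq0_normc.
have := le_trans _ Q0; rewrite (bigD1_seq k) ?box_uniq//= => /(_ (normc (d t k) ^+ 2)).
rewrite lerDl sumr_ge0 => [/(_ isT) h|j _]; last exact: sqr_ge0.
by apply/eqP; rewrite -sqrf_eq0 eq_le h sqr_ge0.
Qed.

Lemma nlin_opp u k : nlin m (fun j => u (- j)) k = nlin m u (- k) :> R[i].
Proof.
rewrite /nlin -[RHS]sum_box_opp; apply: eq_bigr => a _.
rewrite [RHS]big_mkcond -[RHS]sum_box_opp [LHS]big_mkcond; apply: eq_bigr => b _.
by rewrite -opprD eqr_opp.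
Qed.

Lemma nlin_conj u k : nlin m (fun j => (u j)^*) k = (nlin m u k)^* :> R[i].
Proof.
rewrite /nlin rmorph_sum; apply: eq_bigr => a _; rewrite rmorph_sum.
by apply: eq_bigr => b _; rewrite /= rmorphM.
Qed.

(** The map sending u_k to the conjugate of u_(- k) is complex conjugation in physical space, a
    symmetry of the equation. *)
Lemma gal_field_conj u k :
  gal_field m (fun j => (u (- j))^*) k = (gal_field m u (- k))^* :> R[i].
Proof.
rewrite /gal_field (nlin_conj (fun j => u (- j))) nlin_opp.
have key (a h : R) (w N : R[i]) : ('i * (- ((- a%:C) ^+ 3) * w + - h%:C * N))^*
    = 'i * (- (a%:C ^+ 3) * w^* + h%:C * N^*).
  by case: w; case: N => *; apply: complex_ext => /=; ring.
have h2 : k%:~R / 2 = (k%:~R / 2)%:C :> R[i].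
  by rewrite rmorphM fmorphV rmorph_int rmorph_nat.
by rewrite mulrNz (mulNr k%:~R) h2 -(rmorph_int (real_complex R) k) key.
Qed.

(** The conjugate reflection of [U] is a flow with the same initial values, so uniqueness
    applies. *)
Lemma gal_flow_real U : gal_flow U ->
  {in box m, forall k, U 0 (- k) = (U 0 k)^*} ->
  forall t : R, 0 <= t -> {in box m, forall k, U t (- k) = (U t k)^*}.
Proof.
move=> UF U0 t t0 k km.
rewrite -[LHS]conjcK; congr (_^*); symmetry.
apply: (@gal_flow_unique U (fun t j => (U t (- j))^*)) => //.
  split=> [s|j jm]; first by rewrite oppr0 UF.1 conjc0.
  have := cC1half_conj (UF.2 _ (box_opp jm)).
  by apply: cC1half_eq => // s _; rewrite -gal_field_conj.
by move=> j jm; rewrite U0// conjcK.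
Qed.

End Flow.

(** * Growth of the modified energy *)

Section Bound.
Variables (R : realType) (m : nat) (U : R -> int -> R[i]).
Hypothesis UF : gal_flow m U.
Hypothesis U0 : {in box m, forall k, U 0 (- k) = (U 0 k)^*}.
Implicit Types nu : nat -> R.

Let A t k := normc (U t k).
Let A_ge0 t k : 0 <= A t k. Proof. exact: normc_ge0. Qed.
Let A_0 t : A t 0 = 0. Proof. by rewrite /A UF.1 normc0. Qed.

Let UC k : k \in box m -> cC1half (fun t => U t k) (fun t => gal_field m (U t) k).
Proof. exact: UF.2. Qed.

(** The product u_k u_(- k) replaces |u_k|^2, so that the derivative is a polynomial identity free
    of conjugates; reality identifies the two for t >= 0. *)
Definition quadratic_energy nu t : R[i] :=
  \sum_(k <- box m) (nu (absz k) ^+ 2)%:C * (U t k * U t (- k)).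

Definition cubic_energy nu t : R[i] :=
  tri m (fun a b c => symbQ nu a b c * (U t a * U t b * U t c)).

Lemma quadratic_energy_deriv nu : cC1half (quadratic_energy nu)
  (fun t => - ('i / 3) * tri m (fun a b c => (symb nu a b c)%:C * (U t a * U t b * U t c))).
Proof.
have h : cC1half (quadratic_energy nu) (fun t => \sum_(k <- box m) (nu (absz k) ^+ 2)%:C *
    (gal_field m (U t) k * U t (- k) + U t k * gal_field m (U t) (- k))).
  apply: cC1half_sum => k km _; apply: cC1halfZ; apply: cC1halfM; apply: UC => //.
  exact: box_opp.
by apply: cC1half_eq h => // t _; rewrite quadratic_energy_field.
Qed.

Lemma cubic_energy_deriv nu : cC1half (cubic_energy nu)
  (fun t => - (3 * 'i) * tri m (fun a b c => (symb nu a b c)%:C * (U t a * U t b * U t c))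
    + 3 * 'i / 2 * tri m (fun a b c => symbQ nu a b c * c%:~R * (U t a * U t b * nlin m (U t) c))).
Proof.
have h : cC1half (cubic_energy nu) (fun t => tri m (fun a b c => symbQ nu a b c *
      ((gal_field m (U t) a * U t b + U t a * gal_field m (U t) b) * U t c
            + U t a * U t b * gal_field m (U t) c))).
  apply: cC1half_tri => a b c am bm cm; apply: cC1halfZ; apply: cC1halfM; last exact: UC.
  by apply: cC1halfM; exact: UC.
by apply: cC1half_eq h => // t _; rewrite cubic_energy_field// UF.1.
Qed.

(* The time derivative of the cubic term cancels the cubic term in the derivative of the
   quadratic energy, because [a ^ 3 + b ^ 3 + c ^ 3 = 3 a b c] when [a + b + c = 0]. *)
Lemma modified_energy_deriv nu :
  cC1half (fun t => quadratic_energy nu t + - (1 / 9) * cubic_energy nu t)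
    (fun t => - ('i / 6) * tri m (fun a b c => symbQ nu a b c * c%:~R * (U t a * U t b * nlin m (U t) c))).
Proof.
have := cC1halfD (quadratic_energy_deriv nu) (cC1halfZ (- (1 / 9)) (cubic_energy_deriv nu)).
by apply: cC1half_eq => // t _; field.
Qed.

Lemma quadratic_energyE nu (t : R) : 0 <= t ->
  quadratic_energy nu t = (\sum_(k <- box m) (nu (absz k) * A t k) ^+ 2)%:C.
Proof.
move=> t0; rewrite rmorph_sum /quadratic_energy big_seq [RHS]big_seq; apply: eq_bigr => k km.
rewrite (gal_flow_real UF U0 t0 km) mulc_conj exprMn /A.
by rewrite [RHS](rmorphM (real_complex R)).
Qed.

Lemma flow_conserved (t : R) : 0 <= t ->
  \sum_(k <- box m) normc (U t k) ^+ 2 = \sum_(k <- box m) normc (U 0 k) ^+ 2.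
Proof.
move=> t0; pose one (_ : nat) : R := 1.
have E0 : cC1half (quadratic_energy one) (fun=> 0).
  apply: cC1half_eq (quadratic_energy_deriv one) => // s _.
  rewrite (_ : tri _ _ = 0) ?mulr0// /tri big1// => a _; rewrite big1// => b _.
  rewrite big1// => c /eqP abc.
  rewrite (_ : symb _ _ _ _ = 0) ?mul0r//.
  by rewrite /symb /one expr1n !mulr1 -!intrD abc.
have := C1half_const E0.1 t0; rewrite !quadratic_energyE//= => e.
by move: e; rewrite /one; under eq_bigr do rewrite mul1r; under [in RHS]eq_bigr do rewrite mul1r.
Qed.

Variables (n N0 : nat) (nu : nat -> R) (a : R).
Hypotheses (nuW : weight n N0 nu) (N0_gt0 : (0 < N0)%N).
Hypothesis U0a : l2 m (A 0) <= a.
Hypothesis aN0 : 11 * symbC R n * a <= N0%:R.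

Let B t k := nu (absz k) * A t k.
Let h2 t := \sum_(k <- box m) B t k ^+ 2.
Let a_ge0 : 0 <= a. Proof. exact: le_trans (l2_ge0 _ _) U0a. Qed.

Let At (t : R) : 0 <= t -> l2 m (A t) <= a.
Proof. by move=> t0; rewrite /l2 flow_conserved. Qed.

Let h2_ge0 t : 0 <= h2 t. Proof. exact: sum_sqr_ge0. Qed.

Lemma normc_symbQ x y z :
  normc (symbQ nu x y z) = `|symb nu x y z| / ((absz x)%:R * (absz y)%:R * (absz z)%:R).
Proof. by rewrite /symbQ normcM normcV !normcM !normc_int normc_real. Qed.

(** The factor 9 / 2 makes the correction - E3 / 9 at most half of [h2]. The number 11 in [aN0] is
    chosen for this: 48 <= 9 / 2 * 11. *)
Lemma cubic_energy_small (t : R) : 0 <= t -> normc (cubic_energy nu t) <= 9 / 2 * h2 t.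
Proof.
move=> t0; apply: le_trans (normc_tri _ _) _.
rewrite (@eq_tri _ m _ (fun x y z => `|symb nu x y z| / ((absz x)%:R * (absz y)%:R * (absz z)%:R)
    * (A t x * A t y * A t z))); last by move=> x y z _; rewrite normcM normc_symbQ !normcM.
have := trilinear_correction_bound nuW m (A_ge0 t) (A_0 t).
rewrite l2_sqr -/(h2 t); set X := tri _ _ => h.
have N0R : 0 < N0%:R :> R by rewrite ltr0n.
rewrite -(ler_pM2l N0R). apply: (le_trans h).
apply: (@le_trans _ _ (9 / 2 * (11 * symbC R n * a) * h2 t)).
  rewrite ler_wpM2r//.
  have := ler_wpM2l (symbC_ge0 R n) (At t0).
  have := mulr_ge0 (symbC_ge0 R n) a_ge0; lra.
by rewrite [leRHS]mulrA (mulrC N0%:R) ler_wpM2r// ler_wpM2l.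
Qed.

Lemma modified_energy_rate (t : R) : 0 <= t ->
  normc (- ('i / 6) * tri m (fun x y z => symbQ nu x y z * z%:~R * (U t x * U t y * nlin m (U t) z)))
   <= symbC R n * (8 + 32 * 2 ^+ n) / 6 * a ^+ 2 * h2 t.
Proof.
move=> t0; rewrite normcM normcN normcM normc_i mul1r normcV (normc_int _ 6).
have h := quadrilinear_bound nuW m (A_ge0 t) (A_0 t).
apply: (@le_trans _ _ (6^-1 * (symbC R n * (8 + 32 * 2 ^+ n) * l2 m (A t) ^+ 2 * h2 t))).
  rewrite ler_wpM2l// /h2 -(l2_sqr m (B t)); apply: le_trans h.
  apply: le_trans (normc_tri _ _) _; apply: le_tri => x y z _ xyz.
  rewrite normcM (normcM (symbQ _ _ _ _)) normc_symbQ normc_int normcM (normcM (U t x)).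
  have conv_nl : normc (nlin m (U t) z) <= conv m (A t) (A t) z.
    apply: le_trans (normc_sum _ _ _) _; apply: ler_sum => d _.
    by apply: le_trans (normc_sum _ _ _) _; apply: ler_sum => e _; rewrite normcM.
  rewrite [leLHS]mulrA [leRHS]mulrA; apply: ler_pM => //; rewrite ?normc_ge0 ?mulr_ge0 ?invr_ge0 ?normc_ge0//.
  apply: ler_wpM2r; first by rewrite mulr_ge0 ?normc_ge0.
  rewrite -[leLHS]mulrA ler_wpM2l//.
  have [->|z0] := eqVneq z 0; first by rewrite mulr0 invr_ge0 mulr_ge0.
  by rewrite invfM divfK// pnatr_eq0; lia.
have la : l2 m (A t) ^+ 2 <= a ^+ 2 by rewrite lerXn2r ?nnegrE ?l2_ge0 ?At.
have c0 : 0 <= symbC R n * (8 + 32 * 2 ^+ n) * h2 t.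
  by rewrite !mulr_ge0 ?symbC_ge0 ?addr_ge0 ?mulr_ge0 ?exprn_ge0.
by have := ler_wpM2l c0 la; lra.
Qed.

(** The modified energy lies between [h2] / 2 and 3 / 2 [h2]. The quotient of these constants is the
    3 in front, and the lower one turns the rate 1 / 6 into 1 / 3. *)
Lemma flow_bound (t : R) : 0 <= t ->
  h2 t <= 3 * h2 0 * expR (symbC R n * (8 + 32 * 2 ^+ n) / 3 * a ^+ 2 * t).
Proof.
move=> t0; set K := _ / 3 * a ^+ 2.
pose E s := complex.Re (quadratic_energy nu s + - (1 / 9) * cubic_energy nu s).
have EB (s : R) : 0 <= s -> h2 s / 2 <= E s /\ E s <= 3 / 2 * h2 s.
  move=> s0; rewrite /E Re_add quadratic_energyE//= -/(h2 s).
  have : `|complex.Re (- (1 / 9) * cubic_energy nu s)| <= h2 s / 2.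
    apply: le_trans (Re_le_normc _) _; rewrite normcM normcN normcM normcV.
    rewrite normc1 (_ : normc 9 = 9) ?mul1r; last exact: (normc_int _ 9).
    have := cubic_energy_small s0; lra.
  by rewrite ler_norml => /andP[l1 l2]; split; lra.
have := gronwall (modified_energy_deriv nu).1 (K := K) (T := t).
have rate (s : R) : 0 < s < t -> complex.Re (- ('i / 6) *
   tri m (fun x y z => symbQ nu x y z * z%:~R * (U s x * U s y * nlin m (U s) z))) <= K * E s.
  move=> /andP[/ltW s0 _]; apply: le_trans (ler_norm _) _; apply: le_trans (Re_le_normc _) _.
  apply: le_trans (modified_energy_rate s0) _; rewrite /K.
  have [l1 _] := EB s s0.
  have K0 : 0 <= symbC R n * (8 + 32 * 2 ^+ n) / 3 * a ^+ 2.
    by rewrite !mulr_ge0 ?symbC_ge0 ?addr_ge0 ?mulr_ge0 ?exprn_ge0.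
  have := ler_wpM2l K0 l1; lra.
move=> /(_ rate t); rewrite t0 lexx => /(_ isT) g.
have [l1 _] := EB t t0; have [_ u0] := EB 0 (lexx _).
have e0 : 0 <= expR (K * t) by exact: expR_ge0.
have := ler_wpM2r e0 u0; move: g l1; rewrite -/(E t) -/(E 0); nra.
Qed.

End Bound.

(** * A priori bounds *)

Section PowerWeight.
Variable R : realType.

Lemma powR_exp_le (x y s : R) n : 0 < x -> x <= y -> s <= n%:R ->
  y `^ s * x ^+ n <= x `^ s * y ^+ n.
Proof.
move=> x0 xy sn; have y0 := lt_le_trans x0 xy.
have split (z : R) : 0 < z -> z ^+ n = z `^ s * z `^ (n%:R - s).
  move=> z0; rewrite -powRD; last by rewrite (gt_eqF z0) implybT.
  by rewrite addrC subrK powR_mulrn// ltW.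
rewrite (split x x0) (split y y0) mulrCA ler_wpM2l ?powR_ge0//.
rewrite ler_wpM2l ?powR_ge0// ge0_ler_powR// ?nnegrE ?subr_ge0// ltW//.
Qed.

Definition pow_weight (s : R) (N0 k : nat) : R := (maxn k N0)%:R `^ s.

Lemma pow_weight_sqr s N0 k : pow_weight s N0 k ^+ 2 = (maxn k N0)%:R `^ (2 * s).
Proof. by rewrite /pow_weight -powR_mulrn ?powR_ge0// -powRrM mulrC. Qed.

Lemma pow_weightP (s : R) n N0 : 0 <= s -> 2 * s <= n%:R -> (0 < N0)%N ->
  weight n N0 (pow_weight s N0).
Proof.
move=> s0 sn N00; split=> [k|j k jk|j k jk|k kN].
- by rewrite powR_gt0// ltr0n; lia.
- by rewrite /pow_weight ge0_ler_powR// ?nnegrE// ler_nat; lia.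
- rewrite !pow_weight_sqr; have [kN|Nk] := leqP k N0.
    rewrite (maxn_idPr (leq_trans jk kN)).
    by rewrite ler_wpM2l ?powR_ge0// lerXn2r ?nnegrE// ler_nat.
  apply: (@le_trans _ _ (k%:R `^ (2 * s) * (maxn j N0)%:R ^+ n)).
    by rewrite ler_wpM2l ?powR_ge0// lerXn2r ?nnegrE// ler_nat leq_maxl.
  apply: powR_exp_le => //; last by rewrite ler_nat; lia.
  by rewrite ltr0n; lia.
- by rewrite /pow_weight; congr (_%:R `^ _); lia.
Qed.

Lemma pow_weight_ge (s : R) N0 k : 0 <= s -> k%:R `^ (2 * s) <= pow_weight s N0 k ^+ 2.
Proof.
by move=> s0; rewrite pow_weight_sqr ge0_ler_powR ?nnegrE ?mulr_ge0// ler_nat leq_maxl.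
Qed.

Lemma pow_weight_le (s : R) N0 k : 0 <= s -> (0 < N0)%N -> (0 < k)%N ->
  pow_weight s N0 k ^+ 2 <= N0%:R `^ (2 * s) * k%:R `^ (2 * s).
Proof.
move=> s0 N00 k0; rewrite pow_weight_sqr -powRM// -natrM ge0_ler_powR ?nnegrE ?mulr_ge0// ler_nat.
by nia.
Qed.
End PowerWeight.

(** * From the Galerkin system to the autonomous flow *)

Section ToComplex.
Variable R : realType.

Definition toC (z : cplx R) : R[i] := z.1 +i* z.2.

Lemma toC_mul z w : toC (cmul z w) = toC z * toC w.
Proof. by []. Qed.

Lemma normc_toC z : normc (toC z) ^+ 2 = cabs2 z.
Proof. by rewrite normc_sqr. Qed.

Lemma toC_conj z : toC (cconj z) = (toC z)^*.
Proof. by []. Qed.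

Lemma toC_inj : injective toC.
Proof. by move=> [a b] [c d] [-> ->]. Qed.

Lemma toC_sum (I : Type) (r : seq I) (P : pred I) (F : I -> cplx R) :
  toC (\sum_(i <- r | P i) (F i).1, \sum_(i <- r | P i) (F i).2) = \sum_(i <- r | P i) toC (F i).
Proof. by apply: complex_ext; rewrite /= ?Re_sum ?Im_sum. Qed.

Lemma toC_Nterm (v : seqZ R) k t a :
  toC (Nterm v k t a) = cis (3 * k%:~R * a%:~R * (k - a)%:~R * t) * (toC (v a) * toC (v (k - a))).
Proof. by []. Qed.

Lemma toC_galerkin_rhs m (w : seqZ R) k t : k \in box m ->
  toC (galerkin_rhs m w k t) = 'i * (k%:~R / 2) *
   \sum_(a <- box m | [&& a != 0, k - a != 0 & (absz (k - a)%R <= m)%N])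
      toC (Nterm w k t a).
Proof.
rewrite mem_box /galerkin_rhs => ->.
rewrite toC_mul.
rewrite (sum_box_ord m (fun a => [&& a != 0, k - a != 0 & (absz (k - a)%R <= m)%N]) (fun a => (Nterm w k t a).1)).
rewrite (sum_box_ord m (fun a => [&& a != 0, k - a != 0 & (absz (k - a)%R <= m)%N]) (fun a => (Nterm w k t a).2)).
rewrite toC_sum; congr (_ * _).
have -> : k%:~R / 2 = (k%:~R / 2)%:C :> R[i].
  by rewrite rmorphM fmorphV rmorph_int rmorph_nat.
by apply: complex_ext; rewrite /=; ring.
Qed.
End ToComplex.

Section Galerkin.
Variables (R : realType) (m : nat) (w : R -> seqZ R) (v0 : seqZ R).
Hypothesis wG : galerkin_solution m w v0.

(* This change of unknown makes the Galerkin system autonomous, since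
   [k ^ 3 - a ^ 3 - (k - a) ^ 3 = 3 k a (k - a)]. *)
Definition rotated (t : R) (k : int) : R[i] :=
  if k == 0 then 0 else cis (- k%:~R ^+ 3 * t) * toC (w t k).

Lemma nlin_rotated t k : nlin m (rotated t) k = cis (- k%:~R ^+ 3 * t) *
   \sum_(a <- box m | [&& a != 0, k - a != 0 & (absz (k - a)%R <= m)%N])
      toC (Nterm (w t) k t a).
Proof.
rewrite /nlin mulr_sumr [RHS]big_mkcond; apply: eq_bigr => a _.
rewrite (eq_bigl (fun b => b == k - a)); last by move=> b; apply/eqP/eqP; lia.
have -> : \sum_(b <- box m | b == k - a) rotated t a * rotated t b
    = if (absz (k - a)%R <= m)%N then rotated t a * rotated t (k - a) else 0.
  rewrite -mem_box; case: ifP => km.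
    rewrite -big_filter (_ : [seq b <- box m | b == k - a] = [:: k - a]) ?big_seq1//.
    rewrite -(filter_pred1_uniq (box_uniq m) km); apply: eq_filter => b.
    by rewrite /= eq_sym.
  rewrite big_seq_cond big_pred0// => b; apply/negbTE/negP => /andP[bm /eqP bk].
  by move: km; rewrite -bk bm.
rewrite /rotated; have [->|a0] := eqVneq a 0; first by rewrite /= mul0r if_same.
have [->|ka0] := eqVneq (k - a) 0; first by rewrite /= mulr0.
case: ifP => //= _; rewrite toC_Nterm.
rewrite [LHS]mulrACA -cisD [RHS]mulrA -cisD; congr (cis _ * _).
by rewrite intrB; ring.
Qed.

Lemma galerkin_init k : k != 0 -> w 0 k = v0 k.
Proof. by move=> /wG[]. Qed.

Lemma galerkin_C1half k : k != 0 ->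
  cC1half (fun t => toC (w t k)) (fun t => toC (galerkin_rhs m (w t) k t)).
Proof.
move=> k0; have [_ c1 c2 d] := wG k0.
by split; split => // t /d[].
Qed.

Lemma rotated_flow : gal_flow m rotated.
Proof.
split=> [t|k km]; first by rewrite /rotated eqxx.
have [->|k0] := eqVneq k 0.
  apply: cC1half_eq (cC1half_cst 0) => [t|t _]; first by rewrite /rotated eqxx.
  by rewrite /gal_field; ring.
have := cC1halfM (cC1half_cis (- k%:~R ^+ 3)) (galerkin_C1half k0).
apply: cC1half_eq => [t|t _]; first by rewrite /rotated (negbTE k0).
rewrite /gal_field nlin_rotated toC_galerkin_rhs// /rotated (negbTE k0).
rewrite (_ : (- k%:~R ^+ 3)%:C = - (k%:~R ^+ 3)); last first.
  by rewrite rmorphN rmorphXn rmorph_int.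
by ring.
Qed.

(** The right side vanishes outside the window, so these modes keep the value of the datum instead
    of being 0. *)
Lemma galerkin_frozen k t : k \notin box m -> 0 <= t -> w t k = v0 k.
Proof.
move=> km t0; have k0 : k != 0 by apply: contraNneq km => ->; rewrite mem_box.
have [<- _ _ _] := wG k0.
have h : cC1half (fun t => toC (w t k)) (fun=> 0).
  apply: cC1half_eq (galerkin_C1half k0) => // s _.
  by rewrite /galerkin_rhs -mem_box (negbTE km).
by apply/toC_inj/complex_ext; [exact: C1half_const h.1 _ t0|exact: C1half_const h.2 _ t0].
Qed.

Hypothesis v0_real : real_seq v0.

Lemma rotated_real0 : {in box m, forall k, rotated 0 (- k) = (rotated 0 k)^*}.
Proof.
move=> k _; rewrite /rotated oppr_eq0; case: eqVneq => [_|k0]; first by rewrite conjc0.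
have kN0 : - k != 0 by rewrite oppr_eq0.
have [-> _ _ _] := wG k0; have [-> _ _ _] := wG kN0.
by rewrite !mulr0 !cis0 v0_real// toC_conj !mul1r.
Qed.

Lemma galerkin_real t : 0 <= t -> real_seq (w t).
Proof.
move=> t0 k k0; have [km|km] := boolP (k \in box m); last first.
  rewrite !galerkin_frozen ?v0_real//.
  by apply: contra km => /box_opp; rewrite opprK.
have := gal_flow_real rotated_flow rotated_real0 t0 km.
have conjE (s : R) (z : R[i]) : conjc (cis s * z) = cis (- s) * conjc z by rewrite cisN; exact: rmorphM.
rewrite /rotated oppr_eq0 (negbTE k0) conjE -toC_conj.
have -> : - (- k)%:~R ^+ 3 * t = - (- k%:~R ^+ 3 * t) by rewrite mulrNz; ring.
move=> /(congr1 ( *%R (cis (- k%:~R ^+ 3 * t)))); rewrite !mulrA -cisD subrr cis0 !mul1r.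
exact: toC_inj.
Qed.

Lemma normc_rotated t k : k != 0 -> normc (rotated t k) ^+ 2 = cabs2 (w t k).
Proof. by move=> k0; rewrite /rotated (negbTE k0) normcM normc_cis mul1r normc_toC. Qed.

Lemma sum_box_rotated (f : nat -> R) t :
  \sum_(k <- box m) f (absz k) * normc (rotated t k) ^+ 2
  = \sum_(0 <= n < m) f n.+1 * (cabs2 (w t n.+1%:Z) + cabs2 (w t (- n.+1%:Z))).
Proof.
rewrite sum_box_fold {1}/rotated eqxx normc0 expr0n mulr0 add0r.
by apply: eq_bigr => n _; rewrite !normc_rotated// -mulrDr.
Qed.

End Galerkin.

(** * Partial sums of the Sobolev norms *)

Section Hnorm.
Variable R : realType.
Implicit Types (v : seqZ R) (s : R).

Definition Hterm s v (n : nat) : R :=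
  n.+1%:R `^ (2 * s) * (cabs2 (v n.+1%:Z) + cabs2 (v (- n.+1%:Z))).

(** Bounds are stated for these finite sums, uniformly in [N]: they are real numbers and pass to the
    limit mode by mode, with no question of convergence of the full series. *)
Definition Hsum s v (N : nat) : R := \sum_(0 <= n < N) Hterm s v n.

Lemma cabs2_ge0 (z : cplx R) : 0 <= cabs2 z.
Proof. by rewrite addr_ge0 ?sqr_ge0. Qed.

Lemma Hterm_ge0 s v n : 0 <= Hterm s v n.
Proof. by rewrite mulr_ge0 ?powR_ge0// addr_ge0 ?cabs2_ge0. Qed.

Lemma Hsum_ge0 s v N : 0 <= Hsum s v N.
Proof. by apply: sumr_ge0 => n _; exact: Hterm_ge0. Qed.

Lemma Hsum_mono s v : {homo Hsum s v : m n / (m <= n)%N >-> m <= n}.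
Proof.
move=> m n mn; rewrite /Hsum (@big_cat_nat _ _ _ m 0 n)//= lerDl.
by apply: sumr_ge0 => k _; exact: Hterm_ge0.
Qed.

Lemma Hsum_trunc_le s v m N : \sum_(0 <= j < N) (if (j < m)%N then Hterm s v j else 0) <= Hsum s v m.
Proof.
rewrite -big_mkcond; have [mN|/ltnW Nm] := leqP m N.
  by rewrite -(big_nat_widen 0 m N xpredT).
apply: le_trans (Hsum_mono s v Nm).
by rewrite big_mkcond; apply: ler_sum => j _; case: ifP => // _; exact: Hterm_ge0.
Qed.

Lemma Hnorm2E s v : Hnorm2 s v = (\sum_(0 <= n <oo) (Hterm s v n)%:E)%E.
Proof. by []. Qed.

Lemma Hnorm2_ge0 s v : (0 <= Hnorm2 s v)%E.
Proof. by apply: nneseries_ge0 => n _ _; rewrite lee_fin Hterm_ge0. Qed.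

Lemma Hsum_le_Hnorm2 s v N : ((Hsum s v N)%:E <= Hnorm2 s v)%E.
Proof.
rewrite /Hsum -sumEFin Hnorm2E; apply: nneseries_lim_ge => n _ _.
by rewrite lee_fin Hterm_ge0.
Qed.

Lemma Hnorm2_le s v (B : R) : (forall N, Hsum s v N <= B) -> (Hnorm2 s v <= B%:E)%E.
Proof.
move=> vB; rewrite Hnorm2E; apply: lime_le.
  by apply: is_cvg_nneseries => n _ _; rewrite lee_fin Hterm_ge0.
by near=> N; rewrite /= sumEFin lee_fin; exact: vB.
Unshelve. all: by end_near. Qed.

Lemma Hnorm2_fine s v : (Hnorm2 s v < +oo)%E -> Hnorm2 s v = (fine (Hnorm2 s v))%:E.
Proof. by move=> vs; rewrite fineK// ge0_fin_numE// Hnorm2_ge0. Qed.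

Lemma Hsum_le_fine s v N : (Hnorm2 s v < +oo)%E -> Hsum s v N <= fine (Hnorm2 s v).
Proof. by move=> vs; rewrite -lee_fin -Hnorm2_fine// Hsum_le_Hnorm2. Qed.

Lemma Hnorm_fin s v (B : R) : Hnorm2 s v = B%:E -> Hnorm s v = (Num.sqrt B)%:E.
Proof.
move=> vB; rewrite /Hnorm vB poweR_EFin powR12_sqrt//.
by rewrite -lee_fin -vB Hnorm2_ge0.
Qed.

Lemma Hnorm_le s v (B : R) : (forall N, Hsum s v N <= B) -> (Hnorm s v <= (Num.sqrt B)%:E)%E.
Proof.
move=> vB; have B2 := Hnorm2_le vB.
have fin : (Hnorm2 s v < +oo)%E by apply: le_lt_trans B2 (ltry _).
rewrite (Hnorm_fin (Hnorm2_fine fin)) lee_fin ler_wsqrtr//.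
by rewrite -lee_fin -Hnorm2_fine.
Qed.

Lemma fine_Hnorm_sqr s v : (Hnorm2 s v < +oo)%E -> fine (Hnorm s v) ^+ 2 = fine (Hnorm2 s v).
Proof.
move=> vs; rewrite (Hnorm_fin (Hnorm2_fine vs)) sqr_sqrtr// fine_ge0//.
exact: Hnorm2_ge0.
Qed.

Lemma Hterm0E v n : Hterm 0 v n = cabs2 (v n.+1%:Z) + cabs2 (v (- n.+1%:Z)).
Proof. by rewrite /Hterm mulr0 powRr0 mul1r. Qed.

Lemma Hterm_mono s s' v n : s <= s' -> Hterm s v n <= Hterm s' v n.
Proof.
move=> ss'; apply: ler_wpM2r; first by rewrite addr_ge0 ?cabs2_ge0.
by apply: ler_powR; rewrite ?ler_wpM2l ?ler1n.
Qed.

End Hnorm.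

(** * The bound uniform in the truncation *)

Section Apriori.
Variables (R : realType) (s0 : R).
Hypothesis s0_gt0 : 0 < s0.

(** The growth condition on weights uses integer powers, so the real exponent 2 s0 is rounded up. *)
Definition weight_degree : nat := (Num.trunc (2 * s0)).+1.
Local Notation n := weight_degree.

(** The length of the flat part of the weight, as required by [flow_bound]. The choice is not
    circular: [symbC] depends on the degree [n] only. *)
Definition cutoff (x : R) : nat := (Num.trunc (11 * symbC R n * x)).+1.

Definition growth (x T : R) : R :=
  3 * (cutoff x)%:R `^ (2 * s0) * expR (symbC R n * (8 + 32 * 2 ^+ n) / 3 * x ^+ 2 * T) + 1.

Definition apriori (x T y : R) : R := Num.sqrt (growth x T * y ^+ 2).

Variables (T : R) (v0 : seqZ R) (m : nat) (w : R -> seqZ R).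
Hypotheses (v0H : inH s0 v0) (wG : galerkin_solution m w v0).

Let x := fine (Hnorm 0 v0).
Let y := fine (Hnorm s0 v0).

Lemma inH_Hnorm2_0 : (Hnorm2 0 v0 < +oo)%E.
Proof.
apply: le_lt_trans v0H.2; apply: lee_nneseries => [k _ _|k _].
  by rewrite lee_fin; exact: (Hterm_ge0 0).
by rewrite lee_fin; exact: (Hterm_mono v0 k (ltW s0_gt0)).
Qed.

(** The condition m <= N makes the sum contain all moving modes; a smaller window could exchange
    mass with the rest. *)
Lemma galerkin_conserved (t : R) N : 0 <= t -> (m <= N)%N -> Hsum 0 (w t) N = Hsum 0 v0 N.
Proof.
move=> t0 mN; rewrite /Hsum !(@big_cat_nat _ _ _ m 0 N)//=; congr (_ + _).
  have : \sum_(k <- box m) 1 * normc (rotated w t k) ^+ 2 = \sum_(k <- box m) 1 * normc (rotated w 0 k) ^+ 2.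
    by rewrite -!mulr_sumr (flow_conserved (rotated_flow wG) (rotated_real0 wG v0H.1) t0).
  rewrite (sum_box_rotated m w (fun=> 1) t) (sum_box_rotated m w (fun=> 1) 0) => h.
  under eq_bigr do rewrite Hterm0E -[_ + _]mul1r.
  rewrite h; apply: eq_bigr => k _; rewrite Hterm0E mul1r.
  by rewrite !(galerkin_init wG).
rewrite big_nat [RHS]big_nat; apply: eq_bigr => k /andP[mk _].
by have [b1 b2] := succ_notin_box mk; rewrite !Hterm0E !(galerkin_frozen wG).
Qed.

Lemma galerkin_apriori (t : R) N : 0 <= t <= T -> Hsum s0 (w t) N <= growth x T * y ^+ 2.
Proof.
move=> /andP[t0 tT].
have x0 : 0 <= x by rewrite fine_ge0// poweR_ge0.
pose nu := pow_weight s0 (cutoff x).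
have C0 : 0 <= symbC R n by exact: symbC_ge0.
have nuW : weight n (cutoff x) nu.
  apply: pow_weightP => //; first exact: ltW.
  by rewrite /n ltW// truncnS_gt.
have U0x : l2 m (fun k => normc (rotated w 0 k)) <= x.
  rewrite -(@ler_pXn2r _ 2) ?nnegrE ?l2_ge0// l2_sqr.
  rewrite -[leLHS]mul1r mulr_sumr (sum_box_rotated m w (fun=> 1) 0).
  under eq_bigr do rewrite mul1r.
  rewrite /x fine_Hnorm_sqr ?inH_Hnorm2_0//; apply: le_trans (Hsum_le_fine m inH_Hnorm2_0).
  apply: ler_sum => k _; rewrite Hterm0E.
  by rewrite !(galerkin_init wG).
have cx : 11 * symbC R n * x <= (cutoff x)%:R by rewrite ltW// truncnS_gt.
have := flow_bound (rotated_flow wG) (rotated_real0 wG v0H.1) nuW (ltn0Sn _) U0x cx t0.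
set K := symbC R n * (8 + 32 * 2 ^+ n) / 3 * x ^+ 2.
have K0 : 0 <= K.
  have p0 : 0 <= 2 ^+ n :> R by exact: exprn_ge0.
  by apply: mulr_ge0 (sqr_ge0 _); rewrite -mulrA; apply: mulr_ge0 => //; lra.
have hE s : \sum_(k <- box m) (nu (absz k) * normc (rotated w s k)) ^+ 2
  = \sum_(0 <= j < m) nu j.+1 ^+ 2 * (cabs2 (w s j.+1%:Z) + cabs2 (w s (- j.+1%:Z))).
  by rewrite -(sum_box_rotated m w (fun j => nu j ^+ 2)); apply: eq_bigr => k _; rewrite exprMn.
rewrite !hE => h.
have h0 : \sum_(0 <= j < m) nu j.+1 ^+ 2 * (cabs2 (w 0 j.+1%:Z) + cabs2 (w 0 (- j.+1%:Z)))
    <= (cutoff x)%:R `^ (2 * s0) * y ^+ 2.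
  rewrite /y fine_Hnorm_sqr ?v0H.2//.
  apply: le_trans (ler_wpM2l (powR_ge0 _ _) (Hsum_le_fine m v0H.2)).
  rewrite mulr_sumr; apply: ler_sum => k _; rewrite /Hterm mulrA.
  rewrite !(galerkin_init wG)//.
  apply: ler_wpM2r; first by rewrite addr_ge0 ?cabs2_ge0.
  exact: pow_weight_le (ltW s0_gt0) _ _.
have e0 : 0 <= expR (K * T) by exact: expR_ge0.
have eT : expR (K * t) <= expR (K * T) by rewrite ler_expR ler_wpM2l.
rewrite /growth mulrDl mul1r -/K.
(* Moving modes are separated from frozen ones; the latter are bounded by the datum. *)
apply: (@le_trans _ _ (\sum_(0 <= j < N) (if (j < m)%N then Hterm s0 (w t) j else 0) + Hsum s0 v0 N)).
  rewrite -big_split; apply: ler_sum => j _ /=; case: ltnP => jm; first by rewrite lerDl Hterm_ge0.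
  by have [b1 b2] := succ_notin_box jm; rewrite add0r /Hterm !(galerkin_frozen wG).
apply: lerD; last by rewrite /y fine_Hnorm_sqr ?v0H.2//; exact: Hsum_le_fine v0H.2.
apply: le_trans (Hsum_trunc_le s0 (w t) m N) _.
apply: (@le_trans _ _ (\sum_(0 <= j < m) nu j.+1 ^+ 2 * (cabs2 (w t j.+1%:Z) + cabs2 (w t (- j.+1%:Z))))).
  apply: ler_sum => j _; apply: ler_wpM2r; first by rewrite addr_ge0 ?cabs2_ge0.
  exact: pow_weight_ge (ltW s0_gt0).
apply: le_trans h _; have y0 : 0 <= (cutoff x)%:R `^ (2 * s0) * y ^+ 2.
  by rewrite mulr_ge0 ?powR_ge0 ?sqr_ge0.
apply: (@le_trans _ _ (3 * ((cutoff x)%:R `^ (2 * s0) * y ^+ 2) * expR (K * T))).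
  apply: ler_pM; rewrite ?expR_ge0// ?ler_wpM2l//.
  apply: mulr_ge0 => //; apply: sumr_ge0 => j _.
  by rewrite mulr_ge0 ?sqr_ge0// addr_ge0 ?cabs2_ge0.
by apply: eq_ler; ring.
Qed.

End Apriori.

(** * Compactness and passage to the limit *)

Section Compactness.
Variable R : realType.

(** The limit is the supremum of the levels lying below [x] on a set of [U]. Being an ultrafilter,
    [U] contains either the set where [x] is at least sup + e or its complement, and the former
    contradicts the supremum. *)
Lemma ultra_bounded_limit (U : set_system nat) (x : nat -> R) (B : R) :
  UltraFilter U -> (forall n, `|x n| <= B) ->
  exists l : R, forall e : R, 0 < e -> U [set n | `|x n - l| <= e].
Proof.
move=> UU xB; have PU : ProperFilter U by exact: ultra_proper.
pose S := [set a : R | U [set n | a <= x n]].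
have SB : S (- B).
  by rewrite /S /=; apply: filterS filterT => n _ /=; have := xB n; rewrite ler_norml => /andP[].
have Sub : ubound S B.
  move=> a Sa; have [n /= an] := filter_ex Sa.
  by apply: le_trans an _; have := xB n; rewrite ler_norml => /andP[].
have Ssup : has_sup S by split; [exists (- B)|exists B].
exists (sup S) => e e0.
have h1 : U [set n | sup S - e <= x n].
  have [a Sa ae] := sup_adherent e0 Ssup.
  by apply: filterS Sa => n /= an; apply: le_trans an; exact: ltW.
have h2 : U [set n | x n <= sup S + e].
  have [h|h] := in_ultra_setVsetC [set n | sup S + e <= x n] UU.
    have := ub_le_sup (ex_intro _ B Sub) h; rewrite gerDl leNgt e0 //.
  by apply: filterS h => n /= /negP; rewrite -ltNge => /ltW.
apply: filterS (filterI h1 h2) => n /= [l1 l2].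
by rewrite ler_distl l1 l2.
Qed.

Lemma filter_forall_lt (U : set_system nat) (P : nat -> set nat) (j : nat) : Filter U ->
  (forall i, U (P i)) -> U [set n | forall i, (i < j)%N -> P i n].
Proof.
move=> FU UP; elim: j => [|j IH]; first by apply: filterS filterT => n _ i.
apply: filterS (filterI IH (UP j)) => n /= [h1 h2] i.
by rewrite ltnS leq_eqVlt => /orP[/eqP ->//|]; exact: h1.
Qed.

Lemma subsequence_of_frequently (S : nat -> set nat) :
  (forall j N, exists2 n, (N <= n)%N & S j n) ->
  exists2 phi : nat -> nat, {homo phi : a b / (a < b)%N} & forall j, S j (phi j).
Proof.
move=> h.
have /choice [sel selP] : forall p : nat * nat, exists n, (p.2 <= n)%N /\ S p.1 n.
  by move=> [j N]; have [n Nn Sn] := h j N; exists n.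
pose phi := fix phi j := if j is i.+1 then sel (i.+1, (phi i).+1) else sel (0%N, 0%N).
exists phi; last by case=> [|j]; exact: (selP (_, _)).2.
by apply: homo_ltn => [a b c|j]; [exact: ltn_trans|exact: (selP (_, _)).1].
Qed.

(* The limit is taken along an ultrafilter refining [\oo], which fixes all its values at once;
   the subsequence is then extracted from finitely many closeness conditions at each step. *)
Lemma equicontinuous_subsequence (I : countType) (T : R) (f : nat -> I -> R -> R) (B L : I -> R) :
  0 < T ->
  (forall m q t, 0 <= t <= T -> `|f m q t| <= B q) ->
  (forall m q s t, 0 <= s <= T -> 0 <= t <= T -> `|f m q t - f m q s| <= L q * `|t - s|) ->
  exists (phi : nat -> nat) (g : I -> R -> R), {homo phi : a b / (a < b)%N} /\
    forall q (e : R), 0 < e -> exists J, forall j, (J <= j)%N ->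
      forall t, 0 <= t <= T -> `|f (phi j) q t - g q t| <= e.
Proof.
move=> T0 fB fL.
have [U [UU subU]] := ultraFilterLemma eventually_filter.
have PU : ProperFilter U by exact: ultra_proper.
have /choice [g gP] : forall qt : I * R, exists l : R, 0 <= qt.2 <= T ->
    forall e : R, 0 < e -> U [set n | `|f n qt.1 qt.2 - l| <= e].
  move=> [q t] /=; have [tT|] := boolP (0 <= t <= T); last by exists 0.
  by have [l lP] := @ultra_bounded_limit U _ (B q) UU (fun n => fB n q t tT); exists l.
pose tg (j i : nat) : R := i%:R / j.+1%:R * T.
have tgT j i : (i <= j.+1)%N -> 0 <= tg j i <= T.
  move=> ij; rewrite /tg mulr_ge0 ?divr_ge0 ?(ltW T0)//= ler_piMl ?(ltW T0)//.
  by rewrite ler_pdivrMr// mul1r ler_nat.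
have gL q s t : 0 <= s <= T -> 0 <= t <= T -> `|g (q, t) - g (q, s)| <= L q * `|t - s|.
  move=> sT tT; apply/ler_addgt0Pr => e e0; have e2 : 0 < e / 2 by rewrite divr_gt0.
  have [n /= [h1 h2]] := filter_ex (filterI (gP (q, t) tT _ e2) (gP (q, s) sT _ e2)).
  have h3 := fL n q s t sT tT.
  rewrite (_ : _ - _ = - (f n q t - g (q, t)) + (f n q t - f n q s) + (f n q s - g (q, s))); last by ring.
  rewrite (splitr e) [leRHS]addrCA [leRHS]addrA; apply: le_trans (ler_normD _ _) _; apply: lerD h2.
  by apply: le_trans (ler_normD _ _) _; rewrite normrN lerD.
(* At stage [j] closeness is required for the first j + 1 codes of indices, at the j + 2 points of
   the grid of mesh T / (j + 1). *)
pose S j := [set n | forall p, (p < j.+1)%N -> forall i, (i < j.+2)%N ->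
   if unpickle p is Some q then `|f n q (tg j i) - g (q, tg j i)| <= j.+1%:R^-1 else true].
have US j : U (S j).
  apply: (filter_forall_lt (P := fun p => [set n | forall i, (i < j.+2)%N ->
   if unpickle p is Some q then `|f n q (tg j i) - g (q, tg j i)| <= j.+1%:R^-1 else true])) => p.
  case: (unpickle p) => [q|]; last by apply: filterS filterT.
  have h := @filter_forall_lt U (fun i => [set n | (i < j.+2)%N -> `|f n q (tg j i) - g (q, tg j i)| <= j.+1%:R^-1]) j.+2 _ _.
  apply: filterS (h _ _) => [n /= hn i ij|i]; first exact: hn.
  have [ij|ij] := boolP (i < j.+2)%N; last by apply: filterS filterT => n _.
  have p0 : 0 < j.+1%:R^-1 :> R by rewrite invr_gt0.
  by apply: filterS (gP (q, tg j i) (tgT j i ij) _ p0) => n hn _.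
have [phi phi_mono phiS] : exists2 phi : nat -> nat, {homo phi : a b / (a < b)%N} & forall j, S j (phi j).
  apply: subsequence_of_frequently => j N.
  have UN : U [set n | (N <= n)%N] by apply: subU; exact: nbhs_infty_ge.
  by have [n /= [Sn Nn]] := filter_ex (filterI (US j) UN); exists n.
exists phi, (fun q t => g (q, t)); split=> // q e e0.
have L0 : 0 <= L q.
  have := fL 0%N q 0 T; rewrite !lexx (ltW T0) => /(_ isT isT) h.
  have : 0 <= L q * `|T - 0| by exact: le_trans h.
  by rewrite subr0 gtr0_norm// pmulr_lge0.
(* The error at stage [j] is at most C / (j + 1): 1 for the grid point, and twice L T for moving to
   it in the sequence and in the limit. *)
pose C := 1 + 2 * (L q * T).
have C0 : 0 < C by rewrite /C ltr_pwDl// !mulr_ge0// ltW.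
exists (maxn (pickle q) (Num.trunc (C / e)).+1) => j; rewrite geq_max => /andP[qj ej] t tT.
have j0 : 0 < j.+1%:R :> R by [].
have Cj : C / j.+1%:R <= e.
  rewrite ler_pdivrMr// mulrC -ler_pdivrMr//; apply/ltW/(lt_le_trans (truncnS_gt _)).
  by rewrite ler_nat; apply: leq_trans ej _.
pose i := Num.trunc (t / T * j.+1%:R).
have /andP[t0 tT'] := tT.
have tTj : 0 <= t / T * j.+1%:R by rewrite mulr_ge0// divr_ge0// ltW.
have /andP[i1 i2] := truncn_itv tTj.
have ij : (i < j.+2)%N.
  rewrite ltnS -(ler_nat R); apply: le_trans i1 _.
  by rewrite ler_piMl// ler_pdivrMr// mul1r.
have ti : `|t - tg j i| <= T / j.+1%:R.
  have -> : t = (t / T * j.+1%:R) / j.+1%:R * T by field; rewrite !gt_eqF.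
  rewrite /tg -mulrBl -mulrBl normrM (gtr0_norm T0) mulrC ler_wpM2l ?(ltW T0)//.
  rewrite normrM normfV [`|j.+1%:R|]ger0_norm// ler_piMl ?invr_ge0//.
  by rewrite ger0_norm ?subr_ge0// lerBlDl natr1 ltW.
have := phiS j (pickle q) (leq_ltn_trans qj (ltnSn j)) i ij; rewrite pickleK => h.
have tgi := tgT j i (ij : (i <= j.+1)%N).
have h1 := fL (phi j) q (tg j i) t tgi tT; have h2 := gL q t (tg j i) tT tgi.
apply: le_trans Cj.
rewrite (_ : _ - _ = (f (phi j) q t - f (phi j) q (tg j i))
   + (f (phi j) q (tg j i) - g (q, tg j i)) + (g (q, tg j i) - g (q, t))); last by ring.
apply: le_trans (ler_normD _ _) _.
apply: (@le_trans _ _ (L q * (T / j.+1%:R) + j.+1%:R^-1 + L q * (T / j.+1%:R))).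
  apply: lerD; last by apply: le_trans h2 _; rewrite distrC ler_wpM2l.
  by apply: le_trans (ler_normD _ _) _; apply: lerD => //; apply: le_trans h1 _; rewrite ler_wpM2l.
by apply: eq_ler; rewrite /C; field; rewrite gt_eqF.
Qed.
End Compactness.

(** * Limits with explicit rates and the convolution series *)

Section Limits.
Variable R : realType.

(** The quadratic term and the duality pairing are defined as bare values of [limn]; this gives at
    once the existence of the limit and its distance to the partial sums. *)
Lemma cvg_of_rate (u d : nat -> R) :
  (forall N N', (N <= N')%N -> `|u N' - u N| <= d N) -> d @ \oo --> 0 ->
  u @ \oo --> limn u /\ forall N, `|limn u - u N| <= d N.
Proof.
move=> ud d0.
have cu : cvg (u @ \oo).
  apply: cauchy_cvg; apply: cauchy_exP => e e0.
  move/cvgrPdist_lt : d0 => /(_ e e0) [N _ h]; exists (u N); exists N => // N' /= NN'.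
  rewrite /ball /= distrC; apply: le_lt_trans (ud _ _ NN') _.
  have := h N (leqnn _); rewrite /= sub0r normrN => h'; exact: le_lt_trans (ler_norm _) h'.
split=> // N; apply/ler_addgt0Pr => e e0.
move/cvgrPdist_le : cu => /(_ e e0) [N' _ h].
have := h (maxn N N') (leq_maxr _ _) => /= h1.
have h2 := ud N (maxn N N') (leq_maxl _ _).
rewrite (_ : limn u - u N = (u (maxn N N') - u N) + (limn u - u (maxn N N'))); last by ring.
by apply: le_trans (ler_normD _ _) _; apply: lerD.
Qed.

Definition ccvg (z : nat -> R[i]) (l : R[i]) :=
  (fun j => complex.Re (z j)) @ \oo --> complex.Re l /\ (fun j => complex.Im (z j)) @ \oo --> complex.Im l.

Lemma ccvg_cst z : ccvg (fun=> z) z.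
Proof. by split; exact: cvg_cst. Qed.

Lemma ccvgM y z k l : ccvg y k -> ccvg z l -> ccvg (fun j => y j * z j) (k * l).
Proof.
move=> [yr yi] [zr zi]; split.
  rewrite Re_mul (_ : (fun j => complex.Re _) = fun j => complex.Re (y j) * complex.Re (z j)
    - complex.Im (y j) * complex.Im (z j)); last by apply/funext => j; rewrite Re_mul.
  by apply: cvgB; exact: cvgM.
rewrite Im_mul (_ : (fun j => complex.Im _) = fun j => complex.Re (y j) * complex.Im (z j)
  + complex.Im (y j) * complex.Re (z j)); last by apply/funext => j; rewrite Im_mul.
by apply: cvgD; exact: cvgM.
Qed.

Lemma ccvgD y z k l : ccvg y k -> ccvg z l -> ccvg (fun j => y j + z j) (k + l).
Proof.
move=> [yr yi] [zr zi]; split.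
  rewrite Re_add (_ : (fun j => complex.Re _) = fun j => complex.Re (y j) + complex.Re (z j)).
    exact: cvgD.
  by apply/funext => j; rewrite Re_add.
rewrite Im_add (_ : (fun j => complex.Im _) = fun j => complex.Im (y j) + complex.Im (z j)).
  exact: cvgD.
by apply/funext => j; rewrite Im_add.
Qed.

Lemma ccvg_sum (I : Type) (r : seq I) (P : pred I) (F : I -> nat -> R[i]) (l : I -> R[i]) :
  (forall i, P i -> ccvg (F i) (l i)) ->
  ccvg (fun j => \sum_(i <- r | P i) F i j) (\sum_(i <- r | P i) l i).
Proof.
move=> h; elim: r => [|i r IH].
  rewrite big_nil (_ : (fun j => _) = fun=> 0); first exact: ccvg_cst.
  by apply/funext => j; rewrite big_nil.
have e : (fun j => \sum_(i0 <- i :: r | P i0) F i0 j)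
    = (fun j => if P i then F i j + \sum_(i0 <- r | P i0) F i0 j else \sum_(i0 <- r | P i0) F i0 j).
  by apply/funext => j; rewrite big_cons.
rewrite e big_cons; case: ifP => // Pi.
exact: ccvgD (h i Pi) IH.
Qed.

Lemma ccvgP z l : (forall e : R, 0 < e -> \forall j \near \oo, normc (l - z j) <= e) -> ccvg z l.
Proof.
move=> h; split; apply/cvgrPdist_le => e e0; near=> j.
  have : normc (l - z j) <= e by near: j; exact: h.
  by apply: le_trans; rewrite -Re_sub; exact: Re_le_normc.
have : normc (l - z j) <= e by near: j; exact: h.
by apply: le_trans; rewrite -Im_sub; exact: Im_le_normc.
Unshelve. all: by end_near. Qed.

Lemma normc_le_ReIm (z : R[i]) : normc z <= `|complex.Re z| + `|complex.Im z|.
Proof.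
have -> : z = (complex.Re z)%:C + 'i * (complex.Im z)%:C.
  by rewrite {1}[z]complexE.
apply: le_trans (normcD _ _) _; rewrite normcM normc_i mul1r !normc_real.
by case: z => a b; rewrite /= !(mulr0, mul0r, mul1r, addr0, add0r, subr0, sub0r, oppr0).
Qed.

End Limits.

Section Convolution.
Variable R : realType.
Implicit Types (v : seqZ R) (k : int) (s t X Y : R).

Lemma sum_subseq_le (I : eqType) (r1 r2 : seq I) (F : I -> R) :
  uniq r1 -> uniq r2 -> {subset r1 <= r2} -> (forall i, 0 <= F i) ->
  \sum_(i <- r1) F i <= \sum_(i <- r2) F i.
Proof.
move=> u1 u2 sub F0.
have e : perm_eq [seq i <- r2 | i \in r1] r1.
  apply: uniq_perm => //; first exact: filter_uniq.
  by move=> i; rewrite mem_filter andb_idr// => ir; exact: sub.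
rewrite -(perm_big _ e) /= big_filter [leRHS](bigID (mem r1)) /= lerDl.
exact: sumr_ge0.
Qed.

Lemma sum_box_restrict N N' (P : pred int) (F : int -> R[i]) : (N <= N')%N ->
  \sum_(a <- box N | P a) F a = \sum_(a <- box N' | P a && (absz a <= N)%N) F a.
Proof.
move=> NN; rewrite -[LHS]big_filter -[RHS]big_filter; apply: perm_big.
apply: uniq_perm; rewrite ?filter_uniq ?box_uniq// => a.
by rewrite !mem_filter !mem_box; case: (P a) => //=; lia.
Qed.

Lemma sum_box_Hsum s v N :
  \sum_(a <- box N | a != 0) (absz a)%:R `^ (2 * s) * cabs2 (v a) = Hsum s v N.
Proof.
rewrite big_mkcond (sum_box_fold N) eqxx/= add0r.
by apply: eq_bigr => n _; rewrite /Hterm [RHS]mulrDr.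
Qed.

Lemma sum_box_cabs2 v N : \sum_(a <- box N | a != 0) cabs2 (v a) = Hsum 0 v N.
Proof.
by rewrite -sum_box_Hsum; apply: eq_bigr => a _; rewrite mulr0 powRr0 mul1r.
Qed.

Lemma cabs2_le_Hsum v k N : k != 0 -> (absz k <= N)%N -> cabs2 (v k) <= Hsum 0 v N.
Proof.
move=> k0 kN; rewrite -sum_box_cabs2 big_mkcond (bigD1_seq k) ?mem_box ?box_uniq//= k0.
by rewrite lerDl; apply: sumr_ge0 => a _; case: ifP => // _; exact: cabs2_ge0.
Qed.

Lemma inv_powR_cvg0 s : 0 < s -> (fun N : nat => (N.+1%:R `^ s)^-1) @ \oo --> (0 : R).
Proof.
move=> s0; apply/cvgrPdist_le => e e0.
exists (Num.trunc (e^-1 `^ s^-1)) => // N /= Ne; rewrite sub0r normrN ger0_norm ?invr_ge0 ?powR_ge0//.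
rewrite -[e]invrK lef_pV2 ?posrE ?powR_gt0 ?invr_gt0//.
have sn0 : s != 0 by rewrite gt_eqF.
have -> : e^-1 = (e^-1 `^ s^-1) `^ s by rewrite -powRrM mulVf// powRr1// invr_ge0 ltW.
apply: ge0_ler_powR; rewrite ?nnegrE ?powR_ge0 ?(ltW s0)//.
by apply: ltW; apply: lt_le_trans (truncnS_gt _) _; rewrite ler_nat ltnS.
Qed.

Definition tail_rate s X Y (N : nat) : R := Num.sqrt Y * Num.sqrt X * (N.+1%:R `^ s)^-1.

Lemma tail_rate_cvg0 s X Y : 0 < s -> tail_rate s X Y @ \oo --> 0.
Proof.
move=> s0; rewrite -[0](mulr0 (Num.sqrt Y * Num.sqrt X)).
by apply: cvgMl_tmp; exact: inv_powR_cvg0.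
Qed.

Definition conv_sum (u : seqZ R) k t N : R[i] :=
  \sum_(a <- box N | (a != 0) && (k - a != 0)) toC (Nterm u k t a).

Definition conv_lim (u : seqZ R) k t : R[i] := NRe u k t +i* NIm u k t.

Lemma NRe_conv_sum (u : seqZ R) k t : NRe u k t = limn (fun N => complex.Re (conv_sum u k t N)).
Proof.
rewrite /NRe; congr (limn _); apply/funext => N; rewrite /conv_sum Re_sum.
exact: (sum_box_ord N (fun a => (a != 0) && (k - a != 0)) (fun a => (Nterm u k t a).1)).
Qed.

Lemma NIm_conv_sum (u : seqZ R) k t : NIm u k t = limn (fun N => complex.Im (conv_sum u k t N)).
Proof.
rewrite /NIm; congr (limn _); apply/funext => N; rewrite /conv_sum Im_sum.
exact: (sum_box_ord N (fun a => (a != 0) && (k - a != 0)) (fun a => (Nterm u k t a).2)).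
Qed.

Variables (s X Y : R) (v : seqZ R).
Hypotheses (s_gt0 : 0 < s) (vX : forall N, Hsum 0 v N <= X) (vY : forall N, Hsum s v N <= Y).

(** The phases have modulus one, so Cauchy-Schwarz applies: v_a with |a| > N contributes sqrt Y (N +
    1) ^ (- s) by the H^s bound, and v_(k - a) contributes sqrt X. *)
Lemma conv_tail k t N N' (P : pred int) :
  (forall a, P a -> [&& (N < absz a)%N, a != 0 & k - a != 0]) ->
  normc (\sum_(a <- box N' | P a) toC (Nterm v k t a)) <= tail_rate s X Y N.
Proof.
move=> hP; apply: le_trans (normc_sum _ _ _) _.
pose x a := if (N < absz a)%N && (a != 0) then normc (toC (v a)) else 0.
pose y a := if k - a != 0 then normc (toC (v (k - a))) else 0.
apply: (@le_trans _ _ (\sum_(a <- box N') x a * y a)).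
  rewrite big_mkcond; apply: ler_sum => a _; case: ifP => [/hP/and3P[h1 h2 h3]|_].
    by rewrite /x /y h1 h2 h3 toC_Nterm !normcM normc_cis mul1r.
  by rewrite mulr_ge0// /x /y; case: ifP => // _; exact: normc_ge0.
apply: le_trans (cauchy_schwarz_sum _ _ _) _.
have N0 : 0 < N.+1%:R `^ (2 * s) by rewrite powR_gt0.
have Ns : 0 < (N.+1%:R `^ s)^-1 by rewrite invr_gt0 powR_gt0.
have -> : tail_rate s X Y N = Num.sqrt (Y * (N.+1%:R `^ (2 * s))^-1) * Num.sqrt X.
  rewrite /tail_rate mulrAC sqrtrM ?(le_trans (Hsum_ge0 s v 0))//; congr (_ * _ * _).
  rewrite -[LHS]gtr0_norm// -sqrtr_sqr exprVn -[in LHS]powR_mulrn ?powR_ge0//.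
  by rewrite -powRrM (mulrC s).
apply: ler_pM; rewrite ?sqrtr_ge0//; apply: ler_wsqrtr.
  rewrite ler_pdivlMr// mulr_suml; apply: le_trans (vY N').
  rewrite -sum_box_Hsum [leRHS]big_mkcond; apply: ler_sum => a _; rewrite /x.
  case: (ltnP N (absz a)) => Na /=; last first.
    by rewrite expr0n mul0r; case: ifP => // _; rewrite mulr_ge0 ?powR_ge0 ?cabs2_ge0.
  case: ifP => // _; last by rewrite expr0n mul0r.
  rewrite normc_toC mulrC ler_wpM2r ?cabs2_ge0// ge0_ler_powR ?nnegrE ?ler_nat//.
  by rewrite mulr_ge0// ltW.
(* The reflection a -> k - a maps the window of size N' into the one of size N' + |k|. *)
apply: le_trans (vX (N' + absz k)); rewrite -sum_box_cabs2 [leRHS]big_mkcond.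
rewrite -(big_map (fun a => k - a) xpredT (fun b => (if b != 0 then normc (toC (v b)) else 0) ^+ 2)).
apply: le_trans (sum_subseq_le (r2 := box (N' + absz k)) _ _ _ _) _; rewrite ?box_uniq//.
- by rewrite map_inj_uniq ?box_uniq// => a b /(congr1 (fun z => k - z)); rewrite !subKr.
- by move=> b /mapP[a]; rewrite !mem_box => h ->; lia.
- by move=> b; exact: sqr_ge0.
by apply: ler_sum => b _; case: ifP => _; rewrite ?normc_toC// expr0n.
Qed.

Lemma conv_sum_rate k t N N' : (N <= N')%N ->
  normc (conv_sum v k t N' - conv_sum v k t N) <= tail_rate s X Y N.
Proof.
move=> NN; rewrite /conv_sum (sum_box_restrict _ _ NN).
rewrite (bigID (fun a => (absz a <= N)%N))/= addrAC subrr add0r.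
by apply: conv_tail => a /andP[/andP[-> ->]]; rewrite -ltnNge => ->.
Qed.

(** Real and imaginary parts are separate limits, each with error [tail_rate]; hence the factor
    2. *)
Lemma conv_lim_rate k t N : normc (conv_lim v k t - conv_sum v k t N) <= 2 * tail_rate s X Y N.
Proof.
have d0 := tail_rate_cvg0 X Y s_gt0.
have rr i j : (i <= j)%N ->
    `|complex.Re (conv_sum v k t j) - complex.Re (conv_sum v k t i)| <= tail_rate s X Y i.
  move=> NN; apply: le_trans (conv_sum_rate k t NN); rewrite -Re_sub.
  exact: Re_le_normc.
have ri i j : (i <= j)%N ->
    `|complex.Im (conv_sum v k t j) - complex.Im (conv_sum v k t i)| <= tail_rate s X Y i.
  move=> NN; apply: le_trans (conv_sum_rate k t NN); rewrite -Im_sub.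
  exact: Im_le_normc.
have [_ /(_ N) hr] := cvg_of_rate rr d0; have [_ /(_ N) hi] := cvg_of_rate ri d0.
apply: le_trans (normc_le_ReIm _) _; rewrite mulr_natl mulr2n; apply: lerD.
  by rewrite Re_sub /= NRe_conv_sum.
by rewrite Im_sub /= NIm_conv_sum.
Qed.

End Convolution.

(** * Time regularity of the Galerkin modes *)

Section HalfLine.
Variable R : realType.
Implicit Types f : R -> R.

Lemma half_line_itv (t : R) : `[0, t] `<=` `[0, +oo[.
Proof. by move=> x /=; rewrite !in_itv/= andbT => /andP[]. Qed.

Lemma C1half_nincr f f' : C1half f f' -> (forall t : R, 0 < t -> f' t <= 0) ->
  forall s t : R, 0 <= s -> s <= t -> f t <= f s.
Proof.
move=> [cf df] f'0 s t s0 st; apply: (ler0_derive1_nincry _ _ cf) s0 st => x.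
  by rewrite in_itv/= andbT => /df [].
by rewrite in_itv/= andbT => x0; rewrite derive1E; have [_ ->] := df x x0; exact: f'0.
Qed.

Lemma C1half_id : C1half (fun t : R => t) (fun=> 1).
Proof. by apply: C1half_entire => t; exact: is_derive_id. Qed.

(** Both f - L t and - f - L t are nonincreasing. *)
Lemma C1half_lipschitz f f' (L : R) : C1half f f' -> (forall t : R, 0 < t -> `|f' t| <= L) ->
  forall s t : R, 0 <= s -> 0 <= t -> `|f t - f s| <= L * `|t - s|.
Proof.
move=> fC f'L.
have key (s t : R) : 0 <= s -> s <= t -> `|f t - f s| <= L * (t - s).
  move=> s0 st.
  have lin (c : R) : C1half (fun t => c * t) (fun=> c).
    apply: C1half_eq (C1halfM (C1half_cst c) C1half_id) => // x _; by rewrite /= mul0r add0r mulr1.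
  have h1 := C1half_nincr (C1halfD fC (lin (- L))) _ s0 st.
  have h2 := C1half_nincr (C1halfD (C1halfN fC) (lin (- L))) _ s0 st.
  have {}h1 : f t + - L * t <= f s + - L * s.
    by apply: h1 => x x0; have := f'L x x0; rewrite ler_norml; lra.
  have {}h2 : - f t + - L * t <= - f s + - L * s.
    by apply: h2 => x x0; have := f'L x x0; rewrite ler_norml; lra.
  by rewrite ler_norml; apply/andP; split; lra.
move=> s t s0 t0; have [st|/ltW ts] := leP s t; first by rewrite (ger0_norm (_ : 0 <= t - s)) ?subr_ge0// key.
by rewrite distrC (distrC t) (ger0_norm (_ : 0 <= s - t)) ?subr_ge0// key.
Qed.

Lemma C1half_FTC f f' (t : R) : C1half f f' -> {within `[0, +oo[, continuous f'} -> 0 <= t ->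
  f t - f 0 = \int[(@lebesgue_measure R)]_(x in `[0, t]) f' x.
Proof.
move=> [cf df] cf'; rewrite le_eqVlt => /orP[/eqP <-|t0].
  by rewrite set_itv1 Rintegral_set1 subrr.
rewrite /Rintegral (continuous_FTC2 (F := f) t0) //.
- exact: continuous_subspaceW (@half_line_itv t) cf'.
- have := continuous_subspaceW (@half_line_itv t) cf; rewrite continuous_within_itvP// => -[_ c1 c2].
  by split => // x; rewrite in_itv/= => /andP[/df[]].
- move=> x; rewrite in_itv/= => /andP[x0 _]; rewrite derive1E; by have [_ ->] := df x x0.
Qed.
End HalfLine.

Section Modes.
Variables (R : realType) (s0 : R) (v0 : seqZ R) (m : nat) (w : R -> seqZ R).
Hypotheses (s0_gt0 : 0 < s0) (v0H : inH s0 v0) (wG : galerkin_solution m w v0).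

Let X := fine (Hnorm2 0 v0).

Lemma galerkin_Hsum0 t N : 0 <= t -> Hsum 0 (w t) N <= X.
Proof.
move=> t0; apply: le_trans (Hsum_mono 0 (w t) (leq_maxl N m)) _.
rewrite (galerkin_conserved v0H wG t0 (leq_maxr _ _)).
exact: Hsum_le_fine (inH_Hnorm2_0 s0_gt0 v0H).
Qed.

Lemma galerkin_mode_bound t k : 0 <= t -> k != 0 -> normc (toC (w t k)) <= Num.sqrt X.
Proof.
move=> t0 k0; rewrite -[leLHS]ger0_norm ?normc_ge0// -sqrtr_sqr ler_wsqrtr// normc_toC.
by apply: le_trans (cabs2_le_Hsum (w t) k0 (leqnn _)) (galerkin_Hsum0 _ t0).
Qed.

(** Young's inequality for the convolution and the H^0 bound. The result grows with k but is
    independent of [m], which is what equicontinuity of each mode requires. *)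
Lemma galerkin_rhs_bound t k : 0 <= t ->
  normc (toC (galerkin_rhs m (w t) k t)) <= (absz k)%:R / 2 * X.
Proof.
move=> t0; have X0 : 0 <= X by exact: le_trans (Hsum_ge0 0 (w t) 0) (galerkin_Hsum0 0 t0).
have [km|km] := boolP (k \in box m); last first.
  rewrite /galerkin_rhs -mem_box (negbTE km) (_ : toC _ = 0) ?normc0 ?mulr_ge0//.
rewrite toC_galerkin_rhs// normcM normcM normc_i mul1r normcM normc_int normcV.
rewrite (_ : normc 2 = 2); last exact: (normc_int _ 2).
rewrite ler_wpM2l//.
have := congr1 (@normc R) (nlin_rotated m w t k); rewrite normcM normc_cis mul1r => <-.
pose A a := normc (rotated w t a).
apply: (@le_trans _ _ (conv m A A k)).
  apply: le_trans (normc_sum _ _ _) _; apply: ler_sum => d _.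
  by apply: le_trans (normc_sum _ _ _) _; apply: ler_sum => e _; rewrite normcM.
apply: le_trans (conv_le _ _ _ _) _; rewrite -expr2 l2_sqr.
apply: le_trans (galerkin_Hsum0 m t0).
rewrite -[leLHS]mul1r mulr_sumr (sum_box_rotated m w (fun=> 1)).
by apply: ler_sum => j _; rewrite Hterm0E mul1r.
Qed.

Lemma galerkin_rhs_continuous k :
  {within `[0, +oo[, continuous (fun t => (galerkin_rhs m (w t) k t).1)} /\
  {within `[0, +oo[, continuous (fun t => (galerkin_rhs m (w t) k t).2)}.
Proof.
have [km|km] := boolP (k \in box m); last first.
  by rewrite /galerkin_rhs -mem_box (negbTE km); split=> x; exact: cvg_cst.
suff [f' [[h1 _] [h2 _]]] : exists f', cC1half (fun t => toC (galerkin_rhs m (w t) k t)) f'.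
  by split.
eexists; apply: (cC1half_eq (f := fun t => 'i * (k%:~R / 2) *
   \sum_(a <- box m | [&& a != 0, k - a != 0 & (absz (k - a)%R <= m)%N])
      (cis (3 * k%:~R * a%:~R * (k - a)%:~R * t) * (toC (w t a) * toC (w t (k - a)))))).
- by move=> t; rewrite toC_galerkin_rhs.
- by move=> t _; reflexivity.
- apply: cC1halfZ; apply: cC1half_sum => a am /and3P[a0 ka0 _].
  apply: cC1halfM; first exact: cC1half_cis.
  by apply: cC1halfM; apply: (galerkin_C1half wG).
Qed.

Lemma galerkin_lipschitz k s t : k != 0 -> 0 <= s -> 0 <= t ->
  `|(w t k).1 - (w s k).1| <= (absz k)%:R / 2 * X * `|t - s| /\
  `|(w t k).2 - (w s k).2| <= (absz k)%:R / 2 * X * `|t - s|.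
Proof.
move=> k0 s_ge0 t_ge0; have [h1 h2] := galerkin_C1half wG k0; split.
  apply: (C1half_lipschitz h1) => // x /ltW x0.
  by apply: le_trans (Re_le_normc _) (galerkin_rhs_bound k x0).
apply: (C1half_lipschitz h2) => // x /ltW x0.
by apply: le_trans (Im_le_normc _) (galerkin_rhs_bound k x0).
Qed.

Lemma galerkin_integral k t : k != 0 -> 0 <= t ->
  csub (w t k) (v0 k) =
   (\int[(@lebesgue_measure R)]_(x in `[0, t]) (galerkin_rhs m (w x) k x).1,
    \int[(@lebesgue_measure R)]_(x in `[0, t]) (galerkin_rhs m (w x) k x).2).
Proof.
move=> k0 t0; have [h1 h2] := galerkin_C1half wG k0; have [c1 c2] := galerkin_rhs_continuous k.
rewrite -(galerkin_init wG k0) /csub; congr (_, _).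
  exact: (C1half_FTC h1 c1 t0).
exact: (C1half_FTC h2 c2 t0).
Qed.

End Modes.

(** * Measurability and dominated convergence *)

Section MeasureTools.
Variable R : realType.

Lemma measurable_limn d (T : measurableType d) (D : set T) (h : nat -> T -> R) :
  measurable D -> (forall N, measurable_fun D (h N)) ->
  measurable_fun D (fun t => limn (fun N => h N t)).
Proof.
move=> mD mh.
pose f (N : nat) : T -> \bar R := EFin \o h N.
have mf N : measurable_fun D (f N : _ -> \bar R) by apply/measurable_EFinP.
have msup : measurable_fun D (fun t => limn_esup (f^~ t)) by exact: measurable_fun_limn_esup.
have minf : measurable_fun D (fun t => limn_einf (f^~ t)).
  rewrite (_ : (fun t => _) = fun t => (- limn_esup (fun N => - f N t))%E).
    by apply: measurableT_comp => //; apply: measurable_fun_limn_esup => N; exact: measurableT_comp.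
  by apply/funext => t; rewrite -[RHS]limn_einfN; congr limn_einf; apply/funext => N; rewrite /= opprK.
(* Where the real sequence diverges, [limn] is the default point [0]. *)
have -> : (fun t => limn (fun N => h N t))
   = fun t => if limn_einf (f^~ t) == limn_esup (f^~ t) then fine (limn_esup (f^~ t)) else 0.
  apply/funext => t; have [ch|dh] := pselect (cvgn (fun N => h N t)).
    have : f^~ t @ \oo --> (limn (fun N => h N t))%:E by apply/cvg_EFin => //; exact: nearW.
    by move=> /cvg_limn_einf_sup[-> ->]; rewrite eqxx.
  rewrite (dvgP dh); case: eqP => // e; case E : (limn_esup (f^~ t)) => [l| |] //.
  exfalso; apply: dh; apply/cvg_ex; exists l.
  suff /fine_cvgP[] : f^~ t @ \oo --> l%:E by [].
  apply: (@squeeze_cvge _ _ _ _ (einfs (f^~ t)) _ (esups (f^~ t))).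
  - apply: nearW => N; apply/andP; split.
      by apply: ereal_inf_lbound; exists N => /=.
    by apply: ereal_sup_ubound; exists N => /=.
  - by rewrite -E -e limn_einf_lim; exact: is_cvg_einfs.
  - by rewrite -E limn_esup_lim; exact: is_cvg_esups.
apply: measurable_fun_if => //; first exact: measurable_fun_eqe.
have mfine : measurable_fun D (fun t => fine (limn_esup (f^~ t))) by exact: measurableT_comp.
by apply: measurable_funS mD _ mfine; exact: subIsetl.
Qed.

Lemma cvge0_le (a : nat -> \bar R) : (forall n, (0 <= a n)%E) ->
  (forall e : R, 0 < e -> \forall n \near \oo, (a n <= e%:E)%E) -> a @ \oo --> 0%E.
Proof.
move=> a0 ae; apply/fine_cvgP; split.
  near=> n; rewrite ge0_fin_numE//; apply: le_lt_trans (ltry 1).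
  by near: n; exact: ae.
apply/cvgrPdist_le => e e0; near=> n; rewrite sub0r normrN /=.
have : (a n <= e%:E)%E by near: n; exact: ae.
rewrite ger0_norm ?fine_ge0//; case: (a n) (a0 n) => [x||] //=.
Unshelve. all: by end_near. Qed.

Lemma cvg_le_bound (u : nat -> R) (l B : R) : u @ \oo --> l -> (forall j, u j <= B) -> l <= B.
Proof.
move=> ul uB; rewrite -(cvg_lim (@Rhausdorff R) ul); apply: limr_le.
  by apply/cvg_ex; exists l.
exact: nearW.
Qed.

Lemma cvg_ge_bound (u : nat -> R) (l B : R) : u @ \oo --> l -> (forall j, B <= u j) -> B <= l.
Proof.
move=> ul uB; rewrite -(cvg_lim (@Rhausdorff R) ul); apply: limr_ge.
  by apply/cvg_ex; exists l.
exact: nearW.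
Qed.

Lemma cvg_norm_le (u : nat -> R) (l B : R) : u @ \oo --> l -> (forall j, `|u j| <= B) -> `|l| <= B.
Proof. by move=> ul uB; apply: (@cvg_le_bound (fun j => `|u j|)) => //; exact: cvg_norm. Qed.

Lemma bounded_Rintegral_cvg (t B : R) (f : nat -> R -> R) (g : R -> R) :
  (forall j, measurable_fun `[0, t] (f j)) ->
  (forall j x, `[0, t]%classic x -> `|f j x| <= B) ->
  (forall x, `[0, t]%classic x -> f ^~ x @ \oo --> g x) ->
  (@lebesgue_measure R).-integrable `[0, t] (EFin \o g) /\
  (fun j => \int[(@lebesgue_measure R)]_(x in `[0, t]) f j x) @ \oo -->
    \int[(@lebesgue_measure R)]_(x in `[0, t]) g x.
Proof.
move=> mf fB fg.
have mD : measurable (`[0, t] : set R) by exact: measurable_itv.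
have mg : measurable_fun `[0, t] g by exact: measurable_fun_cvg fg.
have fin : (@lebesgue_measure R `[0%R, t]%classic < +oo)%E.
  by rewrite lebesgue_measure_itv; case: ifP => // _; rewrite -EFinB ltry.
have iB : (@lebesgue_measure R).-integrable `[0, t] (EFin \o cst B).
  apply: measurable_bounded_integrable => //; exists `|B|; split => // M BM x _ /=.
  by apply: ltW; rewrite (le_lt_trans _ BM).
have ig : (@lebesgue_measure R).-integrable `[0, t] (EFin \o g).
  apply: le_integrable iB => //; first exact/measurable_EFinP.
  move=> x tx; rewrite /= lee_fin; apply: le_trans (ler_norm _).
  by apply: (cvg_norm_le (fg x tx)) => j; exact: fB.
split=> //.
have := @dominated_cvg _ _ _ (@lebesgue_measure R) _ mD (fun j => EFin \o f j) (EFin \o g) (EFin \o cst B).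
move=> h.
have lim : (fun j => \int[(@lebesgue_measure R)]_(x in `[0%R, t]) (f j x)%:E)%E @ \oo -->
    (\int[(@lebesgue_measure R)]_(x in `[0%R, t]) (g x)%:E)%E.
  apply: h iB _ => [j|x tx|//|j x tx]; first (apply/measurable_EFinP; exact: mf).
    by apply: cvg_EFin; [exact: nearW|exact: fg].
  by rewrite /= lee_fin fB.
have : (\int[(@lebesgue_measure R)]_(x in `[0%R, t]) (g x)%:E)%E
    = (\int[(@lebesgue_measure R)]_(x in `[0%R, t]) g x)%R%:E.
  by rewrite fineK//; exact: integrable_fin_num.
by move=> e; move: lim; rewrite e => /fine_cvgP[].
Qed.

End MeasureTools.

(** * Tails, conservation and uniform convergence in the limit *)

Section HsumMore.
Variable R : realType.
Implicit Types (v a b : seqZ R) (s sigma : R).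

Lemma cabs2_csub (z w : cplx R) : cabs2 (csub z w) <= 2 * (cabs2 z + cabs2 w).
Proof.
rewrite /cabs2 /=.
have := sqr_ge0 (z.1 + w.1); have := sqr_ge0 (z.2 + w.2); nra.
Qed.

Lemma Hsum_sub s a b N : Hsum s (seqZ_sub a b) N <= 2 * (Hsum s a N + Hsum s b N).
Proof.
rewrite -big_split mulr_sumr; apply: ler_sum => n _ /=; rewrite /Hterm -mulrDr mulrCA.
apply: ler_wpM2l; first exact: powR_ge0.
have := cabs2_csub (a n.+1%:Z) (b n.+1%:Z).
have := cabs2_csub (a (- n.+1%:Z)) (b (- n.+1%:Z)).
by rewrite /seqZ_sub; lra.
Qed.

(** Beyond frequency N the weight of order [sigma] is at most (N + 1) ^ (- 2 (s - sigma)) times the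
    weight of order [s]. *)
Lemma Hsum_tail sigma s v N N' : sigma <= s ->
  Hsum sigma v N' <= Hsum sigma v N + (N.+1%:R `^ (2 * (s - sigma)))^-1 * Hsum s v N'.
Proof.
move=> ss; have N0 : 0 < N.+1%:R `^ (2 * (s - sigma)) by rewrite powR_gt0.
apply: le_trans (lerD (Hsum_trunc_le sigma v N N') (lexx _)).
rewrite mulr_sumr -big_split; apply: ler_sum => n _ /=.
have t0 := Hterm_ge0 s v n.
case: ltnP => nN; first by rewrite lerDl mulr_ge0// invr_ge0 ltW.
rewrite add0r mulrC ler_pdivlMr// /Hterm mulrAC.
apply: ler_wpM2r; first by rewrite addr_ge0 ?cabs2_ge0.
have -> : 2 * s = 2 * sigma + 2 * (s - sigma) by ring.
rewrite powRD; last by rewrite pnatr_eq0 implybT.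
rewrite ler_wpM2l ?powR_ge0// ge0_ler_powR ?nnegrE ?mulr_ge0 ?subr_ge0// ler_nat ltnS//.
Qed.
End HsumMore.

Section Limit.
Variables (R : realType) (s0 T X Y : R) (v : nat -> R -> seqZ R) (vinf : R -> seqZ R).
Hypothesis s0_gt0 : 0 < s0.
Hypothesis vX : forall j t N, 0 <= t <= T -> Hsum 0 (v j t) N <= X.
Hypothesis vY : forall j t N, 0 <= t <= T -> Hsum s0 (v j t) N <= Y.
Hypothesis v_cvg : forall k, k != 0 -> forall e : R, 0 < e -> exists J, forall j, (J <= j)%N ->
  forall t, 0 <= t <= T -> cabs2 (csub (v j t k) (vinf t k)) <= e.

Lemma mode_ccvg t k : 0 <= t <= T -> k != 0 -> ccvg (fun j => toC (v j t k)) (toC (vinf t k)).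
Proof.
move=> tT k0; apply: ccvgP => e e0.
have [J JP] := v_cvg k0 (exprn_gt0 2 e0); exists J => // j /= Jj.
have nn : normc (toC (vinf t k) - toC (v j t k)) \is Num.nneg by rewrite nnegrE normc_ge0.
have en : e \is Num.nneg by rewrite nnegrE ltW.
rewrite -(@ler_pXn2r _ 2 _ _ _ nn en)//. rewrite -normcN opprB.
by have := JP j Jj t tT; rewrite -normc_toC.
Qed.

Lemma cvg_sum_nat (u : nat -> nat -> R) (l : nat -> R) N : (forall n, (fun j => u j n) @ \oo --> l n) ->
  (fun j => \sum_(0 <= n < N) u j n) @ \oo --> \sum_(0 <= n < N) l n.
Proof.
move=> ul; elim: N => [|N IH].
  rewrite big_geq// (_ : (fun j => _) = fun=> 0); first exact: cvg_cst.
  by apply/funext => j; rewrite big_geq.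
rewrite big_nat_recr//= (_ : (fun j => _) = fun j => \sum_(0 <= n < N) u j n + u j N).
  by apply: cvgD.
by apply/funext => j; rewrite big_nat_recr.
Qed.

Lemma cabs2_cvg t k : 0 <= t <= T -> k != 0 ->
  (fun j => cabs2 (v j t k)) @ \oo --> cabs2 (vinf t k).
Proof.
move=> tT k0; have [h1 h2] := mode_ccvg tT k0.
rewrite /cabs2 !expr2 (_ : (fun j => _) = fun j =>
   (v j t k).1 * (v j t k).1 + (v j t k).2 * (v j t k).2).
  by apply: cvgD; apply: cvgM.
by apply/funext => j; rewrite !expr2.
Qed.

Lemma Hsum_cvg s t N : 0 <= t <= T -> (fun j => Hsum s (v j t) N) @ \oo --> Hsum s (vinf t) N.
Proof.
move=> tT; apply: cvg_sum_nat => n; apply: cvgMl_tmp.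
by apply: cvgD; exact: cabs2_cvg.
Qed.

Lemma limit_Hsum0 t N : 0 <= t <= T -> Hsum 0 (vinf t) N <= X.
Proof. by move=> tT; apply: (cvg_le_bound (@Hsum_cvg 0 t N tT)) => j; exact: vX. Qed.

Lemma limit_Hsum t N : 0 <= t <= T -> Hsum s0 (vinf t) N <= Y.
Proof. by move=> tT; apply: (cvg_le_bound (@Hsum_cvg s0 t N tT)) => j; exact: vY. Qed.

Lemma limit_real : (forall j t, 0 <= t <= T -> real_seq (v j t)) ->
  forall t, 0 <= t <= T -> real_seq (vinf t).
Proof.
move=> vr t tT k k0; have kN0 : - k != 0 by rewrite oppr_eq0.
have [h1 h2] := mode_ccvg tT k0; have [g1 g2] := mode_ccvg tT kN0.
apply: toC_inj; apply: complex_ext.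
  rewrite -(cvg_lim (@Rhausdorff R) g1) -(cvg_lim (@Rhausdorff R) h1).
  by congr (limn _); apply/funext => j; rewrite vr.
rewrite -(cvg_lim (@Rhausdorff R) g2).
have -> : (fun j => complex.Im (toC (v j t (- k)))) = fun j => - complex.Im (toC (v j t k)).
  by apply/funext => j; rewrite vr.
by rewrite (cvg_lim (@Rhausdorff R) (cvgN h2)).
Qed.

(** The inequality <= is lower semicontinuity. For the converse, no mass may escape to high
    frequencies: the conserving windows grow with [j], so the tail beyond a fixed N is first removed
    by the H^s0 bound, then j and finally N tend to infinity. *)
Lemma limit_conserved (v0 : seqZ R) : Hnorm2 0 v0 = X%:E ->
  (forall j t, 0 <= t <= T -> exists m, forall N, (m <= N)%N -> Hsum 0 (v j t) N = Hsum 0 v0 N) ->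
  forall t, 0 <= t <= T -> Hnorm2 0 (vinf t) = Hnorm2 0 v0.
Proof.
move=> v0X cons t tT; rewrite v0X; apply/eqP; rewrite eq_le; apply/andP; split.
  by apply: Hnorm2_le => N; exact: limit_Hsum0.
have lower N : X <= Hsum 0 (vinf t) N + (N.+1%:R `^ (2 * (s0 - 0)))^-1 * Y.
  have step j : X <= Hsum 0 (v j t) N + (N.+1%:R `^ (2 * (s0 - 0)))^-1 * Y.
    rewrite -lee_fin -v0X; apply: Hnorm2_le => N'; have [m mP] := cons j t tT.
    apply: le_trans (Hsum_mono 0 v0 (leq_maxl N' m)) _.
    rewrite -(mP _ (leq_maxr _ _)); apply: le_trans (Hsum_tail _ N _ (ltW s0_gt0)) _.
    by rewrite lerD2l ler_wpM2l ?invr_ge0 ?powR_ge0// vY.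
  apply: (@cvg_ge_bound _ (fun j => Hsum 0 (v j t) N + (N.+1%:R `^ (2 * (s0 - 0)))^-1 * Y)) => //.
  by apply: cvgD; [exact: Hsum_cvg|exact: cvg_cst].
have fin : (Hnorm2 0 (vinf t) < +oo)%E.
  by apply: le_lt_trans (ltry X); apply: Hnorm2_le => N; exact: limit_Hsum0.
rewrite (Hnorm2_fine fin) lee_fin.
have p0 : 0 < 2 * (s0 - 0) by rewrite subr0 mulr_gt0.
rewrite -[X in _ <= X]addr0 -[X in _ <= _ + X](mul0r Y).
apply: (@cvg_ge_bound _ (fun N : nat => fine (Hnorm2 0 (vinf t)) + (N.+1%:R `^ (2 * (s0 - 0)))^-1 * Y)).
  by apply: cvgD; [exact: cvg_cst|apply: cvgMr_tmp; exact: inv_powR_cvg0].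
by move=> N; apply: le_trans (lower N) _; rewrite lerD2r Hsum_le_fine.
Qed.

Section Strong.
Variable sigma : R.
Hypothesis sigma_lt : sigma < s0.

Let d j t := seqZ_sub (v j t) (vinf t).

Lemma finite_Hsum_small K (e : R) : 0 < e -> exists J, forall j, (J <= j)%N ->
  forall t, 0 <= t <= T -> Hsum sigma (d j t) K <= e.
Proof.
elim: K e => [|K IH] e e0.
  by exists 0%N => j _ t _; rewrite /Hsum big_geq// ltW.
have [J1 h1] := IH (e / 2) (divr_gt0 e0 (ltr0n _ 2)).
pose c : R := K.+1%:R `^ (2 * sigma).
have c0 : 0 < c by rewrite powR_gt0.
(* The modes K + 1 and - (K + 1), both with weight [c], together contribute e / 2. *)
have e4 : 0 < e / (4 * c) by rewrite divr_gt0// mulr_gt0.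
have [J2 h2] := v_cvg (isT : K.+1%:Z != 0) e4.
have [J3 h3] := v_cvg (isT : - K.+1%:Z != 0) e4.
exists (maxn J1 (maxn J2 J3)) => j; rewrite !geq_max => /and3P[l1 l2 l3] t tT.
rewrite /Hsum big_nat_recr//= (splitr e); apply: lerD; first exact: h1.
apply: le_trans (ler_wpM2l (ltW c0) (lerD (h2 j l2 t tT) (h3 j l3 t tT))) _.
by apply: eq_ler; field; rewrite gt_eqF.
Qed.

(** The cutoff [K] is chosen first, from the H^s0 bound 2 (Y + Y) = 4 Y of the difference; the
    finitely many modes below it then converge uniformly in time. *)
Lemma uniform_Hsum_small (e : R) : 0 < e -> exists J, forall j, (J <= j)%N ->
  forall t, 0 <= t <= T -> forall N, Hsum sigma (d j t) N <= e.
Proof.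
move=> e0; have e2 : 0 < e / 2 by rewrite divr_gt0.
have p0 : 0 < 2 * (s0 - sigma) by rewrite mulr_gt0// subr_gt0.
have h : (fun N : nat => (N.+1%:R `^ (2 * (s0 - sigma)))^-1 * (4 * Y)) @ \oo --> (0 : R).
  by rewrite -(mul0r (4 * Y)); apply: cvgMr_tmp; exact: inv_powR_cvg0.
move/cvgrPdist_le : h => /(_ _ e2) [K _ /(_ K (leqnn _))].
rewrite sub0r normrN => hK.
have [J JP] := finite_Hsum_small K e2; exists J => j Jj t tT N.
apply: le_trans (Hsum_tail _ K _ (ltW sigma_lt)) _.
rewrite (splitr e); apply: lerD; first exact: JP.
apply: le_trans (le_trans (ler_norm _) hK); rewrite ler_wpM2l ?invr_ge0 ?powR_ge0//.
apply: le_trans (Hsum_sub _ _ _ _) _.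
have := vY j N tT; have := limit_Hsum N tT; lra.
Qed.

End Strong.
End Limit.

Section Approx.
Variable R : realType.

(** An exchange of limits: the approximation by [b N] may begin later as N grows, but its error
    depends on N only. *)
Lemma cvg_approx (a : nat -> R) (b : nat -> nat -> R) (c d : nat -> R) (l : R) :
  (forall N, \forall j \near \oo, `|a j - b N j| <= d N) ->
  (forall N, b N @ \oo --> c N) -> (forall N, `|l - c N| <= d N) -> d @ \oo --> 0 ->
  a @ \oo --> l.
Proof.
move=> ab bc lc d0; apply/cvgrPdist_le => e e0; have e3 : 0 < e / 3 by rewrite divr_gt0.
move/cvgrPdist_le : d0 => /(_ _ e3) [N _ /(_ N (leqnn _))]; rewrite sub0r normrN => dN.
have {}dN := le_trans (ler_norm _) dN.
move/cvgrPdist_le : (bc N) => /(_ _ e3) bcN; near=> j.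
have h1 : `|a j - b N j| <= d N by near: j; exact: ab.
have h2 : `|c N - b N j| <= e / 3 by near: j.
have h3 := lc N.
rewrite (_ : l - a j = (l - c N) + (c N - b N j) - (a j - b N j)); last by ring.
apply: le_trans (ler_normB _ _) _; have := ler_normD (l - c N) (c N - b N j); lra.
Unshelve. all: by end_near. Qed.

End Approx.

(** * The duality pairing of H^s and H^(-s) *)

Section Pairing.
Variable R : realType.
Implicit Types (v g : seqZ R) (s Y : R).

Definition pair_term v g (n : nat) : R :=
  (cmul (v (n.+1)%:Z) (cconj (g (n.+1)%:Z))).1 + (cmul (v (- (n.+1)%:Z)) (cconj (g (- (n.+1)%:Z)))).1.

Definition pair_sum v g (N : nat) : R := \sum_(0 <= n < N) pair_term v g n.

Lemma pair_term_le s v g n : `|pair_term v g n| <= Num.sqrt (Hterm s v n) * Num.sqrt (Hterm (- s) g n).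
Proof.
rewrite -sqrtrM ?Hterm_ge0// -sqrtr_sqr ler_wsqrtr//.
have w1 : n.+1%:R `^ (2 * s) * n.+1%:R `^ (2 * - s) = 1 :> R.
  rewrite -powRD; last by rewrite pnatr_eq0 implybT.
  by rewrite mulrN subrr powRr0.
rewrite /Hterm mulrACA w1 mul1r /pair_term /cmul /cconj /cabs2 /=.
move: (v n.+1%:Z) (v (- n.+1%:Z)) (g n.+1%:Z) (g (- n.+1%:Z)) => [a b] [c d] [e f] [p q] /=.
(* The opposite weights have cancelled; what remains is Cauchy-Schwarz in dimension four, by
   Lagrange's identity with its six minors. *)
have := sqr_ge0 (a * f - b * e); have := sqr_ge0 (a * p - c * e); have := sqr_ge0 (a * q - d * e).
have := sqr_ge0 (b * p - c * f); have := sqr_ge0 (b * q - d * f); have := sqr_ge0 (c * q - d * p).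
lra.
Qed.

(** Only a bound on [v] in H^s is available, so the decay comes from the tail of [g]; the rate is
    thus the same for all terms of the sequence. *)
Definition pair_rate s Y g (N : nat) : R :=
  Num.sqrt Y * Num.sqrt (fine (Hnorm2 (- s) g) - Hsum (- s) g N).

Lemma pair_sum_rate s Y v g N N' : (forall n, Hsum s v n <= Y) -> (Hnorm2 (- s) g < +oo)%E ->
  (N <= N')%N -> `|pair_sum v g N' - pair_sum v g N| <= pair_rate s Y g N.
Proof.
move=> vY gfin NN; rewrite /pair_sum (@big_cat_nat _ _ _ N 0 N')//= addrAC subrr add0r.
apply: le_trans (ler_norm_sum _ _ _) _.
apply: le_trans (ler_sum _ (fun n _ => pair_term_le s v g n)) _.
apply: le_trans (cauchy_schwarz_sum _ _ _) _.
apply: ler_pM; rewrite ?sqrtr_ge0// ler_wsqrtr//.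
  apply: le_trans (vY N'); rewrite /Hsum (@big_cat_nat _ _ _ N 0 N')//=.
  rewrite -[leLHS]add0r lerD ?Hsum_ge0//; apply: ler_sum => n _.
  by rewrite sqr_sqrtr// Hterm_ge0.
rewrite lerBrDl; apply: le_trans (Hsum_le_fine N' gfin).
rewrite /Hsum (@big_cat_nat _ _ _ N 0 N')//= lerD2l; apply: ler_sum => n _.
by rewrite sqr_sqrtr// Hterm_ge0.
Qed.

Lemma pair_rate_cvg0 s Y g : (Hnorm2 (- s) g < +oo)%E -> pair_rate s Y g @ \oo --> 0.
Proof.
move=> gfin; rewrite -(mulr0 (Num.sqrt Y)); apply: cvgMl_tmp; apply/cvgrPdist_le => e e0.
have [N hN] : exists N, fine (Hnorm2 (- s) g) - e ^+ 2 < Hsum (- s) g N.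
  apply: contrapT => /forallNP h.
  have : (Hnorm2 (- s) g <= (fine (Hnorm2 (- s) g) - e ^+ 2)%:E)%E.
    by apply: Hnorm2_le => N; rewrite leNgt; exact/negP.
  have hf := Hnorm2_fine gfin; set G := fine _ in hf *.
  by rewrite hf lee_fin; have := exprn_gt0 2 e0; lra.
exists N => // n /= Nn; rewrite sub0r normrN ger0_norm ?sqrtr_ge0//.
rewrite -[e]gtr0_norm// -sqrtr_sqr ler_wsqrtr//.
by have := Hsum_mono (- s) g Nn; lra.
Qed.

Lemma Hpair_rate s Y v g N : (forall n, Hsum s v n <= Y) -> (Hnorm2 (- s) g < +oo)%E ->
  `|Hpair v g - pair_sum v g N| <= pair_rate s Y g N.
Proof.
move=> vY gfin.
by have [_] := cvg_of_rate (fun i j => pair_sum_rate vY gfin) (pair_rate_cvg0 Y gfin); apply.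
Qed.

(** The domination must also hold when [g] has infinite norm. Adding 1 keeps the constant positive,
    so that its product with +oo is +oo. *)
Lemma Hpair_le s Y v g : (forall n, Hsum s v n <= Y) ->
  (`|(Hpair v g)%:E| <= (Num.sqrt Y + 1)%:E * Hnorm (- s) g)%E.
Proof.
move=> vY; have c0 : 0 < Num.sqrt Y + 1 by rewrite ltr_wpDl ?sqrtr_ge0.
have [gfin|] := ltP (Hnorm2 (- s) g) +oo%E.
  rewrite (Hnorm_fin (Hnorm2_fine gfin)) /= -EFinM lee_fin.
  have := Hpair_rate 0 vY gfin; rewrite /pair_sum /pair_rate /Hsum !big_geq// !subr0.
  by move=> /le_trans; apply; rewrite ler_wpM2r ?sqrtr_ge0// lerDl.
rewrite leye_eq => /eqP ginf; rewrite /Hnorm ginf poweRyr ?invr_eq0 ?pnatr_eq0//.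
by rewrite gt0_muley ?lte_fin ?leey.
Qed.
End Pairing.

Section Measurability.
Variables (R : realType) (D : set R).
Hypothesis mD : measurable D.
Implicit Types (w g : R -> seqZ R).

(** The mode 0 is excluded because a Galerkin solution says nothing about it. *)
Definition mode_meas w := forall k, k != 0 ->
  measurable_fun D (fun t => (w t k).1) /\ measurable_fun D (fun t => (w t k).2).

Lemma measurable_cabs2 w k : mode_meas w -> k != 0 -> measurable_fun D (fun t => cabs2 (w t k)).
Proof.
move=> mw k0; have [m1 m2] := mw k k0.
by apply: measurable_funD; apply: measurable_funX.
Qed.

Lemma measurable_Hnorm s w : mode_meas w -> measurable_fun D (fun t => Hnorm s (w t)).
Proof.
move=> mw; rewrite /Hnorm.
apply: (measurableT_comp (measurable_poweR 2^-1)).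
apply: ge0_emeasurable_sum => [n t _ _|n _].
  by rewrite lee_fin; exact: (Hterm_ge0 s (w t) n).
apply/measurable_EFinP; apply: measurable_funM; first exact: measurable_cst.
by apply: measurable_funD; apply: measurable_cabs2.
Qed.

Lemma mode_meas_sub w g : mode_meas w -> mode_meas g -> mode_meas (fun t => seqZ_sub (w t) (g t)).
Proof.
move=> mw mg k k0; have [m1 m2] := mw k k0; have [n1 n2] := mg k k0.
by split; apply: measurable_funB.
Qed.

Lemma measurable_Hpair w g : mode_meas w -> mode_meas g -> measurable_fun D (fun t => Hpair (w t) (g t)).
Proof.
move=> mw mg; apply: measurable_limn => // N; apply: measurable_sum => n.
have [m1 m2] := mw n.+1%:Z isT; have [m3 m4] := mw (- n.+1%:Z) isT.
have [n1 n2] := mg n.+1%:Z isT; have [n3 n4] := mg (- n.+1%:Z) isT.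
have c2 : measurable_fun D (fun t => - (g t n.+1%:Z).2) by exact: measurableT_comp.
have c4 : measurable_fun D (fun t => - (g t (- n.+1%:Z)).2) by exact: measurableT_comp.
apply: measurable_funD; apply: measurable_funB; apply: measurable_funM;
  first [exact: m1|exact: m2|exact: m3|exact: m4|exact: n1|exact: n3|exact: c2|exact: c4].
Qed.
End Measurability.

Section LimitPassage.
Variables (R : realType) (s0 T X Y : R) (v : nat -> R -> seqZ R) (vinf : R -> seqZ R).
Hypotheses (s0_gt0 : 0 < s0) (T_gt0 : 0 < T).
Hypothesis vX : forall j t N, 0 <= t <= T -> Hsum 0 (v j t) N <= X.
Hypothesis vY : forall j t N, 0 <= t <= T -> Hsum s0 (v j t) N <= Y.
Hypothesis v_cvg : forall k, k != 0 -> forall e : R, 0 < e -> exists J, forall j, (J <= j)%N ->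
  forall t, 0 <= t <= T -> cabs2 (csub (v j t k) (vinf t k)) <= e.
Hypothesis v_meas : forall j, mode_meas `[0, T] (v j).

Local Notation mu := (@lebesgue_measure R).

Let itvT t : `[0, T]%classic t -> 0 <= t <= T.
Proof. by rewrite /= in_itv. Qed.

Let mD (t : R) : measurable (`[0, t] : set R).
Proof. exact: measurable_itv. Qed.

Lemma limit_meas : mode_meas `[0, T] vinf.
Proof.
move=> k k0; split.
  apply: (measurable_fun_cvg (h := fun j t => (v j t k).1)) => [j|t /itvT tT].
    by have [] := v_meas j k0.
  by have [] := mode_ccvg v_cvg tT k0.
apply: (measurable_fun_cvg (h := fun j t => (v j t k).2)) => [j|t /itvT tT].
  by have [] := v_meas j k0.
by have [] := mode_ccvg v_cvg tT k0.
Qed.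

Lemma strong_convergence sigma p : sigma < s0 -> 1 < p ->
  (fun j => (\int[mu]_(t in `[0%R, T]%classic) (Hnorm sigma (seqZ_sub (v j t) (vinf t)) `^ p))%E)
    @ \oo --> 0%E.
Proof.
move=> ss p1; have p0 : 0 < p by exact: lt_trans p1.
apply: cvge0_le => [j|e e0]; first by apply: integral_ge0 => t _; exact: poweR_ge0.
(* Chosen so that q ^ p T = e: a bound by [q] at every time gives a bound by [e] for the
   integral. *)
pose q := (e / T) `^ p^-1.
have q0 : 0 < q by rewrite powR_gt0// divr_gt0.
have [J JP] := uniform_Hsum_small vY v_cvg ss (exprn_gt0 2 q0).
exists J => // j /= Jj.
have mH : measurable_fun `[0, T] (fun t => (Hnorm sigma (seqZ_sub (v j t) (vinf t)) `^ p)%E).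
  apply: (measurableT_comp (measurable_poweR p)); apply: measurable_Hnorm.
  by apply: mode_meas_sub => //; exact: limit_meas.
apply: (@le_trans _ _ (\int[mu]_(t in `[0%R, T]%classic) (cst (e / T)%:E t))%E).
  apply: ge0_le_integral => //.
  - by move=> t _; exact: poweR_ge0.
  - move=> t /itvT tT /=.
    have -> : (e / T)%:E = (q%:E `^ p)%E.
      by rewrite poweR_EFin -powRrM mulVf ?gt_eqF// powRr1// divr_ge0 ?ltW.
    apply: gt0_ler_poweR; rewrite ?(ltW p0)// ?in_itv/= ?leey ?andbT ?poweR_ge0 ?lee_fin ?(ltW q0)//.
    by have := Hnorm_le (JP j Jj t tT); rewrite sqrtr_sqr gtr0_norm.
have muT : mu `[0%R, T]%classic = T%:E by rewrite lebesgue_measure_itv /= lte_fin T_gt0 sube0.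
by rewrite integral_cst// [X in (_ * X)%E]muT -EFinM lee_fin divfK// gt_eqF.
Qed.

(** Dominated convergence in time. For almost every t the norm of [g t] is finite, and the pairing
    is then approximated by finite sums uniformly in [j], each of which converges mode by mode. *)
Lemma weak_star_convergence g : inL1H (- s0) T g ->
  (fun j => \int[mu]_(t in `[0%R, T]%classic) Hpair (v j t) (g t)) @ \oo -->
    \int[mu]_(t in `[0%R, T]%classic) Hpair (vinf t) (g t).
Proof.
move=> [mg _ gfin].
have {}mg : mode_meas `[0, T] g by move=> k _; exact: mg.
have mpair w : mode_meas `[0, T] w -> measurable_fun `[0, T] (fun t => (Hpair (w t) (g t))%:E).
  by move=> mw; apply/measurable_EFinP; apply: measurable_Hpair.
have mH : measurable_fun `[0, T] (fun t => Hnorm (- s0) (g t)) by exact: measurable_Hnorm.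
have iH : mu.-integrable `[0, T] (fun t => Hnorm (- s0) (g t)).
  apply/integrableP; split => //; under eq_integral do rewrite gee0_abs ?poweR_ge0//.
  exact: gfin.
have := @dominated_convergence _ _ _ mu _ (mD T) (fun j t => (Hpair (v j t) (g t))%:E)
  (fun t => (Hpair (vinf t) (g t))%:E) (fun t => ((Num.sqrt Y + 1)%:E * Hnorm (- s0) (g t))%E).
case.
- by move=> j; apply: mpair; exact: v_meas.
- by apply: mpair; exact: limit_meas.
- have := integrable_ae (mD T : measurable (`[0, T] : set (measurableTypeR R))) iH; apply: filterS => t h tD.
  have tT := itvT tD.
  have gt : (Hnorm2 (- s0) (g t) < +oo)%E.
    have := h tD; rewrite fin_numElt => /andP[_]; apply: lty_poweRy.
    by rewrite invr_eq0 pnatr_eq0.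
  apply: cvg_EFin; first exact: nearW.
  apply: (cvg_approx (b := fun N j => pair_sum (v j t) (g t) N)
    (c := pair_sum (vinf t) (g t)) (d := pair_rate s0 Y (g t))).
  + by move=> N; apply: nearW => j; apply: Hpair_rate => // n; exact: vY.
  + move=> N; apply: cvg_sum_nat => n.
    have [a1 a2] := mode_ccvg v_cvg tT (isT : n.+1%:Z != 0).
    have [b1 b2] := mode_ccvg v_cvg tT (isT : - n.+1%:Z != 0).
    by apply: cvgD; apply: cvgB; apply: cvgMr_tmp.
  + by move=> N; apply: Hpair_rate => // n; exact: limit_Hsum vY v_cvg _ _ tT.
  + exact: pair_rate_cvg0.
- exact: integrableZl.
- by apply: aeW => t j tD; apply: Hpair_le => n; apply: vY; exact: itvT.
move=> ii _ lim.
have e : (\int[mu]_(t in `[0%R, T]%classic) (Hpair (vinf t) (g t))%:E)%E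
   = (\int[mu]_(t in `[0%R, T]%classic) Hpair (vinf t) (g t))%R%:E.
  by rewrite fineK//; exact: integrable_fin_num.
by move: lim; rewrite e => /fine_cvgP[].
Qed.

End LimitPassage.

(** * The limit solves the full system *)

Section Solution.
Variables (R : realType) (s0 T : R) (v0 : seqZ R) (vm : nat -> R -> seqZ R) (phi : nat -> nat).
Variables (vinf : R -> seqZ R) (Y : R).
Hypotheses (s0_gt0 : 0 < s0) (v0H : inH s0 v0).
Hypothesis vmG : forall m, galerkin_solution m (vm m) v0.
Hypothesis phi_ge : forall j, (j <= phi j)%N.

Let v j := vm (phi j).
Let X := fine (Hnorm2 0 v0).

Hypothesis vY : forall j t N, 0 <= t <= T -> Hsum s0 (v j t) N <= Y.
Hypothesis v_cvg : forall k, k != 0 -> forall e : R, 0 < e -> exists J, forall j, (J <= j)%N ->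
  forall t, 0 <= t <= T -> cabs2 (csub (v j t k) (vinf t k)) <= e.

Local Notation mu := (@lebesgue_measure R).

Let vX j t N : 0 <= t <= T -> Hsum 0 (v j t) N <= X.
Proof. by move=> /andP[t0 _]; exact: (galerkin_Hsum0 s0_gt0 v0H (vmG (phi j))). Qed.

Definition galerkin_sum m (w : seqZ R) k t : R[i] :=
  \sum_(a <- box m | [&& a != 0, k - a != 0 & (absz (k - a)%R <= m)%N]) toC (Nterm w k t a).

(** The condition N + |k| <= phi j ensures |k - a| <= phi j whenever |a| <= N: the truncation then
    removes none of the terms of the partial sum, and the difference is a tail. *)
Lemma galerkin_sum_rate j k t N : 0 <= t <= T -> (N + absz k <= phi j)%N ->
  normc (galerkin_sum (phi j) (v j t) k t - conv_sum (v j t) k t N) <= tail_rate s0 X Y N.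
Proof.
move=> tT Nj; have Nj' : (N <= phi j)%N by exact: leq_trans (leq_addr _ _) Nj.
rewrite /galerkin_sum /conv_sum (sum_box_restrict _ _ Nj').
rewrite (bigID (fun a => (absz a <= N)%N))/=.
rewrite (eq_bigl (fun a => (a != 0) && (k - a != 0) && (absz a <= N)%N)); last first.
  move=> a; case: (leqP (absz a) N) => aN; rewrite ?andbF// !andbT.
  by case: (a != 0) => //=; case: (k - a != 0) => //=; lia.
rewrite addrAC subrr add0r; apply: conv_tail => // [n|n|a].
- exact: vX.
- exact: vY.
- by rewrite -ltnNge => /andP[/and3P[-> -> _] ->].
Qed.

Lemma Nterm_ccvg k t a : 0 <= t <= T -> (a != 0) && (k - a != 0) ->
  ccvg (fun j => toC (Nterm (v j t) k t a)) (toC (Nterm (vinf t) k t a)).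
Proof.
move=> tT /andP[a0 ka0].
have h := ccvgM (ccvg_cst (cis (3 * k%:~R * a%:~R * (k - a)%:~R * t)))
  (ccvgM (mode_ccvg v_cvg tT a0) (mode_ccvg v_cvg tT ka0)).
by [].
Qed.

Lemma galerkin_sum_cvg k t : 0 <= t <= T ->
  ccvg (fun j => galerkin_sum (phi j) (v j t) k t) (conv_lim (vinf t) k t).
Proof.
move=> tT.
have near_rate N : \forall j \near \oo,
    normc (galerkin_sum (phi j) (v j t) k t - conv_sum (v j t) k t N) <= tail_rate s0 X Y N.
  exists (N + absz k)%N => // j /= Nj; apply: galerkin_sum_rate => //.
  exact: leq_trans (phi_ge j).
have cs N : ccvg (fun j => conv_sum (v j t) k t N) (conv_sum (vinf t) k t N).
  by apply: ccvg_sum => a; exact: Nterm_ccvg.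
have lim_rate N : normc (conv_lim (vinf t) k t - conv_sum (vinf t) k t N) <= 2 * tail_rate s0 X Y N.
  apply: conv_lim_rate => // n; first exact: limit_Hsum0 vX v_cvg _ _ tT.
  exact: limit_Hsum vY v_cvg _ _ tT.
have rate0 N : 0 <= tail_rate s0 X Y N.
  by rewrite !mulr_ge0 ?sqrtr_ge0// invr_ge0 powR_ge0.
have d0 : (fun N => 2 * tail_rate s0 X Y N) @ \oo --> 0.
  by rewrite -(mulr0 2); apply: cvgMl_tmp; exact: tail_rate_cvg0.
split.
  apply: (cvg_approx (b := fun N j => complex.Re (conv_sum (v j t) k t N))
    (c := fun N => complex.Re (conv_sum (vinf t) k t N)) _ _ _ d0).
  - move=> N; apply: filterS (near_rate N) => j h; rewrite -Re_sub.
    by apply: le_trans (Re_le_normc _) _; apply: le_trans h _; have := rate0 N; lra.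
  - by move=> N; have [] := cs N.
  - by move=> N; rewrite -Re_sub; apply: le_trans (Re_le_normc _) (lim_rate N).
apply: (cvg_approx (b := fun N j => complex.Im (conv_sum (v j t) k t N))
    (c := fun N => complex.Im (conv_sum (vinf t) k t N)) _ _ _ d0).
- move=> N; apply: filterS (near_rate N) => j h; rewrite -Im_sub.
  by apply: le_trans (Im_le_normc _) _; apply: le_trans h _; have := rate0 N; lra.
- by move=> N; have [] := cs N.
- by move=> N; rewrite -Im_sub; apply: le_trans (Im_le_normc _) (lim_rate N).
Qed.

Lemma galerkin_rhs_cvg k t : 0 <= t <= T ->
  ccvg (fun j => toC (galerkin_rhs (phi j) (v j t) k t)) ('i * (k%:~R / 2)%:C * conv_lim (vinf t) k t).
Proof.
move=> tT; have [h1 h2] := ccvgM (ccvg_cst ('i * (k%:~R / 2)%:C)) (galerkin_sum_cvg k tT).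
have e : \forall j \near \oo, 'i * (k%:~R / 2)%:C * galerkin_sum (phi j) (v j t) k t
   = toC (galerkin_rhs (phi j) (v j t) k t).
  exists (absz k) => // j /= kj; rewrite toC_galerkin_rhs ?mem_box; last exact: leq_trans (phi_ge j).
  by rewrite [(k%:~R / 2)%:C]rmorphM fmorphV rmorph_int rmorph_nat.
split.
  by apply: cvg_trans h1; apply: near_eq_cvg; apply: filterS e => j <-.
by apply: cvg_trans h2; apply: near_eq_cvg; apply: filterS e => j <-.
Qed.

(** Dominated convergence yields integrability of the product only; dividing by c != 0 gives that of
    [f]. *)
Lemma Rintegral_scale (D : set (measurableTypeR R)) (f : measurableTypeR R -> R) (c : R) : measurable D -> c != 0 ->
  mu.-integrable D (EFin \o (fun x => c * f x)) ->
  \int[mu]_(x in D) (c * f x) = c * \int[mu]_(x in D) f x.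
Proof.
move=> mD c0 icf; apply: RintegralZl => //.
have := integrableZl mD c^-1 icf; apply: eq_integrable => // x _ /=.
by rewrite -EFinM mulKf.
Qed.

(** The Galerkin equation is used in integrated form: its integrands converge pointwise and are
    bounded by |k| / 2 X, uniformly in [j] and in time. *)
Lemma limit_integral_eq k t : k != 0 -> 0 <= t <= T ->
  csub (vinf t k) (v0 k) = cmul (0, k%:~R / 2)
     (\int[mu]_(tau in `[0, t]) NRe (vinf tau) k tau, \int[mu]_(tau in `[0, t]) NIm (vinf tau) k tau).
Proof.
move=> k0 tT; have /andP[t0 tT'] := tT.
have sub x : `[0, t]%classic x -> 0 <= x <= T.
  by rewrite /= in_itv/= => /andP[-> /le_trans]; apply.
have [c1 c2] := mode_ccvg v_cvg tT k0.
pose B := (absz k)%:R / 2 * X.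
have rhsB j x : `[0, t]%classic x -> normc (toC (galerkin_rhs (phi j) (v j x) k x)) <= B.
  by move=> /sub/andP[x0 _]; exact: (galerkin_rhs_bound s0_gt0 v0H (vmG (phi j))).
have mrhs j : measurable_fun `[0, t] (fun x => (galerkin_rhs (phi j) (v j x) k x).1) /\
              measurable_fun `[0, t] (fun x => (galerkin_rhs (phi j) (v j x) k x).2).
  have [h1 h2] := galerkin_rhs_continuous (vmG (phi j)) k.
  by split; apply: subspace_continuous_measurable_fun; try exact: measurable_itv;
    exact: (continuous_subspaceW (@half_line_itv R t)).
have int_eq j : csub (v j t k) (v0 k) =
   (\int[mu]_(x in `[0, t]) (galerkin_rhs (phi j) (v j x) k x).1,
    \int[mu]_(x in `[0, t]) (galerkin_rhs (phi j) (v j x) k x).2).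
  exact: (galerkin_integral (vmG (phi j)) k0 t0).
have c0 : k%:~R / 2 != 0 :> R by rewrite mulf_neq0 ?invr_eq0 ?intr_eq0 ?pnatr_eq0.
have lim1 x : `[0, t]%classic x ->
    (fun j => (galerkin_rhs (phi j) (v j x) k x).1) @ \oo --> - (k%:~R / 2) * NIm (vinf x) k x.
  move=> /sub xT; have [h _] := galerkin_rhs_cvg k xT.
  have e : complex.Re ('i * (k%:~R / 2)%:C * conv_lim (vinf x) k x) = - (k%:~R / 2) * NIm (vinf x) k x.
    by rewrite /=; ring.
  by rewrite -e.
have lim2 x : `[0, t]%classic x ->
    (fun j => (galerkin_rhs (phi j) (v j x) k x).2) @ \oo --> k%:~R / 2 * NRe (vinf x) k x.
  move=> /sub xT; have [_ h] := galerkin_rhs_cvg k xT.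
  have e : complex.Im ('i * (k%:~R / 2)%:C * conv_lim (vinf x) k x) = k%:~R / 2 * NRe (vinf x) k x.
    by rewrite /=; ring.
  by rewrite -e.
have [i1 l1] := bounded_Rintegral_cvg (fun j => (mrhs j).1)
  (fun j x xt => le_trans (Re_le_normc _) (rhsB j x xt)) lim1.
have [i2 l2] := bounded_Rintegral_cvg (fun j => (mrhs j).2)
  (fun j x xt => le_trans (Im_le_normc _) (rhsB j x xt)) lim2.
have mt : measurable (`[0, t] : set R) by exact: measurable_itv.
rewrite Rintegral_scale ?oppr_eq0// in l1; rewrite Rintegral_scale// in l2.
rewrite /cmul /csub /= !mul0r sub0r add0r -mulNr; congr (_, _).
  have h : (fun j => (v j t k).1 - (v0 k).1) @ \oo --> (vinf t k).1 - (v0 k).1.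
    by apply: cvgB; [exact: c1|exact: cvg_cst].
  rewrite -(cvg_lim (@Rhausdorff R) h) -(cvg_lim (@Rhausdorff R) l1); congr (limn _).
  by apply/funext => j; have [] := int_eq j.
have h : (fun j => (v j t k).2 - (v0 k).2) @ \oo --> (vinf t k).2 - (v0 k).2.
  by apply: cvgB; [exact: c2|exact: cvg_cst].
rewrite -(cvg_lim (@Rhausdorff R) h) -(cvg_lim (@Rhausdorff R) l2); congr (limn _).
by apply/funext => j; have [] := int_eq j.
Qed.

End Solution.

Local Close Scope complex_scope.

Theorem theorem4p6 (R : realType) (s0 : R) (hs0 : 0 < s0) :
  exists M : R -> R -> R -> R,
  forall (T sigma : R) (v0 : seqZ R) (vm : nat -> R -> seqZ R),
    0 < T -> 0 < sigma -> sigma < s0 -> inH s0 v0 ->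
    (forall m : nat, galerkin_solution m (vm m) v0) ->
    exists (phi : nat -> nat) (vinf : R -> seqZ R),
      (forall a b : nat, (a < b)%N -> (phi a < phi b)%N) /\
      [/\
          (* strong convergence in L_p([0,T]; \dot H^sigma), every 1 < p < oo *)
          (forall p : R, 1 < p ->
             (fun n => (\int[(@lebesgue_measure R)]_(t in `[0%R, T]%classic)
                 (Hnorm sigma (seqZ_sub (vm (phi n) t) (vinf t)) `^ p))%E)
             @ \oo --> 0%E),
          (* weak-* convergence in L_infty([0,T]; \dot H^s0) = (L_1([0,T]; \dot H^{-s0}))^* *)
          (forall g : R -> seqZ R, inL1H (- s0) T g ->
             (fun n => \int[(@lebesgue_measure R)]_(t in `[0%R, T]%classic) Hpair (vm (phi n) t) (g t))
             @ \oo --> \int[(@lebesgue_measure R)]_(t in `[0%R, T]%classic) Hpair (vinf t) (g t)),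
          is_solution T vinf v0,
          {ae (@lebesgue_measure R), forall t, `[0, T]%classic t ->
             (Hnorm s0 (vinf t) <= (M (fine (Hnorm 0 v0)) T (fine (Hnorm s0 v0)))%:E)%E}
        & {ae (@lebesgue_measure R), forall t, `[0, T]%classic t ->
             Hnorm 0 (vinf t) = Hnorm 0 v0}].
Proof.
exists (apriori s0) => T sigma v0 vm T0 _ sigma_lt v0H vmG.
pose X := fine (Hnorm2 0 v0).
pose Y := growth s0 (fine (Hnorm 0 v0)) T * fine (Hnorm s0 v0) ^+ 2.
have v0X : Hnorm2 0 v0 = X%:E by rewrite -Hnorm2_fine// (inH_Hnorm2_0 hs0 v0H).
(* Real and imaginary parts are treated as separate scalar families. The value 0 is assigned at the
   mode 0, where nothing is known, so that the bounds hold for every index. *)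
pose f m (q : int * bool) t : R :=
  if q.1 == 0 then 0 else if q.2 then (vm m t q.1).1 else (vm m t q.1).2.
have fB m q t : 0 <= t <= T -> `|f m q t| <= Num.sqrt X.
  move=> /andP[t0 _]; rewrite /f; case: eqVneq => [_|q0]; first by rewrite normr0 sqrtr_ge0.
  have h := galerkin_mode_bound hs0 v0H (vmG m) t0 q0.
  by case: ifP => _; [apply: le_trans (Re_le_normc _) h|apply: le_trans (Im_le_normc _) h].
have fL m q s t : 0 <= s <= T -> 0 <= t <= T ->
    `|f m q t - f m q s| <= (absz q.1)%:R / 2 * X * `|t - s|.
  move=> /andP[s_ge0 _] /andP[t_ge0 _]; rewrite /f; case: eqVneq => [->|q0].
    by rewrite subrr normr0 !mul0r.
  by have [h1 h2] := galerkin_lipschitz hs0 v0H (vmG m) q0 s_ge0 t_ge0; case: ifP.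
have [phi [g [phi_mono fg]]] := equicontinuous_subsequence T0 fB fL.
(* The definition of a solution requires measurability at every k, including 0; hence the explicit
   value there. *)
pose vinf t k : cplx R := if k == 0 then (0, 0) else (g (k, true) t, g (k, false) t).
have phi_ge j : (j <= phi j)%N.
  by elim: j => // j; move=> /leq_ltn_trans; apply; exact: phi_mono.
have v_cvg k : k != 0 -> forall e : R, 0 < e -> exists J, forall j, (J <= j)%N ->
    forall t, 0 <= t <= T -> cabs2 (csub (vm (phi j) t k) (vinf t k)) <= e.
  (* Each of the two parts contributes at most e / 2 to the squared modulus. *)
  move=> k0 e e0; have e2 : 0 < Num.sqrt (e / 2) by rewrite sqrtr_gt0 divr_gt0.
  have [J1 h1] := fg (k, true) _ e2; have [J2 h2] := fg (k, false) _ e2.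
  exists (maxn J1 J2) => j; rewrite geq_max => /andP[l1 l2] t tT.
  have := h1 j l1 t tT; have := h2 j l2 t tT; rewrite /f /vinf (negbTE k0) /=.
  have small (z : R) : `|z| <= Num.sqrt (e / 2) -> z ^+ 2 <= e / 2.
    move=> h; rewrite -(real_normK (num_real z)) -[leRHS]sqr_sqrtr; last first.
      by rewrite divr_ge0// ltW.
    by apply: lerXn2r h; rewrite nnegrE ?sqrtr_ge0.
  by move=> /small s2 /small s1; rewrite /cabs2 /= (splitr e) lerD.
have vX j t N : 0 <= t <= T -> Hsum 0 (vm (phi j) t) N <= X.
  by move=> /andP[t0 _]; exact: (galerkin_Hsum0 hs0 v0H (vmG (phi j))).
have vY j t N : 0 <= t <= T -> Hsum s0 (vm (phi j) t) N <= Y.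
  by move=> tT; exact: (galerkin_apriori hs0 v0H (vmG (phi j))).
have v_meas j : mode_meas `[0, T] (vm (phi j)).
  move=> k k0; have [_ c1 c2 _] := vmG (phi j) k k0.
  by split; apply: subspace_continuous_measurable_fun; try exact: measurable_itv;
    exact: (continuous_subspaceW (@half_line_itv R T)).
have itvT t : `[0, T]%classic t -> 0 <= t <= T by rewrite /= in_itv.
have X_bound t : 0 <= t <= T -> (Hnorm 0 (vinf t) <= (Num.sqrt X)%:E)%E.
  by move=> tT; apply: Hnorm_le => N; exact: limit_Hsum0 vX v_cvg _ _ tT.
have energy t : 0 <= t <= T -> Hnorm2 0 (vinf t) = Hnorm2 0 v0.
  apply: (limit_conserved hs0 vX vY v_cvg v0X) => j s /andP[s_ge0 _].
  by exists (phi j) => N; exact: (galerkin_conserved v0H (vmG (phi j)) s_ge0).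
exists phi, vinf; split; first exact: phi_mono.
split.
- by move=> p; apply: (strong_convergence T0 vY v_cvg v_meas sigma_lt).
- by move=> h; apply: (weak_star_convergence vY v_cvg v_meas).
- split.
  + move=> k; have [->|k0] := eqVneq k 0; last exact: limit_meas v_cvg v_meas k k0.
    by rewrite /vinf eqxx; split; exact: measurable_cst.
  + move=> t /itvT; apply: (limit_real v_cvg) => j s /andP[s_ge0 _].
    exact: galerkin_real (vmG (phi j)) v0H.1 _ s_ge0.
  + by exists (Num.sqrt X); apply: aeW => t /itvT; exact: X_bound.
  + move=> k k0 t /itvT tT; exact: (limit_integral_eq hs0 v0H vmG phi_ge vY v_cvg).
- apply: aeW => t /itvT tT; apply: Hnorm_le => N; exact: limit_Hsum vY v_cvg _ _ tT.
- by apply: aeW => t /itvT tT; rewrite /Hnorm energy.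
Qed.
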